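(* Let $\mathcal{X}\subset\mathbb{R}$ be compact, $\Omega_1=[0,\overline{\tau}_1]\times[0,\overline{\tau}_2]$ for given $\overline{\tau}_1,\overline{\tau}_2>0$, and $\Omega_2\subset\mathbb{R}_{+}$ compact. Take $h_1(X,\theta_1)=(\theta_1^{(1)}+\theta_1^{(2)}X)^2$ and $h_2$ with $h_2^2(X,\theta_2)=\theta_2$. Let $(X_i,Y_i)_{i=1}^n$ be i.i.d. from $p_{G_0}$ where $G_0=\sum_{i=1}^{k_0}\pi_i^0\delta_{(\theta_{1i}^0,\theta_{2i}^0)}$ has exactly $k_0$ distinct atoms in $\Omega$, $\pi_i^0\ge\overline{c}_0$, and $G_0$ satisfies nonlinearity setting II: there is an index $i$ with $(\theta_{1i}^0)^{(1)}\ne0$ and $(\theta_{1i}^0)^{(2)}=0$. Let $k>k_0$ and $\widehat{G}_n\in\arg\max_{G\in\mathcal{O}_{k,\overline{c}_0}(\Omega)}\sum_{i=1}^n\log g_G(Y_i\mid X_i)$. Define $\mathcal{A}=\{i\in\{1,\ldots,k_0\}:(\theta_{1i}^0)^{(1)}\ne0,\ (\theta_{1i}^0)^{(2)}=0\}$, $i_{\max}\in\arg\max_{i\in\mathcal{A}}\widetilde{r}((\theta_{1i}^0)^{(1)},k-k_0+1)$, and $\widetilde{r}_{\sin}=\widetilde{r}((\theta_{1i_{\max}}^0)^{(1)},k-k_0+1)$. Then there exist a positive constant $C_0$ depending only on $G_0$ and $\Omega$, a positive constant $c$ depending only on $\Omega$, and $C'>0$ independent of $n$ such that $$\mathbb{P}\Big(\widetilde{W}_{\kappa}(\widehat{G}_n,G_0)>C_0(\log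 n/n)^{1/(2\widetilde{r}_{\sin})}\Big)\le C'\exp(-c\log n),\qquad\kappa=(\widetilde{r}_{\sin},2,\lceil\widetilde{r}_{\sin}/2\rceil).$$
   Context: $f(y\mid\mu,\sigma)$ is the univariate Gaussian density with mean $\mu$ and standard deviation $\sigma$. $X$ has a given density $\overline{f}$ on $\mathcal{X}$. $\Omega=\Omega_1\times\Omega_2$. For $G=\sum_i\pi_i\delta_{(\theta_{1i},\theta_{2i})}$, $g_G(Y\mid X)=\sum_i\pi_i f(Y\mid h_1(X,\theta_{1i}),h_2(X,\theta_{2i}))$, $p_G(X,Y)=g_G(Y\mid X)\overline{f}(X)$. $\mathcal{O}_k(\Omega)$: discrete probability measures on $\Omega$ with at most $k$ atoms; $\mathcal{O}_{k,\overline{c}_0}(\Omega)$: those with all weights $\ge\overline{c}_0$, for a given sufficiently small $\overline{c}_0>0$. Polynomials $P_u^{(\gamma_1)}$: for $\gamma_1\in\mathbb{N}$ and $0\le u\le\lfloor\gamma_1/2\rfloor$, $P_u^{(\gamma_1)}(t)$ are the polynomials in $t$ such that for every smooth $g:\mathbb{R}\to\mathbb{R}$, $\frac{d^{\gamma_1}}{dt^{\gamma_1}}g(t^2)=\sum_{u=0}^{\lfloor\gamma_1/2\rfloor}P_u^{(\gamma_1)}(t)\,g^{(\lceil\gamma_1/2\rceil+u)}(t^2)$ (so $P_0^{(0)}=1$, $P_0^{(1)}(t)=2t$, $P_0^{(2)}=2$, $P_1^{(2)}(t)=4t^2$); equivalently, these describe $\partial^{\gamma_1}f/\partial(\theta_1^{(1)})^{\gamma_1}$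 at $\theta_1^{(2)}=0$ in terms of derivatives of $f$ in its location argument. System of polynomial limits: given $s\in\mathbb{N}$, $t\ne0$, $r\in\mathbb{N}$, consider sequences $a_{i,n}\to0$, $b_{i,n}\to0$, $c_{i,n}\ge0$ ($1\le i\le s$) with $\sum_i c_{i,n}\le\overline{c}$ for a fixed $\overline{c}>0$, such that for every $l\in\{1,\ldots,2r\}$, $$\frac{\sum_{(\gamma_1,\gamma_2,u)\in I_l}\frac{P_u^{(\gamma_1)}(t)}{2^{\gamma_2}}\sum_{i=1}^s c_{i,n}\frac{a_{i,n}^{\gamma_1}b_{i,n}^{\gamma_2}}{\gamma_1!\gamma_2!}}{\sum_{i=1}^s c_{i,n}(|a_{i,n}|^r+|b_{i,n}|^{\lceil r/2\rceil})}\to0\quad(n\to\infty),$$ where $I_l$ is the set of $(\gamma_1,\gamma_2,u)\in\mathbb{N}^3$ with $\gamma_1+\gamma_2\le r$, $0\le u\le\lfloor\gamma_1/2\rfloor$, and $\lceil\gamma_1/2\rceil+u+2\gamma_2=l$. $\widetilde{r}(t,s)$ is the smallest positive integer $r$ for which no choice of such sequences satisfies all these limits. Generalized transportation distance: $d_\kappa(\eta,\eta')=(\sum_i|\eta^{(i)}-\eta'^{(i)}|^{\kappa_i})^{1/\|\kappa\|_\infty}$, $\widetilde{W}_\kappa(G,G')=(\inf_q\sum_{i,j}q_{ij}d_\kappa^{\|\kappa\|_\infty}(\eta_i,\eta'_j))^{1/\|\kappa\|_\infty}$ over couplings $q$ of the weight vectors; atoms ordered as $\eta=(\theta_1^{(1)},\theta_1^{(2)},\theta_2)$.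 *)

(* Defs.v *)
From HB Require Import structures.
From mathcomp Require Import all_boot all_order all_algebra.
From mathcomp Require Import all_classical all_reals all_analysis.
Set Implicit Arguments. Unset Strict Implicit. Unset Printing Implicit Defensive.
Import Order.TTheory GRing.Theory Num.Theory.
Import numFieldNormedType.Exports.
Local Open Scope classical_set_scope.
Local Open Scope ring_scope.

Section Defs.
Variable R : realType.

Definition gauss (y mu sigma : R) : R :=
  (sigma * Num.sqrt (2 * pi))^-1 * expR (- (y - mu) ^+ 2 / (2 * sigma ^+ 2)).

(* A finitely supported mixing measure G = sum_i w_i delta_{eta_i};
   an atom eta = ((theta1^(1), theta1^(2)), theta2). *)
Record mixmeas := MixMeas {
  mnum : nat;
  mwt : 'I_mnum -> R;
  matom : 'I_mnum -> (R * R) * R }.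
Arguments mwt : clear implicits.
Arguments matom : clear implicits.

Definition h1 (x : R) (th1 : R * R) : R := (th1.1 + th1.2 * x) ^+ 2.
Definition h2 (x : R) (th2 : R) : R := Num.sqrt th2.

Definition gmix (G : mixmeas) (x y : R) : R :=
  \sum_(i < mnum G) mwt G i * gauss y (h1 x (matom G i).1) (h2 x (matom G i).2).

Definition inOmega (tau1 tau2 : R) (Om2 : set R) (eta : (R * R) * R) : Prop :=
  [/\ 0 <= eta.1.1 <= tau1, 0 <= eta.1.2 <= tau2 & Om2 eta.2].

Definition inOkc (tau1 tau2 : R) (Om2 : set R) (k : nat) (cbar0 : R)
    (G : mixmeas) : Prop :=
  [/\ (mnum G <= k)%N, injective (matom G), (forall i, cbar0 <= mwt G i),
      \sum_(i < mnum G) mwt G i = 1 & (forall i, inOmega tau1 tau2 Om2 (matom G i))].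

Definition loglik (G : mixmeas) (Xs Ys : nat -> R) (n : nat) : R :=
  \sum_(j < n) ln (gmix G (Xs j) (Ys j)).

Definition is_MLE tau1 tau2 Om2 k cbar0 (G : mixmeas) (Xs Ys : nat -> R) n : Prop :=
  inOkc tau1 tau2 Om2 k cbar0 G /\
  forall G', inOkc tau1 tau2 Om2 k cbar0 G' -> loglik G' Xs Ys n <= loglik G Xs Ys n.

Definition kappa_norm (kappa : nat * nat * nat) : nat :=
  maxn kappa.1.1 (maxn kappa.1.2 kappa.2).

Definition dkappa_pow (kappa : nat * nat * nat) (eta eta' : (R * R) * R) : R :=
  `|eta.1.1 - eta'.1.1| ^+ kappa.1.1 + `|eta.1.2 - eta'.1.2| ^+ kappa.1.2
  + `|eta.2 - eta'.2| ^+ kappa.2.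

Definition is_coupling (G G' : mixmeas) (q : 'I_(mnum G) -> 'I_(mnum G') -> R) : Prop :=
  [/\ (forall i j, 0 <= q i j),
      (forall i, \sum_(j < mnum G') q i j = mwt G i) &
      forall j, \sum_(i < mnum G) q i j = mwt G' j].

Definition Wkappa (kappa : nat * nat * nat) (G G' : mixmeas) : R :=
  (inf [set x | exists q, is_coupling q /\
      x = \sum_(i < mnum G) \sum_(j < mnum G') q i j * dkappa_pow kappa (matom G i) (matom G' j)])
  `^ ((kappa_norm kappa)%:R^-1).

(* Polynomials P_u^{(gamma1)}: Qpoly g j is the coefficient of g^{(j)}(t^2) in
   d^g/dt^g [g(t^2)], obtained by repeated differentiation:
   d/dt [Q(t) g^{(j)}(t^2)] = Q'(t) g^{(j)}(t^2) + 2 t Q(t) g^{(j+1)}(t^2). *)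
Fixpoint Qpoly (g j : nat) : {poly R} :=
  match g with
  | 0 => if j == 0%N then 1 else 0
  | g'.+1 => deriv (Qpoly g' j) +
             (match j with 0 => 0 | j'.+1 => 'X *+ 2 * Qpoly g' j' end)
  end.

Definition Ppoly (g1 u : nat) : {poly R} := Qpoly g1 (uphalf g1 + u).

Definition sys_num (t : R) (s r l : nat) (a b c : 'I_s -> R) : R :=
  \sum_(g1 < r.+1) \sum_(g2 < r.+1) \sum_(u < r.+1 |
       [&& (g1 + g2 <= r)%N, (u <= g1./2)%N & (uphalf g1 + u + 2 * g2 == l)%N])
    ((Ppoly g1 u).[t] / 2 ^+ g2 *
      \sum_(i < s) c i * (a i ^+ g1 * b i ^+ g2) / ((g1`!)%:R * (g2`!)%:R)).

Definition sys_den (s r : nat) (a b c : 'I_s -> R) : R :=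
  \sum_(i < s) c i * (`|a i| ^+ r + `|b i| ^+ (uphalf r)).

Definition sys_solvable (t : R) (s r : nat) : Prop :=
  exists cbar : R, 0 < cbar /\
  exists a b c : nat -> 'I_s -> R,
    [/\ (forall i, (fun n => a n i) @ \oo --> (0 : R)),
        (forall i, (fun n => b n i) @ \oo --> (0 : R)),
        (forall n i, 0 <= c n i),
        (forall n, \sum_(i < s) c n i <= cbar) /\
          (forall n, 0 < sys_den r (a n) (b n) (c n)) &
        forall l, (1 <= l <= 2 * r)%N ->
          (fun n => sys_num t r l (a n) (b n) (c n) / sys_den r (a n) (b n) (c n))
            @ \oo --> (0 : R)].

(* \widetilde r(t, s): smallest positive r for which the system has no solution
   (0 if there is none; the theorem assumes existence) *)
Definition rtilde_pred (t : R) (s : nat) : pred nat :=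
  fun r => `[< (0 < r)%N /\ ~ sys_solvable t s r >].

Definition rtilde (t : R) (s : nat) : nat :=
  match pselect (exists r, rtilde_pred t s r) with
  | left H => ex_minn H
  | right _ => 0%N
  end.

End Defs.

(* Main.v *)
(* A Gaussian mixture is determined by its moment generating functions. Let Delta_G(n, x) be
   the difference of those of g_G(. | x) and g_G0(. | x) at n. The functions hexp n x e of (n, x),
   for e in the quadrant, are linearly independent over polynomials because they grow at
   different rates in n. Near an atom of G_0 expand hexp in powers of n and x: at a singular atom
   the coefficients of n^l x^0 are the numerators of the polynomial system, which control the
   error because the system has no solution at order r~; elsewhere the second-order coefficients
   control the squared error. With compactness far from G_0, this bounds the r~_sin-th power of
   the distance by finitely many int fbar |Delta_G(n, .)|, with a constant free of c_0. AM-GM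
   with weight e^(n y) bounds these by a multiple of eps when the affinity of G and G_0 is at
   least 1 - eps^2. Finally, the MLE has affinity at least 1 - A log n / n off an event of
   probability O(1 / n): split the parameters into polynomially many cells on which the
   likelihood is constant up to a bounded factor, and apply Markov's inequality to
   prod sqrt(g_G / g_G0) for one G per cell. *)
Require Import Defs.
From HB Require Import structures.
From mathcomp Require Import all_boot all_order all_algebra.
From mathcomp Require Import all_classical all_reals all_analysis.
From mathcomp Require Import measurable_realfun ring lra zify.
Import Order.TTheory GRing.Theory Num.Theory.
Import numFieldNormedType.Exports.
Local Open Scope classical_set_scope.
Local Open Scope ring_scope.
Set Implicit Arguments. Unset Strict Implicit. Unset Printing Implicit Defensive.

(** * Linear independence of Gaussian moment generating functions *)

(** Several atoms of G may sit near one atom of G_0. Only weighted sums of their expansion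
    coefficients are then visible, and first-order terms can cancel; a bound has to come from linear
    combinations that keep a sign, or from the polynomial system. At a singular atom the slope lies
    on the boundary of the quadrant, so its increments are nonnegative and cannot cancel: they are
    controlled linearly, and what remains is the system in intercept and variance. The lower bound
    on the weights acts through compactness: limits of admissible mixtures keep positive weights, so
    no atom of G strays and every atom of G_0 keeps a neighbour, which leaves at most k - k_0 + 1
    atoms of G around each. It fixes the radius of the local regime and the constant of the
    probability bound. Orders 1 and 2 of the system are solvable by two atoms, hence r~ is at least
    3; this is what makes r~_sin the largest entry of kappa and lets the squared error at regular
    atoms dominate the powers r~_sin and ceil(r~_sin / 2). *)

Lemma ler_normD2 (R : numDomainType) (a b c d : R) :
  `|a| <= c -> `|b| <= d -> `|a + b| <= c + d.
Proof. by move=> ac bd; rewrite (le_trans (ler_normD _ _))// lerD. Qed.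

Section LinearIndependence.
Variable R : realType.

Lemma poly_bound_nat (p : {poly R}) (n : nat) : (0 < n)%N ->
  `|p.[n%:R]| <= (\sum_(i < size p) `|p`_i|) * n%:R ^+ size p.
Proof.
move=> n0; rewrite horner_coef (le_trans (ler_norm_sum _ _ _))// mulr_suml.
apply: ler_sum => i _; rewrite normrM ler_wpM2l// normrX ger0_norm//.
by rewrite ler_weXn2l// ?ler1n// ltnW.
Qed.

(** The quadratic rate [b] decides unless it vanishes, so the exponent is eventually at most [- n d]
    for some [d > 0]. The term of order [s + 1] of the exponential series then beats a polynomial
    with [s] coefficients, with a factor [n] to spare. *)
Lemma poly_expR_decay (p : {poly R}) (a b eps : R) : 0 < eps ->
  (b < 0) || ((b == 0) && (a < 0)) ->
  \forall n \near \oo, `|p.[n%:R]| * expR (n%:R * a + n%:R ^+ 2 * b) <= eps.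
Proof.
move=> eps0 hab.
have [d d0 hd] : exists2 d : R, 0 < d &
    \forall n \near \oo, n%:R * a + n%:R ^+ 2 * b <= - (n%:R * d).
  case/orP: hab => [b0|/andP[/eqP-> a0]].
    exists 1 => //; near=> n.
    have hn : (a + 1) / (- b) <= n%:R by near: n; exact: nbhs_infty_ger.
    rewrite ler_pdivrMr ?oppr_gt0// in hn.
    have : 0 <= n%:R :> R by [].
    rewrite mulr1; nra.
  exists (- a); first by rewrite oppr_gt0.
  by near=> n; rewrite mulr0 addr0 mulrN opprK.
set s := size p; set C := \sum_(i < size p) `|p`_i|.
have C0 : 0 <= C by apply: sumr_ge0.
near=> n.
have n0 : (0 < n)%N by near: n; exact: nbhs_infty_gt.
have hn : n%:R * a + n%:R ^+ 2 * b <= - (n%:R * d) by near: n.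
have hN : C * (s.+1)`!%:R / (d ^+ s.+1) / eps <= n%:R.
  by near: n; exact: nbhs_infty_ger.
apply: le_trans (_ : C * n%:R ^+ s * expR (- (n%:R * d)) <= _).
  by apply: ler_pM => //; [exact: poly_bound_nat|rewrite ler_expR].
rewrite expRN ler_pdivrMr ?expR_gt0//.
have nd0 : 0 <= n%:R * d by rewrite mulr_ge0// ltW.
have h1 := expR_ge1Dxn s nd0.
have : (n%:R * d) ^+ s.+1 / s.+1`!%:R <= expR (n%:R * d).
  by apply: le_trans h1; rewrite lerDr.
move=> h2; apply: le_trans (_ : eps * ((n%:R * d) ^+ s.+1 / s.+1`!%:R) <= _); last first.
  by rewrite ler_pM2l.
have f0 : 0 < (s.+1)`!%:R :> R by rewrite ltr0n fact_gt0.
rewrite mulrA ler_pdivlMr// exprMn mulrCA (exprS n%:R).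
move: hN; rewrite ler_pdivrMr// ler_pdivrMr ?exprn_gt0// => hN.
have ns0 : 0 <= n%:R ^+ s :> R by rewrite exprn_ge0.
have := ler_wpM2r ns0 hN.
rewrite (_ : C * n%:R ^+ s * _ = C * (s.+1)`!%:R * n%:R ^+ s); last by ring.
by move=> /le_trans; apply; rewrite le_eqVlt; apply/orP; left; apply/eqP; ring.
Unshelve. all: by end_near.
Qed.

(** The leading coefficient itself is the bound: in Horner's scheme, the constant term [c] is
    absorbed as soon as [n >= 1 + |c| / lead_coef q]. *)
Lemma poly_lower_bound (p : {poly R}) : p != 0 ->
  exists2 c : R, 0 < c & \forall n \near \oo, c <= `|p.[n%:R]|.
Proof.
move=> p0.
have aux (q : {poly R}) : 0 < lead_coef q ->
    \forall n \near \oo, lead_coef q <= `|q.[n%:R]|.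
  elim/poly_ind: q => [|q c IHq]; first by rewrite lead_coef0 ltxx.
  have [->|q0] := eqVneq q 0.
    rewrite mul0r add0r lead_coefC => c0; near=> n.
    by rewrite hornerC ger0_norm// ltW.
  rewrite lead_coefDl ?size_mulX ?size_polyC // ?lead_coefMX; last first.
    by apply: (leq_trans (leq_b1 _)); rewrite size_poly_gt0.
  move=> lq; have := IHq lq => hq; near=> n.
  have h1 : lead_coef q <= `|q.[n%:R]| by near: n.
  have h2 : 1 + `|c| / lead_coef q <= n%:R by near: n; exact: nbhs_infty_ger.
  rewrite !hornerE.
  have h3 : `|q.[n%:R]| * n%:R - `|c| <= `|q.[n%:R] * n%:R + c|.
    have := lerB_dist (q.[n%:R] * n%:R) (- c).
    by rewrite opprK normrN normrM (ger0_norm (ler0n _ n)).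
  apply: le_trans h3; rewrite lerBrDr.
  apply: le_trans (_ : lead_coef q * (1 + `|c| / lead_coef q) <= _).
    by rewrite mulrDr mulr1 mulrCA divff ?gt_eqF// mulr1.
  by apply: ler_pM => //; [exact: ltW|rewrite addr_ge0// divr_ge0// ltW].
have [lp|lp] := ltP 0 (lead_coef p).
  by exists (lead_coef p) => //; exact: aux.
have lp' : 0 < lead_coef (- p).
  by rewrite lead_coefN oppr_gt0 lt_neqAle lp andbT lead_coef_eq0.
exists (lead_coef (- p)) => //; have := aux _ lp'.
by apply: filterS => n; rewrite hornerN normrN.
Unshelve. all: by end_near.
Qed.

(** Order the terms lexicographically by [(v, mu)]. After division by the exponential of the largest
    term with nonzero polynomial, all other terms decay, while that polynomial stays away from zero
    along the naturals. *)
Lemma gauss_mgf_free (I : finType) (mu v : I -> R) (p : I -> {poly R}) :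
  (forall i j, mu i = mu j -> v i = v j -> i = j) ->
  (forall n : nat,
     \sum_i (p i).[n%:R] * expR (n%:R * mu i + n%:R ^+ 2 * v i) = 0) ->
  forall i, p i = 0.
Proof.
move=> inj H i0; apply/eqP; apply: contraT => pi0.
have [i1 pi1 max1] : exists2 i1, p i1 != 0 & forall i, p i != 0 -> v i <= v i1.
  by case: (@Order.TotalTheory.arg_maxP _ _ _ i0 (fun i => p i != 0) v pi0) => i ? ?; exists i.
have h1 : (p i1 != 0) && (v i1 == v i1) by rewrite pi1 eqxx.
have [i2 /andP[pi2 /eqP vi2] max2] : exists2 i2, (p i2 != 0) && (v i2 == v i1) &
    forall i, (p i != 0) && (v i == v i1) -> mu i <= mu i2.
  by case: (@Order.TotalTheory.arg_maxP _ _ _ i1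
    (fun i => (p i != 0) && (v i == v i1)) mu h1) => i ? ?; exists i.
have [c c0 hc] := poly_lower_bound pi2.
(* Fewer than [#|I| + 1] decaying terms of this size sum to less than [c]. *)
pose eps := c / (2 * (#|I|%:R + 1)).
have eps0 : 0 < eps by rewrite divr_gt0// mulr_gt0// ltr_wpDl.
have hn : \forall n \near \oo, forall i, i != i2 ->
    `|(p i).[n%:R]| * expR (n%:R * (mu i - mu i2) + n%:R ^+ 2 * (v i - v i2)) <= eps.
  apply: filter_forall => i; have [->|ii2] := eqVneq i i2; first by near=> n.
  have [->|pin0] := eqVneq (p i) 0.
    by near=> n => _; rewrite horner0 normr0 mul0r ltW.
  suff : (v i - v i2 < 0) || ((v i - v i2 == 0) && (mu i - mu i2 < 0)).
    by move=> /(poly_expR_decay (p i) eps0); apply: filterS.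
  rewrite !subr_lt0 subr_eq0 lt_neqAle vi2 (max1 _ pin0) andbT.
  have [vii /=|//] := eqVneq (v i) (v i1).
  rewrite lt_neqAle max2 ?pin0 ?vii ?eqxx// andbT.
  by apply: contra_neq ii2 => mm; apply: inj => //; rewrite vii vi2.
near \oo => n.
have c1 : c <= `|(p i2).[n%:R]| by near: n.
have hn2 : forall i, i != i2 ->
    `|(p i).[n%:R]| * expR (n%:R * (mu i - mu i2) + n%:R ^+ 2 * (v i - v i2)) <= eps.
  by near: n.
move: (H n); rewrite (bigD1 i2)//= => /eqP; rewrite addr_eq0 => /eqP Hn.
have : `|(p i2).[n%:R]| <= \sum_(i | i != i2) eps.
  have -> : (p i2).[n%:R] = - \sum_(i | i != i2) (p i).[n%:R] *
      expR (n%:R * (mu i - mu i2) + n%:R ^+ 2 * (v i - v i2)).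
    apply: (mulIf (lt0r_neq0 (expR_gt0 (n%:R * mu i2 + n%:R ^+ 2 * v i2)))).
    rewrite Hn mulNr mulr_suml; congr (- _); apply: eq_bigr => i _.
    by rewrite -[RHS]mulrA -expRD; congr (_ * expR _); ring.
  rewrite normrN (le_trans (ler_norm_sum _ _ _))//; apply: ler_sum => i ii2.
  by rewrite normrM (ger0_norm (expR_ge0 _)) hn2.
rewrite sumr_const => h; have := le_trans c1 h.
rewrite leNgt => /negP[].
rewrite (@le_lt_trans _ _ (eps *+ #|I|))//.
  by rewrite ler_wpMn2l// ?(ltW eps0)// max_card.
rewrite -mulr_natr /eps mulrAC ltr_pdivrMr ?mulr_gt0// ?ltr_wpDl//.
have : 0 <= #|I|%:R :> R by [].
nra.
Unshelve. all: by end_near.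
Qed.

(* The value at [lam] of the moment generating function of the Gaussian component with
   mean [h1 x e.1] and variance [e.2]. *)
Definition hexp (lam x : R) (e : R * R * R) : R :=
  expR (lam * h1 x e.1 + lam ^+ 2 * (e.2 / 2)).

Lemma hexp_le (lam x a b v B : R) (e : R * R * R) : `|e.1.1| <= a -> `|e.1.2| <= b ->
  `|e.2| <= v -> `|x| <= B -> hexp lam x e <= expR (`|lam| * (a + b * B) ^+ 2 + lam ^+ 2 * (v / 2)).
Proof.
move=> ea eb ev xB; rewrite ler_expR; apply: lerD; last first.
  by rewrite ler_wpM2l ?sqr_ge0// ler_wpM2r// (le_trans (ler_norm _)).
rewrite (le_trans (ler_norm _))// normrM ler_wpM2l// normrX lerXn2r ?nnegrE//.
  have p (u w : R) : `|u| <= w -> 0 <= w by exact: le_trans.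
  by rewrite addr_ge0 ?(p _ _ ea) ?mulr_ge0 ?(p _ _ eb) ?(p _ _ xB).
by apply: ler_normD2 => //; rewrite normrM; apply: ler_pM.
Qed.

(** The square in [h1] determines the affine form [a + b x] only up to sign; nonnegative coordinates
    fix the sign. *)
Definition quadrant (e : R * R * R) := (0 <= e.1.1) && (0 <= e.1.2).

Lemma h1_inj_quadrant (e f : R * R * R) : quadrant e -> quadrant f ->
  (forall x, h1 x e.1 = h1 x f.1) -> e.1 = f.1.
Proof.
case: e f => [[a b] u] [[a' b'] u'] /andP/=[a0 b0] /andP/=[a0' b0'] H.
have e0 := H 0; have e1 := H 1; move: e0 e1; rewrite /h1/= !mulr0 !addr0 !mulr1.
move/eqP; rewrite eqrXn2// => /eqP -> /eqP.
by rewrite eqrXn2// ?addr_ge0// => /eqP/addrI ->.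
Qed.

(** The outer variable of [c i] is the exponent [n], the inner one is [x]. Distinct atoms of equal
    variance may share their mean at exceptional points [x], exactly the zeros of the polynomial
    [D]. Elsewhere [gauss_mgf_free] applies at fixed [x]; hence [D] times each coefficient vanishes
    on [Z], where only the zero polynomial vanishes, and [D] cancels. *)
Lemma hexp_free (I : finType) (e : I -> R * R * R) (c : I -> {poly {poly R}})
    (Z : set R) : injective e -> (forall i, quadrant (e i)) ->
  (forall q : {poly R}, (forall x, Z x -> q.[x] = 0) -> q = 0) ->
  (forall x, Z x -> forall n : nat,
     \sum_i (c i).[n%:R%:P].[x] * hexp n%:R x (e i) = 0) ->
  forall i, c i = 0.
Proof.
move=> inj qe dense H i.
pose hp j : {poly R} := ((e j).1.1%:P + (e j).1.2 *: 'X) ^+ 2.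
have hpE j x : (hp j).[x] = h1 x (e j).1 by rewrite /hp /h1 !hornerE.
pose bad (ij : I * I) := (ij.1 != ij.2) && ((e ij.1).2 == (e ij.2).2).
pose D : {poly R} := \prod_(ij | bad ij) (hp ij.1 - hp ij.2).
have D0 : D != 0.
  rewrite /D prodf_seq_neq0; apply/allP => -[j j'] _ /=; apply/implyP.
  move=> /andP[/= jj' /eqP ejj']; rewrite subr_eq0; apply: contra_neq jj' => hh.
  apply: inj; rewrite [LHS]surjective_pairing [RHS]surjective_pairing ejj'.
  congr (_, _); apply: h1_inj_quadrant => // x.
  by rewrite -!hpE hh.
apply/polyP => l; rewrite coef0; apply: (mulfI D0); rewrite mulr0.
apply: dense => x Zx; rewrite hornerM.
have [->|Dx] := eqVneq D.[x] 0; first by rewrite mul0r.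
pose p j : {poly R} := map_poly (horner_eval x) (c j).
have pE j (n : nat) : (p j).[n%:R] = (c j).[n%:R%:P].[x].
  have -> : (n%:R : R) = horner_eval x (n%:R%:P) by rewrite /horner_eval hornerC.
  by rewrite /p horner_map /horner_eval hornerC.
have : p i = 0.
  apply: (@gauss_mgf_free _ (fun j => h1 x (e j).1) (fun j => (e j).2 / 2)).
    move=> j j' hj vj; apply/eqP; apply: contraNT Dx => jj'.
    rewrite /D horner_prod (bigD1 (j, j'))/=; last first.
      rewrite /bad/= jj'/=; apply/eqP; apply: (mulIf _ vj).
      by rewrite invr_eq0 pnatr_eq0.
    by rewrite hornerD hornerN !hpE hj subrr mul0r.
  by move=> n; rewrite -[RHS](H x Zx n); apply: eq_bigr => j _; rewrite pE.
move=> /polyP/(_ l); rewrite coef0 /p coef_map_id0 ?/horner_eval ?horner0//.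
by move=> ->; rewrite mulr0.
Qed.

End LinearIndependence.

(** * Separating seminorms: finitely many dominate the norm *)

Lemma cvgr_sum (R : realType) (T : Type) (F : set_system T) (I : Type) (r : seq I)
    (f : I -> T -> R) (l : I -> R) : Filter F ->
  (forall i, f i @ F --> l i) ->
  (fun x => \sum_(i <- r) f i x) @ F --> \sum_(i <- r) l i.
Proof.
move=> FF fl; apply: cvg_big => //.
by move=> x; exact: add_continuous.
Qed.

Section NormEquivalence.
Variables (R : realType) (J : finType) (p : nat -> (J -> R) -> R) (C : nat -> R).
Hypothesis p_ge0 : forall n u, 0 <= p n u.
Hypothesis p_lip : forall n u w, p n u <= p n w + C n * \sum_j `|u j - w j|.
Hypothesis pZ : forall n a u, p n (fun j => a * u j) = `|a| * p n u.
Hypothesis p_sep : forall u, (forall n, p n u = 0) -> forall j, u j = 0.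

(** At each point of the l1 unit sphere some seminorm is positive, and the Lipschitz bound keeps it
    so nearby. Compactness leaves finitely many seminorms, homogeneity extends the bound to all
    vectors. *)
Lemma seminorms_dominate : exists2 K : R, 0 < K &
  exists L, forall u, \sum_j `|u j| <= K * \sum_(n < L) p n u.
Proof.
pose uv (v : 'rV[R]_#|J|) j := v ord0 (enum_rank j).
pose S v := \sum_j `|uv v j|.
have Scont : continuous S.
  move=> v; apply: (@cvgr_sum _ _ (nbhs v)) => j.
  by apply: cvg_norm; exact: coord_continuous.
have dcont (v : 'rV[R]_#|J|) e : 0 < e ->
    \forall v' \near v, \sum_j `|uv v j - uv v' j| < e.
  move=> e0.
  have : (fun v' => \sum_j `|uv v j - uv v' j|) @ v --> \sum_j `|uv v j - uv v j|.
    apply: (@cvgr_sum _ _ (nbhs v)) => j; apply: cvg_norm; apply: cvgB; first exact: cvg_cst.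
    exact: coord_continuous.
  rewrite (_ : \sum_j `|uv v j - uv v j| = 0); last first.
    by apply: big1 => j _; rewrite subrr normr0.
  by move=> /cvgrPdist_lt/(_ _ e0); apply: filterS => v'; rewrite sub0r normrN;
    apply: le_lt_trans; exact: ler_norm.
have Kc : compact [set v : 'rV[R]_#|J| | forall i, `[(-1 : R), 1]%classic (v ord0 i)].
  by apply: (@rV_compact _ _ (fun=> `[(-1 : R), 1]%classic)) => _; exact: segment_compact.
(* In the near-covering form of compactness a single [n] tending to infinity is both the number of
   seminorms and the inverse of their lower bound. *)
have [L _ HL] : \forall n \near \oo,
   [set v : 'rV[R]_#|J| | forall i, `[(-1 : R), 1]%classic (v ord0 i)] `<=`
   (fun v => S v = 1 -> n.+1%:R^-1 <= \sum_(m < n) p m (uv v)).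
  move/compact_near_coveringP : Kc; apply => v _.
  have [Sv|Sv] := eqVneq (S v) 1; last first.
    have : \forall v' \near v, S v' != 1.
      have := Scont v; move/cvgrPdist_lt => /(_ `|S v - 1|).
      rewrite normr_gt0 subr_eq0 => /(_ Sv); apply: filterS => v' h.
      by apply/eqP => Sv'; move: h; rewrite Sv' ltxx.
    move=> h; near=> v' n => /= Sv'; exfalso; move/eqP: Sv'; apply/negP.
    by near: v'.
  have [m pm] : exists m, 0 < p m (uv v).
    apply: contrapT => /forallNP H.
    have : forall n, p n (uv v) = 0.
      by move=> n; apply/eqP; rewrite eq_le p_ge0 andbT leNgt; apply/negP/H.
    move=> /p_sep uv0; move: Sv; rewrite /S big1 => [/eqP|j _].
      by rewrite eq_sym oner_eq0.
    by rewrite uv0 normr0.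
  (* Within this l1 radius the Lipschitz bound costs at most half of [p m (uv v)]. *)
  pose e := p m (uv v) / (2 * (`|C m| + 1)).
  have e0 : 0 < e by rewrite divr_gt0// mulr_gt0// ltr_wpDl.
  have := dcont v e e0 => hd; near=> v' n => /= Sv'.
  have hv' : \sum_j `|uv v j - uv v' j| < e by near: v'.
  have mn : (m < n)%N by near: n; exact: nbhs_infty_gt.
  rewrite (bigD1 (Ordinal mn))//= ler_wpDr ?sumr_ge0//.
  have hn : (p m (uv v) / 2)^-1 <= n%:R by near: n; exact: nbhs_infty_ger.
  apply: le_trans (_ : p m (uv v) / 2 <= _).
    rewrite invf_ple ?posrE ?divr_gt0//; apply: le_trans hn _.
    by rewrite ler_nat.
  have := p_lip m (uv v) (uv v').
  have : C m * \sum_j `|uv v j - uv v' j| <= p m (uv v) / 2.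
    apply: le_trans (_ : (`|C m| + 1) * e <= _).
      apply: le_trans (_ : `|C m| * \sum_j `|uv v j - uv v' j| <= _).
        by rewrite ler_wpM2r ?sumr_ge0// ler_norm.
      by apply: ler_pM => //; [exact: sumr_ge0|rewrite lerDl|exact: ltW].
    rewrite le_eqVlt /e; apply/orP; left; apply/eqP; field.
    by rewrite gt_eqF// ltr_wpDl.
  lra.
exists L.+1%:R => //; exists L => u.
set s := \sum_j `|u j|.
have s0 : 0 <= s by exact: sumr_ge0.
have [->|sn0] := eqVneq s 0; first by rewrite mulr_ge0// sumr_ge0.
have sgt0 : 0 < s by rewrite lt_neqAle eq_sym sn0.
pose v : 'rV[R]_#|J| := \row_i (s^-1 * u (enum_val i)).
have uvE j : uv v j = s^-1 * u j by rewrite /uv mxE enum_rankK.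
have Sv : S v = 1.
  rewrite /S (eq_bigr (fun j => s^-1 * `|u j|)) => [|j _].
    by rewrite -mulr_sumr mulVf.
  by rewrite uvE normrM gtr0_norm// invr_gt0.
have := HL L (leqnn L) v; rewrite /= => /(_ _ Sv).
have -> : \sum_(m < L) p m (uv v) = s^-1 * \sum_(m < L) p m u.
  rewrite mulr_sumr; apply: eq_bigr => m _.
  rewrite (_ : uv v = (fun j => s^-1 * u j)); last exact/funext.
  by rewrite pZ gtr0_norm// invr_gt0.
move=> h; have {h} : L.+1%:R^-1 <= s^-1 * \sum_(m < L) p m u.
  apply: h => i; rewrite /= in_itv/= -ler_norml -Sv /S.
  by rewrite (bigD1 (enum_val i))//= /uv enum_valK ler_wpDr// sumr_ge0.
by rewrite -ler_pdivrMl ?invr_gt0// invrK -ler_pdivrMl// mulrC.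
Unshelve. all: by end_near.
Qed.

End NormEquivalence.

(** * The L1 seminorm weighted by the density of the covariate *)

Section WeightedL1.
Variables (R : realType) (Xs : set R) (fbar : R -> R).
Hypotheses (Xs_compact : compact Xs) (fbar_ge0 : forall x, 0 <= fbar x).
Hypothesis fbar_out : forall x, ~ Xs x -> fbar x = 0.
Hypothesis fbar_meas : measurable_fun setT fbar.
Hypothesis fbar_int : (\int[@lebesgue_measure R]_(x in Xs) (fbar x)%:E = 1)%E.
Local Notation leb := (@lebesgue_measure R).

Lemma density_integralT : (\int[leb]_x (fbar x)%:E = 1)%E.
Proof.
rewrite -fbar_int [RHS]integral_mkcond; apply: eq_integral => x _.
by rewrite patchE; case: ifPn => // /negP xX; rewrite fbar_out// => /mem_set.
Qed.

Lemma support_bounded : exists2 B : R, 1 <= B & forall x, Xs x -> `|x| <= B.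
Proof.
have [M [Mr HM]] := compact_bounded Xs_compact.
exists (Num.max 1 (M + 1)) => [|x Xx]; first by rewrite le_max lexx.
have Mlt : M < M + 1 by rewrite ltrDl.
by rewrite le_max (HM _ Mlt x Xx : `|x| <= M + 1) orbT.
Qed.

(** A class closed under sums and products on which [L1] is finite: [fbar] is integrable and
    vanishes outside [Xs]. *)
Definition tame (F : R -> R) :=
  measurable_fun [set: R] F /\ exists M, forall x, Xs x -> `|F x| <= M.

Definition L1 (F : R -> R) : R := fine (\int[leb]_x (fbar x * `|F x|)%:E).

Lemma measurable_wabs (F : R -> R) : measurable_fun [set: R] F ->
  measurable_fun [set: R] (fun x : R => (fbar x * `|F x|)%:E).
Proof.
move=> mF; apply/measurable_EFinP; apply: measurable_funM => //.
exact: measurableT_comp.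
Qed.

Lemma L1_integral_le (F : R -> R) M : measurable_fun [set: R] F -> 0 <= M ->
  (forall x, Xs x -> `|F x| <= M) ->
  (\int[leb]_x (fbar x * `|F x|)%:E <= M%:E)%E.
Proof.
move=> mF M0 FM.
apply: (@le_trans _ _ (\int[leb]_x (M%:E * (fbar x)%:E))%E).
  apply: ge0_le_integral => //.
  - by move=> x _; rewrite lee_fin mulr_ge0.
  - exact: measurable_wabs.
  - by apply/measurable_EFinP; exact: measurable_funM.
  - move=> x _; rewrite -EFinM lee_fin.
    have [Xx|/fbar_out->] := pselect (Xs x); last by rewrite mul0r mulr0.
    by rewrite mulrC ler_wpM2r// FM.
rewrite ge0_integralZl//; last 2 first.
- exact/measurable_EFinP.
- by move=> x _; rewrite lee_fin.
by rewrite density_integralT mule1.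
Qed.

Lemma L1E F : tame F -> ((L1 F)%:E = \int[leb]_x (fbar x * `|F x|)%:E)%E.
Proof.
move=> [mF [M FM]]; rewrite /L1 fineK// ge0_fin_numE; last first.
  by apply: integral_ge0 => x _; rewrite lee_fin mulr_ge0.
apply: le_lt_trans (ltry (Num.max M 0)); apply: L1_integral_le => //.
  by rewrite le_max lexx orbT.
by move=> x /FM h; rewrite le_max h.
Qed.

Lemma L1_ge0 F : 0 <= L1 F.
Proof. by apply: fine_ge0; apply: integral_ge0 => x _; rewrite lee_fin mulr_ge0. Qed.

Lemma L1_le (F : R -> R) M : measurable_fun [set: R] F -> 0 <= M ->
  (forall x, Xs x -> `|F x| <= M) -> L1 F <= M.
Proof.
move=> mF M0 FM; rewrite -lee_fin L1E; first exact: L1_integral_le.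
by split => //; exists M.
Qed.

Lemma L1_triangle F G H : tame F -> tame G -> tame H ->
  (forall x, Xs x -> `|F x| <= `|G x| + `|H x|) -> L1 F <= L1 G + L1 H.
Proof.
move=> tF tG tH FGH; rewrite -lee_fin EFinD !L1E// -ge0_integralD//; first last.
- exact: measurable_wabs tH.1.
- by move=> x _; rewrite lee_fin mulr_ge0.
- exact: measurable_wabs tG.1.
- by move=> x _; rewrite lee_fin mulr_ge0.
apply: ge0_le_integral => //.
- by move=> x _; rewrite lee_fin mulr_ge0.
- exact: measurable_wabs tF.1.
- by apply: emeasurable_funD; [exact: measurable_wabs tG.1|exact: measurable_wabs tH.1].
- move=> x _; rewrite -EFinD lee_fin -mulrDr.
  have [Xx|/fbar_out->] := pselect (Xs x); last by rewrite !mul0r.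
  by rewrite ler_wpM2l// FGH.
Qed.

Lemma L1Z a F : tame F -> L1 (fun x => a * F x) = `|a| * L1 F.
Proof.
move=> tF; apply: EFin_inj; rewrite EFinM (L1E tF) L1E; last first.
  split; first by apply: measurable_funM => //; exact: tF.1.
  case: tF => _ [M FM]; exists (`|a| * M) => x /FM h.
  by rewrite normrM ler_wpM2l.
rewrite -ge0_integralZl//; first last.
- by move=> x _; rewrite lee_fin mulr_ge0.
- exact: measurable_wabs tF.1.
by apply: eq_integral => x _; rewrite -EFinM normrM mulrCA.
Qed.

Lemma L1_eq0 F : tame F -> L1 F = 0 -> {ae leb, forall x, fbar x * F x = 0}.
Proof.
move=> tF F0.
have mFF : measurable_fun [set: R] (fun x : R => (fbar x * F x)%:E).
  by apply/measurable_EFinP; apply: measurable_funM => //; exact: tF.1.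
have : (\int[leb]_x `|(fbar x * F x)%:E| = 0)%E.
  rewrite -[RHS]/(0%:E) -F0 L1E//; apply: eq_integral => x _.
  by rewrite abse_EFin normrM (ger0_norm (fbar_ge0 _)).
move/(ae_eq_integral_abs leb measurableT mFF).
by apply: filterS => x /(_ I) [].
Qed.

Lemma poly_roots_finite (q : {poly R}) : q != 0 -> finite_set [set x | root q x].
Proof.
move=> q0; apply: contrapT => /(infinite_set_fset (size q))[B sB].
rewrite leqNgt => /negP; apply; apply: max_poly_roots => //.
  by apply/allP => x xB; apply: sB.
exact: finmap.fset_uniq.
Qed.

(** Almost every point of positive density is a common zero of the [F n], hence a root of [q]. The
    roots of a nonzero polynomial form a null set, so [fbar] would vanish almost everywhere, against
    its total mass one. *)
Lemma L1_null_dense (F : nat -> R -> R) : (forall n, tame (F n)) ->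
  (forall n, L1 (F n) = 0) ->
  forall q : {poly R}, (forall x, Xs x -> (forall n, F n x = 0) -> q.[x] = 0) -> q = 0.
Proof.
move=> tF F0 q qZ; apply/eqP; apply: contraT => q0.
have ae1 : {ae leb, forall x, forall n, fbar x * F n x = 0}.
  by apply: ae_foralln => n; exact: L1_eq0.
have ae2 : {ae leb, forall x, ~~ root q x}.
  exists [set x | root q x]; split.
  - by apply: countable_measurable => //; apply: finite_set_countable; exact: poly_roots_finite.
  - by apply: countable_lebesgue_measure0; apply: finite_set_countable; exact: poly_roots_finite.
  - by move=> x /= /negP; rewrite negbK.
have ae3 : ae_eq leb setT (fun x => (fbar x)%:E) (cst 0%E).
  near=> x => _.
  have h1 : forall n, fbar x * F n x = 0 by near: x.
  have h2 : ~~ root q x by near: x.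
  have [->//|fx] := eqVneq (fbar x) 0.
  have Xx : Xs x by apply: contrapT => /fbar_out/eqP; apply/negP.
  move: h2; rewrite /root qZ ?eqxx// => n.
  by have /eqP := h1 n; rewrite mulf_eq0 (negbTE fx)/= => /eqP.
have : (\int[leb]_x (fbar x)%:E = \int[leb]_x (cst 0 x))%E.
  apply: ge0_ae_eq_integral => //; first exact/measurable_EFinP.
  by move=> x _; rewrite lee_fin.
rewrite density_integralT integral0 => /eqP.
by rewrite onee_eq0.
Unshelve. all: by end_near.
Qed.

Lemma measurable_h1 (th : R * R) : measurable_fun [set: R] (fun x => h1 x th).
Proof.
rewrite /h1; apply: measurable_funX; apply: measurable_funD => //.
Qed.

Lemma measurable_hexp lam e : measurable_fun [set: R] (fun x => hexp lam x e).
Proof.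
apply: measurableT_comp => //; apply: measurable_funD => //.
by apply: measurable_funM => //; exact: measurable_h1.
Qed.

Lemma hexp_bounded lam e : exists M, forall x, Xs x -> `|hexp lam x e| <= M.
Proof.
have [B B1 hB] := support_bounded.
eexists => x /hB xB; rewrite ger0_norm ?expR_ge0//; exact: hexp_le xB.
Qed.

Lemma tame_hexp lam e : tame (fun x => hexp lam x e).
Proof. by split; [exact: measurable_hexp|exact: hexp_bounded]. Qed.

Lemma tameM F G : tame F -> tame G -> tame (fun x => F x * G x).
Proof.
move=> [mF [M FM]] [mG [N GN]]; split; first exact: measurable_funM.
by exists (M * N) => x Xx; rewrite normrM; apply: ler_pM => //; [exact: FM|exact: GN].
Qed.

Lemma tame_cst a : tame (fun=> a).
Proof. by split => //; exists `|a|. Qed.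

Lemma tame_id : tame id.
Proof. by split => //; have [B _ hB] := support_bounded; exists B. Qed.

Lemma tame_exp F n : tame F -> tame (fun x => F x ^+ n).
Proof.
move=> [mF [M FM]]; split; first exact: measurable_funX.
exists (M ^+ n) => x Xx; rewrite normrX lerXn2r ?nnegrE//; last exact: FM.
exact: le_trans (FM x Xx).
Qed.

Lemma tameD F G : tame F -> tame G -> tame (fun x => F x + G x).
Proof.
move=> [mF [M FM]] [mG [N GN]]; split; first exact: measurable_funD.
exists (M + N) => x Xx; rewrite (le_trans (ler_normD _ _))//.
by apply: lerD; [exact: FM|exact: GN].
Qed.

Lemma tameN F : tame F -> tame (fun x => - F x).
Proof.
move=> [mF [M FM]]; split; first exact: measurableT_comp.
by exists M => x Xx; rewrite normrN FM.
Qed.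

Lemma tame_sum (I : Type) (s : seq I) (F : I -> R -> R) :
  (forall i, tame (F i)) -> tame (fun x => \sum_(i <- s) F i x).
Proof.
move=> tF; elim: s => [|i s IH].
  under eq_fun do rewrite big_nil; exact: tame_cst.
by under eq_fun do rewrite big_cons; exact: tameD.
Qed.

Section CoefficientBound.
Variables (I : finType) (e : I -> R * R * R) (A : nat).
Hypotheses (e_inj : injective e) (e_quad : forall i, quadrant (e i)).
Local Notation J := (I * 'I_A * 'I_A)%type.

Definition basis (n : nat) (j : J) (x : R) : R :=
  n%:R ^+ j.1.2 * x ^+ j.2 * hexp n%:R x (e j.1.1).

Lemma tame_basis n j : tame (basis n j).
Proof.
apply: tameM; last exact: tame_hexp.
by apply: tameM; [exact: tame_cst|apply: tame_exp; exact: tame_id].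
Qed.

Lemma tame_comb n (u : J -> R) : tame (fun x => \sum_j u j * basis n j x).
Proof.
by apply: tame_sum => j; apply: tameM; [exact: tame_cst|exact: tame_basis].
Qed.

(** The functions [L1] of the combinations are seminorms in [u]. They separate: if all are zero,
    every combination vanishes on a set dense for polynomials, and [hexp_free] kills the
    coefficients. [K] and [L] thus depend only on the atoms, the degree [A] and the covariate
    law. *)
Lemma coef_dominated : exists2 K : R, 0 < K & exists L, forall u : J -> R,
  \sum_j `|u j| <= K * \sum_(n < L) L1 (fun x => \sum_j u j * basis n j x).
Proof.
have /choice[C HC] : forall n : nat, exists C : R, 0 <= C /\ forall j x, Xs x ->
    `|basis n j x| <= C.
  move=> n.
  have /choice[M HM] : forall j : J, exists M, forall x, Xs x -> `|basis n j x| <= M.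
    by move=> j; have [_] := tame_basis n j.
  exists (\sum_j `|M j|); split => [|j x Xx]; first exact: sumr_ge0.
  rewrite (bigD1 j)//= ler_wpDr ?sumr_ge0// (le_trans (HM j x Xx))//.
  exact: ler_norm.
apply: (@seminorms_dominate R J (fun n u => L1 (fun x => \sum_j u j * basis n j x)) C).
- by move=> n u; exact: L1_ge0.
- move=> n u w; have [C0 Cb] := HC n.
  apply: le_trans (_ : L1 (fun x => \sum_j w j * basis n j x) +
     L1 (fun x => \sum_j (u j - w j) * basis n j x) <= _).
    apply: L1_triangle; [exact: tame_comb|exact: tame_comb| |].
      exact: (tame_comb n (fun j => u j - w j)).
    move=> x Xx; have -> : \sum_j u j * basis n j x =
        \sum_j w j * basis n j x + \sum_j (u j - w j) * basis n j x.
      by rewrite -big_split/=; apply: eq_bigr => j _; ring.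
    exact: ler_normD.
  rewrite lerD2l; apply: L1_le.
  + exact: (tame_comb n (fun j => u j - w j)).1.
  + by rewrite mulr_ge0// sumr_ge0.
  + move=> x Xx; rewrite (le_trans (ler_norm_sum _ _ _))// mulr_sumr.
    by apply: ler_sum => j _; rewrite normrM mulrC ler_wpM2r// Cb.
- move=> n a u; rewrite -L1Z; last exact: tame_comb.
  congr L1; apply/funext => x; rewrite mulr_sumr; apply: eq_bigr => j _.
  by rewrite mulrA.
- move=> u u0 [[i l] m].
  (* The coefficients attached to atom [i], regrouped as a polynomial in [n] over polynomials in
     [x]. *)
  pose c i : {poly {poly R}} := \sum_(l < A) (\sum_(m < A) u (i, l, m) *: 'X^m)%:P * 'X^l.
  have dense := L1_null_dense (fun n => tame_comb n u) u0.
  have : c i = 0.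
    apply: (@hexp_free R I e c
      [set x | Xs x /\ forall n : nat, \sum_j u j * basis n j x = 0]) => //.
      by move=> q hq; apply: dense => x Xx hx; exact: hq.
    move=> x [Xx hx] n; rewrite -[RHS](hx n).
    have -> : \sum_j u j * basis n j x =
        \sum_i \sum_l \sum_m u (i, l, m) * basis n (i, l, m) x.
      rewrite (pair_bigA _ (fun i l => \sum_m u (i, l, m) * basis n (i, l, m) x))/=.
      rewrite (pair_bigA _ (fun p m => u (p.1, p.2, m) * basis n (p.1, p.2, m) x))/=.
      by apply: eq_bigr => -[[? ?] ?].
    apply: eq_bigr => i' _; rewrite /c horner_sum horner_sum mulr_suml.
    apply: eq_bigr => l' _; rewrite hornerM hornerC hornerXn -polyC_exp hornerM hornerC.
    rewrite horner_sum !mulr_suml; apply: eq_bigr => m' _.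
    by rewrite hornerZ hornerXn /basis/=; ring.
  move=> /polyP/(_ l); rewrite coef0 /c coef_sum (bigD1 l)//=.
  rewrite [X in _ + X]big1 => [|l' ll']; last first.
    by rewrite coefCM coefXn val_eqE eq_sym (negbTE ll') mulr0.
  rewrite addr0 coefCM coefXn eqxx mulr1 => /polyP/(_ m).
  rewrite coef0 coef_sum (bigD1 m)//= [X in _ + X]big1 => [|m' mm']; last first.
    by rewrite coefZ coefXn val_eqE eq_sym (negbTE mm') mulr0.
  by rewrite addr0 coefZ coefXn eqxx mulr1.
Qed.

End CoefficientBound.

End WeightedL1.

(** * Local expansions at the atoms *)

Section Taylor.
Variable R : realType.

Definition taylor_poly (f : nat -> R -> R) (n : nat) : {poly R} :=
  \poly_(i < n) (f i 0 / i`!%:R).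

Lemma deriv_taylor_poly f n :
  (taylor_poly f n.+1)^`() = taylor_poly (fun i => f i.+1) n.
Proof.
apply/polyP => i; rewrite coef_deriv !coef_poly ltnS; case: ifP => // _.
  rewrite factS natrM -mulr_natr; field.
  by rewrite nat1r !pnatr_eq0 -lt0n fact_gt0.
by rewrite mul0rn.
Qed.

(** [f] lists the successive derivatives of [f 0]. The derivative of the remainder is the remainder
    of the shifted list, so induction and the mean value theorem suffice; the factor [1 / n!] is
    given up, only the power of [a] matters. *)
Lemma taylor_bound (f : nat -> R -> R) (rho M : R) (n : nat) :
  (forall i x, is_derive x (1 : R) (f i) (f i.+1 x)) ->
  (forall x, `|x| <= rho -> `|f n x| <= M) ->
  forall a, `|a| <= rho -> `|f 0%N a - (taylor_poly f n).[a]| <= M * `|a| ^+ n.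
Proof.
elim: n f => [|n IHn] f df fM a arho.
  rewrite /taylor_poly poly_def big_ord0 horner0 subr0 expr0 mulr1; exact: fM.
pose g x := f 0%N x - (taylor_poly f n.+1).[x].
pose dg x := f 1%N x - (taylor_poly (fun i => f i.+1) n).[x].
have gd x : is_derive x (1 : R) g (dg x).
  by rewrite /g /dg -deriv_taylor_poly; apply: is_deriveB.
have dgM x : `|x| <= rho -> `|dg x| <= M * `|x| ^+ n.
  by apply: IHn => // i y; exact: df.
have M0 : 0 <= M by apply: le_trans (fM a arho).
have g0 : g 0 = 0.
  rewrite /g horner_coef0 coef_poly/= fact0 divr1 subrr//.
have gc : continuous g.
  move=> x; apply/differentiable_continuous/derivable1_diffP.
  by have [] := gd x.
have dgle c : `|c| <= `|a| -> `|dg c| <= M * `|a| ^+ n.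
  move=> ca; apply: le_trans (dgM c (le_trans ca arho)) _.
  by rewrite ler_wpM2l// lerXn2r.
rewrite -/(g a) exprSr mulrA.
have [a0|a0] := leP 0 a.
  have [c ci] := MVT_segment a0 (fun x _ => gd x) (continuous_subspaceT gc).
  rewrite g0 !subr0 => ->; rewrite normrM ler_wpM2r// dgle//.
  by move: ci; rewrite in_itv/= => /andP[c0 ca]; rewrite !ger0_norm.
have [c ci] := MVT_segment (ltW a0) (fun x _ => gd x) (continuous_subspaceT gc).
rewrite g0 !sub0r => /eqP; rewrite eqr_oppLR => /eqP ->.
rewrite mulrN opprK normrM ler_wpM2r// dgle//.
move: ci; rewrite in_itv/= => /andP[ac c0].
by rewrite !ler0_norm ?lerN2// ltW.
Qed.

Lemma expR_taylor (n : nat) (M z : R) : `|z| <= M ->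
  `|expR z - \sum_(i < n) z ^+ i / i`!%:R| <= expR M * `|z| ^+ n.
Proof.
move=> zM.
have := @taylor_bound (fun=> expR) M (expR M) n (fun _ x => is_derive_expR x).
have -> : (taylor_poly (fun=> expR) n) = \poly_(i < n) (i`!%:R)^-1.
  by apply/polyP => i; rewrite !coef_poly expR0 mul1r.
move=> /(_ _ z zM); rewrite horner_poly.
under [in X in _ -> X]eq_bigr do rewrite mulrC.
apply=> x xM; rewrite ger0_norm ?expR_ge0// ler_expR.
exact: le_trans (ler_norm _) xM.
Qed.

End Taylor.

(** * Derivatives of the exponential of a square *)

Section QpolyTheory.
Variable R : realType.
Local Notation Q := (Qpoly R).

(** The degree is at most [2 j - g]: differentiating at fixed [j] lowers it by one, passing from [j]
    to [j + 1] raises it by one. Consequently [Qpoly g j] vanishes for [2 j < g], which is why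
    [Ppoly] starts at index [uphalf g]. *)
Lemma size_Qpoly g j : (size (Q g j) <= j.*2.+1 - g)%N.
Proof.
elim: g j => [|g IHg] j /=.
  by case: j => [|j]; rewrite ?size_poly1 ?size_poly0.
rewrite (leq_trans (size_polyD _ _))// geq_max; apply/andP; split.
  have [->|q0] := eqVneq (Q g j) 0; first by rewrite deriv0 size_poly0.
  by move: (lt_size_deriv q0) (IHg j); lia.
case: j => [|j]; first by rewrite size_poly0.
have [->|q0] := eqVneq (Q g j) 0; first by rewrite mulr0 size_poly0.
rewrite -scaler_nat -scalerAl (leq_trans (size_scale_leq _ _))//.
rewrite mulrC size_mulX//; move: (IHg j); rewrite -size_poly_gt0 in q0.
lia.
Qed.

Lemma Qpoly_low g j : (j.*2 < g)%N -> Q g j = 0.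
Proof.
move=> jg; apply/eqP; rewrite -size_poly_leq0.
by apply: leq_trans (size_Qpoly g j) _; lia.
Qed.

Lemma Qpoly_high g j : (g < j)%N -> Q g j = 0.
Proof.
elim: g j => [|g IHg] [|j] //= gj.
by rewrite !IHg ?deriv0 ?mulr0 ?addr0//; lia.
Qed.

(** The factor produced by [g] derivatives in [t] of exp(lam t^2): the outer function exp(lam y) has
    j-th derivative lam^j exp(lam y). *)
Definition Qsum (lam t : R) (g : nat) : R := \sum_(j < g.+1) (Q g j).[t] * lam ^+ j.

(** The [g]-th derivative in [a] of exp(lam ((t + a)^2 - t^2)), written in closed form so that the
    whole family can be given to [taylor_bound]. *)
Definition shifted_exp (lam t : R) (g : nat) (a : R) : R :=
  Qsum lam (t + a) g * expR (lam * ((t + a) ^+ 2 - t ^+ 2)).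

Lemma QsumS lam t g : Qsum lam t g.+1 =
  \sum_(j < g.+1) (Q g j)^`().[t] * lam ^+ j + 2 * t * lam * Qsum lam t g.
Proof.
rewrite /Qsum (eq_bigr (fun j : 'I_g.+2 => (Q g j)^`().[t] * lam ^+ j +
  (match j : nat with 0 => 0 | j'.+1 => 'X *+ 2 * Q g j' end).[t] * lam ^+ j)); last first.
  by move=> j _ /=; rewrite hornerD mulrDl.
rewrite big_split/=; congr (_ + _).
  by rewrite big_ord_recr/= Qpoly_high// deriv0 horner0 mul0r addr0.
rewrite big_ord_recl/= horner0 mul0r add0r mulr_sumr; apply: eq_bigr => j _.
rewrite /bump add1n hornerM hornerMn hornerX exprS; ring.
Qed.

Lemma is_derive_shifted_exp lam t g a :
  is_derive a (1 : R) (shifted_exp lam t g) (shifted_exp lam t g.+1 a).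
Proof.
pose S : {poly R} := \sum_(j < g.+1) lam ^+ j *: Q g j.
have SE x : Qsum lam x g = S.[x].
  by rewrite horner_sum; apply: eq_bigr => j _; rewrite hornerZ mulrC.
pose U : {poly R} := S \Po (t%:P + 'X).
pose V : {poly R} := lam *: (('X + t%:P) * ('X + t%:P) - (t ^+ 2)%:P).
have -> : shifted_exp lam t g = (fun x => U.[x]) * (expR \o (fun x => V.[x])).
  apply/funext => x; rewrite /shifted_exp SE; transitivity (U.[x] * expR V.[x]) => //.
  by rewrite /U /V horner_comp !hornerE; congr (_ * expR (_ * _)); ring.
have dV : is_derive a (1 : R) (fun x => V.[x]) V^`().[a] by exact: is_derive_poly.
have dU : is_derive a (1 : R) (fun x => U.[x]) U^`().[a] by exact: is_derive_poly.
have dE := is_derive1_comp (is_derive_expR V.[a]) dV.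
have dM := is_deriveM dU dE.
apply: is_derive_eq dM _.
have U'E : U^`().[a] = \sum_(j < g.+1) (Q g j)^`().[t + a] * lam ^+ j.
  rewrite /U deriv_comp derivD derivC derivX add0r mulr1 horner_comp !hornerE.
  rewrite /S raddf_sum horner_sum; apply: eq_bigr => j _.
  by rewrite /= derivZ hornerZ mulrC.
have V'E : V^`().[a] = 2 * (t + a) * lam.
  rewrite /V derivZ derivB derivC subr0 derivM derivD derivX derivC.
  by rewrite !(hornerZ, hornerD, hornerM, hornerX, hornerC); ring.
have VE : V.[a] = lam * ((t + a) ^+ 2 - t ^+ 2) by rewrite /V !hornerE; ring.
have UE : U.[a] = Qsum lam (t + a) g by rewrite /U horner_comp !hornerE SE.
rewrite /shifted_exp QsumS /= /GRing.scale/= U'E V'E VE UE; ring.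
Qed.

End QpolyTheory.

Section SystemGeneratingFunction.
Variable R : realType.

Lemma Qsum_Ppoly (lam t : R) g N : (g < N)%N ->
  Qsum lam t g = \sum_(u < N | (u <= g./2)%N) (Ppoly R g u).[t] * lam ^+ (uphalf g + u).
Proof.
move=> gN; transitivity (\sum_(u < g./2.+1) (Ppoly R g u).[t] * lam ^+ (uphalf g + u)); last first.
  rewrite (big_ord_widen N (fun u : nat => (Ppoly R g u).[t] * lam ^+ (uphalf g + u)))//; lia.
rewrite /Qsum -(big_mkord xpredT (fun j => (Qpoly R g j).[t] * lam ^+ j)).
rewrite (@big_cat_nat _ _ _ (uphalf g))//=; last lia.
rewrite big_nat big1 ?add0r => [|j /andP[_ jg]]; last first.
  rewrite Qpoly_low ?horner0 ?mul0r//; lia.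
rewrite -{1}[uphalf g]add0n big_addn.
have -> : (g.+1 - uphalf g = g./2.+1)%N by lia.
by rewrite big_mkord; apply: eq_bigr => u _; rewrite /Ppoly addnC.
Qed.

(** The Taylor polynomial of exp(lam ((t + a)^2 - t^2) + lam^2 v / 2) in [(a, v)], cut at total
    degree [r]. *)
Definition trunc (lam t : R) (r : nat) (a v : R) : R :=
  \sum_(g1 < r.+1) \sum_(g2 < r.+1 | (g1 + g2 <= r)%N)
    (Qsum lam t g1 * (a ^+ g1 / g1`!%:R)) * ((lam ^+ 2 / 2 * v) ^+ g2 / g2`!%:R).

(** The index [l] of the system is a power of [lam]: a derivative of order [uphalf g1 + u] in the
    location gives that many factors [lam], and each power of [v] comes with lam^2 / 2, whence the
    weight 2 of [g2] and the factor 2^-g2. *)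
Lemma sys_num_generating (lam t : R) (s r : nat) (a b c : 'I_s -> R) :
  \sum_(l < r.*2.+1) sys_num t r l a b c * lam ^+ l =
  \sum_(i < s) c i * trunc lam t r (a i) (b i).
Proof.
pose term g1 g2 u := (Ppoly R g1 u).[t] / 2 ^+ g2 *
  \sum_(i < s) c i * (a i ^+ g1 * b i ^+ g2) / ((g1`!)%:R * (g2`!)%:R).
transitivity (\sum_(g1 < r.+1) \sum_(g2 < r.+1 | (g1 + g2 <= r)%N)
   \sum_(u < r.+1 | (u <= g1./2)%N) term g1 g2 u * lam ^+ (uphalf g1 + u + 2 * g2)).
  rewrite /sys_num; under eq_bigr do rewrite mulr_suml.
  rewrite exchange_big/=; apply: eq_bigr => g1 _.
  under eq_bigr do rewrite mulr_suml.
  rewrite exchange_big/= [RHS]big_mkcond/=; apply: eq_bigr => g2 _.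
  under eq_bigr do rewrite mulr_suml big_mkcond/=.
  rewrite exchange_big/=; case: ifPn => g12; last by apply: big1 => u _; apply: big1.
  rewrite [RHS]big_mkcond/=; apply: eq_bigr => u _.
  case: ifPn => /= u1; last by apply: big1.
  (* From [u <= g1./2] the index is at most [g1 + 2 * g2 <= 2 * r], so each triple is met by exactly
     one [l]. *)
  have hl : (uphalf g1 + u + 2 * g2 < r.*2.+1)%N.
    by move: (ltn_ord u) => *; lia.
  rewrite (bigD1 (Ordinal hl))//= eqxx [X in _ + X]big1 ?addr0// => l.
  by rewrite -val_eqE/= eq_sym => /negbTE ->.
transitivity (\sum_(g1 < r.+1) \sum_(g2 < r.+1 | (g1 + g2 <= r)%N) \sum_(i < s)
   c i * (Qsum lam t g1 * (a i ^+ g1 / g1`!%:R) * ((lam ^+ 2 / 2 * b i) ^+ g2 / g2`!%:R))).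
  apply: eq_bigr => g1 _; apply: eq_bigr => g2 _.
  rewrite (Qsum_Ppoly _ _ (ltn_ord g1)).
  rewrite (eq_bigr (fun u : 'I_r.+1 => (Ppoly R g1 u).[t] * lam ^+ (uphalf g1 + u) *
     \sum_(i < s) c i * (a i ^+ g1 / g1`!%:R * ((lam ^+ 2 / 2 * b i) ^+ g2 / g2`!%:R)))).
    rewrite -mulr_suml mulr_sumr; apply: eq_bigr => i _; ring.
  move=> u _; rewrite /term !mulr_sumr mulr_suml; apply: eq_bigr => i _.
  rewrite exprD exprMn expr_div_n -exprM; field.
  by rewrite !pnatr_eq0 -!lt0n !fact_gt0 expf_neq0// pnatr_eq0.
under eq_bigr do rewrite exchange_big/=.
rewrite exchange_big/=; apply: eq_bigr => i _; rewrite /trunc mulr_sumr.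
by apply: eq_bigr => g1 _; rewrite mulr_sumr.
Qed.

(* If there were no such [eps] and [del], counterexamples for [1 / n] would solve the system. *)
Lemma sys_lower_bound (t : R) (s r : nat) : ~ sys_solvable t s r ->
  exists2 eps : R, 0 < eps & exists2 del : R, 0 < del &
  forall a b c : 'I_s -> R, (forall i, 0 <= c i) -> \sum_(i < s) c i <= 1 ->
    (forall i, `|a i| <= del) -> (forall i, `|b i| <= del) ->
    eps * sys_den r a b c <= \sum_(l < r.*2.+1 | (0 < l)%N) `|sys_num t r l a b c|.
Proof.
move=> nsol; apply: contrapT => H; apply: nsol.
have {}H : forall n : nat, exists abc : ('I_s -> R) * ('I_s -> R) * ('I_s -> R),
    [/\ forall i, 0 <= abc.2 i, \sum_(i < s) abc.2 i <= 1,
        forall i, `|abc.1.1 i| <= n.+1%:R^-1, forall i, `|abc.1.2 i| <= n.+1%:R^-1 &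
        \sum_(l < r.*2.+1 | (0 < l)%N) `|sys_num t r l abc.1.1 abc.1.2 abc.2| <
          n.+1%:R^-1 * sys_den r abc.1.1 abc.1.2 abc.2].
  move=> n; apply: contrapT => Hn; apply: H.
  exists n.+1%:R^-1; first by rewrite invr_gt0.
  exists n.+1%:R^-1; first by rewrite invr_gt0.
  move=> a b c c0 c1 ad bd; rewrite leNgt; apply/negP => h; apply: Hn.
  by exists (a, b, c).
have [f Hf] := choice H.
exists 1; split => //; exists (fun n => (f n).1.1), (fun n => (f n).1.2), (fun n => (f n).2).
have inv0 : (fun n : nat => n.+1%:R^-1 : R) @ \oo --> (0 : R) by exact: cvg_harmonic.
have sq (u : nat -> R) : (forall n, `|u n| <= n.+1%:R^-1) -> u @ \oo --> (0 : R).
  move=> hu; apply: (@squeeze_cvgr _ _ _ _ (fun n => - n.+1%:R^-1) (fun n => n.+1%:R^-1)) => //.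
    by near=> n; rewrite -ler_norml.
  by rewrite -[X in _ --> X]oppr0; exact: cvgN.
have den0 n : 0 < sys_den r (f n).1.1 (f n).1.2 (f n).2.
  have [_ _ _ _ h] := Hf n; have : 0 < n.+1%:R^-1 * sys_den r (f n).1.1 (f n).1.2 (f n).2.
    by apply: le_lt_trans h; exact: sumr_ge0.
  by rewrite pmulr_rgt0// invr_gt0.
split.
- by move=> i; apply: sq => n; have [_ _ + _ _] := Hf n.
- by move=> i; apply: sq => n; have [_ _ _ + _] := Hf n.
- by move=> n; have [+ _ _ _ _] := Hf n.
- by split => n; [have [_ + _ _ _] := Hf n|exact: den0].
move=> l /andP[l1 l2]; apply: sq => n; have [_ _ _ _ h] := Hf n.
rewrite normrM normfV (gtr0_norm (den0 n)) ler_pdivrMr//.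
apply: le_trans (ltW h).
have hl : (l < r.*2.+1)%N by lia.
by rewrite (bigD1 (Ordinal hl))//= lerDl sumr_ge0.
Unshelve. all: by end_near.
Qed.

End SystemGeneratingFunction.

(** * Taylor remainders at a singular atom *)

Section Expansions.
Variable R : realType.

Lemma expR_sub1 (M z : R) : `|z| <= M -> `|expR z - 1| <= expR M * `|z|.
Proof.
move=> /(expR_taylor 1); rewrite expr1 big_ord1 /= expr0 fact0.
by rewrite divr1.
Qed.

Lemma expR_sub2 (M z : R) : `|z| <= M -> `|expR z - 1 - z| <= expR M * `|z| ^+ 2.
Proof.
move=> /(expR_taylor 2); rewrite !big_ord_recr big_ord0 /= add0r expr0 expr1.
by rewrite !divr1 opprD addrA.
Qed.

Lemma expR_sub3 (M z : R) : `|z| <= M ->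
  `|expR z - (1 + z + z ^+ 2 / 2)| <= expR M * `|z| ^+ 3.
Proof.
move=> /(expR_taylor 3); rewrite !big_ord_recr big_ord0 /= add0r expr0 expr1.
by rewrite !divr1.
Qed.

(** With [m = max a v <= 1] the monomial is at most [m ^ (r + 1) <= del * m ^ r], and [m ^ r] is
    [a ^ r], or at most [v ^ uphalf r], according to which of the two is larger. *)
Lemma monomial_small (del a v : R) (r g1 g2 : nat) :
  0 <= a <= del -> 0 <= v <= del -> del <= 1 -> (r < g1 + g2)%N ->
  a ^+ g1 * v ^+ g2 <= del * (a ^+ r + v ^+ uphalf r).
Proof.
move=> /andP[a0 ad] /andP[v0 vd] d1 rg.
pose m := Num.max a v.
have am : a <= m by rewrite le_max lexx.
have vm : v <= m by rewrite le_max lexx orbT.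
have m0 : 0 <= m := le_trans a0 am.
have md : m <= del by rewrite ge_max ad vd.
have m1 : m <= 1 := le_trans md d1.
apply: le_trans (_ : m ^+ g1 * m ^+ g2 <= _).
  by apply: ler_pM; rewrite ?exprn_ge0// lerXn2r.
rewrite -exprD; apply: le_trans (_ : m ^+ r.+1 <= _).
  by apply: ler_wiXn2l.
rewrite exprS; apply: ler_pM => //; first exact: exprn_ge0.
have hr : (uphalf r <= r)%N by lia.
have v1 : v <= 1 := le_trans vd d1.
rewrite /m; case: (leP a v) => av.
  by rewrite ler_wpDl ?exprn_ge0// ler_wiXn2l.
by rewrite lerDl exprn_ge0.
Qed.

(** The next derivative is continuous, hence bounded on [[-1, 1]] by its extreme values. *)
Lemma shifted_exp_taylor (lam t : R) (r : nat) : exists2 K : R, 0 <= K &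
  forall a, `|a| <= 1 ->
   `|expR (lam * ((t + a) ^+ 2 - t ^+ 2)) -
     \sum_(g < r.+1) Qsum lam t g * (a ^+ g / g`!%:R)| <= K * `|a| ^+ r.+1.
Proof.
have cont n : continuous (shifted_exp lam t n).
  move=> x; apply/differentiable_continuous/derivable1_diffP.
  by have [] := is_derive_shifted_exp lam t n x.
have n01 : (-1 : R) <= 1 by rewrite lerNl (le_trans _ ler01)// lerN10.
have [c1 _ h1] := EVT_max n01 (continuous_subspaceT (cont r.+1)).
have [c2 _ h2] := EVT_min n01 (continuous_subspaceT (cont r.+1)).
pose K := `|shifted_exp lam t r.+1 c1| + `|shifted_exp lam t r.+1 c2|.
exists K; first by rewrite addr_ge0.
have Kb x : `|x| <= 1 -> `|shifted_exp lam t r.+1 x| <= K.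
  rewrite ler_norml => x1; have xi : x \in `[(-1 : R), 1] by rewrite in_itv.
  rewrite ler_norml; apply/andP; split.
    rewrite (le_trans _ (h2 x xi))// lerNl (le_trans (ler_norm _))// normrN.
    by rewrite lerDr.
  by rewrite (le_trans (h1 x xi))// (le_trans (ler_norm _))// lerDl.
have Q0 : Qsum lam t 0 = 1 by rewrite /Qsum big_ord_recl big_ord0 /= hornerC expr0 !mulr1 addr0.
move=> a a1; have := taylor_bound (is_derive_shifted_exp lam t) Kb a1.
have -> : shifted_exp lam t 0 a = expR (lam * ((t + a) ^+ 2 - t ^+ 2)).
  rewrite /shifted_exp; have -> : Qsum lam (t + a) 0 = 1; last by rewrite mul1r.
  by rewrite /Qsum big_ord_recl big_ord0 /= hornerC expr0 !mulr1 addr0.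
rewrite /taylor_poly horner_poly.
rewrite (eq_bigr (fun g : 'I_r.+1 => Qsum lam t g * (a ^+ g / g`!%:R))) => // g _.
rewrite /shifted_exp addr0 subrr mulr0 expR0 mulr1; ring.
Qed.

(** The slope increment [b] is counted to the first power in the error, so one linear term in it is
    kept; [a * b] and [b ^ 2] are already of size [del * b]. Intercept and variance are counted to
    high powers and need the full truncation. *)
Lemma singular_expansion (t B lam : R) (r : nat) : 0 <= B -> exists2 K : R, 0 <= K &
  forall del a b v x, del <= 1 -> `|a| <= del -> 0 <= b <= del -> `|v| <= del ->
   `|x| <= B ->
   `|expR (lam * ((t + a + b * x) ^+ 2 - t ^+ 2) + lam ^+ 2 / 2 * v) -
     (trunc lam t r a v + 2 * t * lam * b * x)| <=
   K * (del * (`|a| ^+ r + b + `|v| ^+ uphalf r)).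
Proof.
move=> B0.
have [Ka Ka0 hKa] := shifted_exp_taylor lam t r.
pose L := lam ^+ 2 / 2; pose CL := expR L.
have L0 : 0 <= L by rewrite divr_ge0 ?sqr_ge0.
have CL0 : 0 <= CL by exact: expR_ge0.
pose Kv := CL * L ^+ r.+1.
have Kv0 : 0 <= Kv by rewrite mulr_ge0 ?exprn_ge0.
pose al g := `|Qsum lam t g|.
pose be g := L ^+ g.
pose CP := \sum_(g < r.+1) al g.
have CP0 : 0 <= CP by apply: sumr_ge0 => g _; exact: normr_ge0.
pose KT := \sum_(g1 < r.+1) \sum_(g2 < r.+1) al g1 * be g2.
have al0 g : 0 <= al g by exact: normr_ge0.
have be0 g : 0 <= be g by exact: exprn_ge0.
have KT0 : 0 <= KT by do 2 (apply: sumr_ge0 => ? _); exact: mulr_ge0.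
pose Z := `|lam| * (2 * (`|t| + 1) * B + B ^+ 2).
have Z0 : 0 <= Z by rewrite mulr_ge0// addr_ge0 ?mulr_ge0 ?addr_ge0 ?exprn_ge0.
pose Kb := expR Z * Z ^+ 2 + `|lam| * (2 * B + B ^+ 2).
have Kb0 : 0 <= Kb.
  have B20 : 0 <= 2 * B + B ^+ 2 by rewrite addr_ge0 ?mulr_ge0 ?exprn_ge0.
  by apply: addr_ge0; apply: mulr_ge0 => //; exact: exprn_ge0.
pose Z2 := `|lam| * (2 * `|t| + 1) + L.
have Z20 : 0 <= Z2 by apply: addr_ge0 => //; rewrite mulr_ge0// addr_ge0// mulr_ge0.
pose K := KT + Ka * CL + CP * Kv + expR Z2 * Kb + expR Z2 * Z2 * (2 * `|t| * `|lam| * B).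
exists K => [|del a b v x d1 ad /andP[b0 bd] vd xB].
  have e0 : 0 <= expR Z2 by exact: expR_ge0.
  have t0 : 0 <= 2 * `|t| * `|lam| * B by rewrite !mulr_ge0.
  by rewrite /K; do 4 (apply: addr_ge0; last by rewrite !mulr_ge0); exact: KT0.
have d0 : 0 <= del := le_trans (normr_ge0 a) ad.
set Er := `|a| ^+ r + b + `|v| ^+ uphalf r.
have a1 : `|a| <= 1 := le_trans ad d1.
have v1 : `|v| <= 1 := le_trans vd d1.
have b1 : b <= 1 := le_trans bd d1.
pose Ea := expR (lam * ((t + a) ^+ 2 - t ^+ 2)).
pose Ev := expR (L * v).
pose zb := lam * (2 * (t + a) * b * x + b ^+ 2 * x ^+ 2).
pose Pa := \sum_(g < r.+1) Qsum lam t g * (a ^+ g / g`!%:R).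
pose Pv := \sum_(g < r.+1) (L * v) ^+ g / g`!%:R.
have -> : expR (lam * ((t + a + b * x) ^+ 2 - t ^+ 2) + lam ^+ 2 / 2 * v) =
    Ea * Ev * expR zb.
  by rewrite -!expRD; congr expR; rewrite /zb /L; ring.
have mono g1 g2 : (r < g1 + g2)%N -> `|a| ^+ g1 * `|v| ^+ g2 <= del * Er.
  move=> h; apply: le_trans (monomial_small (r := r) _ _ d1 h) _; rewrite ?normr_ge0//.
  by rewrite ler_wpM2l// /Er addrAC lerDl.
have hEv : `|Ev| <= CL.
  rewrite ger0_norm ?expR_ge0// ler_expR (le_trans (ler_norm _))// normrM.
  by rewrite (ger0_norm L0) ler_piMr.
have hra : `|Ea - Pa| <= Ka * (del * Er).
  apply: le_trans (hKa a a1) _; rewrite ler_wpM2l//.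
  by have := mono r.+1 0%N; rewrite expr0 mulr1; apply; rewrite addn0.
have hrv : `|Ev - Pv| <= Kv * (del * Er).
  have Lv : `|L * v| <= L by rewrite normrM (ger0_norm L0) ler_piMr.
  apply: le_trans (expR_taylor r.+1 Lv) _.
  rewrite normrM (ger0_norm L0) exprMn mulrA ler_wpM2l//.
  by have := mono 0%N r.+1; rewrite expr0 mul1r; apply.
have hPa : `|Pa| <= CP.
  rewrite (le_trans (ler_norm_sum _ _ _))//; apply: ler_sum => g _.
  rewrite normrM ler_piMr// normrM normfV normrX [X in _ / X]ger0_norm//.
  rewrite ler_pdivrMr ?ltr0n ?fact_gt0// mul1r (le_trans (_ : _ <= 1))//.
    by rewrite exprn_ile1.
  by rewrite ler1n fact_gt0.
have hPP : `|Pa * Pv - trunc lam t r a v| <= KT * (del * Er).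
  rewrite /Pa /Pv /trunc mulr_suml -sumrB (le_trans (ler_norm_sum _ _ _))//.
  rewrite /KT [leRHS]mulr_suml; apply: ler_sum => g1 _.
  rewrite mulr_sumr [X in _ - X]big_mkcond/= -sumrB (le_trans (ler_norm_sum _ _ _))//.
  rewrite [leRHS]mulr_suml; apply: ler_sum => g2 _; case: ifPn => g12.
    by rewrite subrr normr0 !mulr_ge0// ?exprn_ge0// !addr_ge0// exprn_ge0.
  rewrite subr0 -ltnNge in g12 *.
  have fle (g : nat) (y : R) : `|y / g`!%:R| <= `|y|.
    rewrite normrM normfV [X in _ / X]ger0_norm// ler_pdivrMr ?ltr0n ?fact_gt0//.
    by rewrite ler_peMr// ler1n fact_gt0.
  rewrite normrM [`|Qsum _ _ _ * _|]normrM.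
  apply: le_trans (_ : al g1 * `|a ^+ g1| * `|(L * v) ^+ g2| <= _).
    by apply: ler_pM => //; rewrite ler_wpM2l// fle.
  rewrite !normrX normrM (ger0_norm L0) exprMn.
  rewrite (_ : _ * _ * _ = al g1 * be g2 * (`|a| ^+ g1 * `|v| ^+ g2)); last by rewrite /be; ring.
  by rewrite ler_wpM2l ?mono// mulr_ge0// exprn_ge0.
have bEr : b <= Er by rewrite /Er addrAC lerDr addr_ge0 ?exprn_ge0.
have hzb : `|zb| <= Z * b.
  rewrite (_ : zb = lam * ((2 * (t + a) * x + b * x ^+ 2) * b)); last by rewrite /zb; ring.
  rewrite !normrM (ger0_norm b0) mulrA ler_wpM2r// ler_wpM2l//.
  rewrite (le_trans (ler_normD _ _))//; apply: lerD.
    rewrite !normrM ger0_norm//; apply: ler_pM => //.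
    by rewrite ler_wpM2l// (le_trans (ler_normD _ _))// lerD2l.
  rewrite normrM (ger0_norm b0) normrX (le_trans (_ : _ <= 1 * `|x| ^+ 2))//.
    by rewrite ler_wpM2r.
  by rewrite mul1r lerXn2r.
have b2 : b ^+ 2 <= del * b by rewrite expr2 ler_wpM2r.
have hEb : `|expR zb - 1 - 2 * t * lam * b * x| <= Kb * (del * b).
  rewrite (_ : _ - _ - _ = (expR zb - 1 - zb) + lam * (2 * a * b * x + b ^+ 2 * x ^+ 2));
    last by rewrite /zb; ring.
  rewrite (le_trans (ler_normD _ _))// /Kb [leRHS]mulrDl; apply: lerD.
    have zbZ : `|zb| <= Z by apply: le_trans hzb _; rewrite ler_piMr.
    apply: le_trans (expR_sub2 zbZ) _; rewrite -mulrA ler_wpM2l ?expR_ge0//.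
    apply: le_trans (_ : (Z * b) ^+ 2 <= _); first by apply: lerXn2r => //; rewrite nnegrE mulr_ge0.
    by rewrite exprMn ler_wpM2l ?exprn_ge0.
  rewrite normrM -[leRHS]mulrA ler_wpM2l// (le_trans (ler_normD _ _))// [leRHS]mulrDl; apply: lerD.
    rewrite !normrM (ger0_norm b0) ger0_norm//.
    rewrite (_ : 2 * `|a| * b * `|x| = 2 * `|x| * (`|a| * b)); last by ring.
    apply: ler_pM; rewrite ?mulr_ge0//; first by rewrite ler_wpM2l.
    by rewrite ler_wpM2r.
  rewrite normrM !normrX (ger0_norm b0) mulrC; apply: ler_pM; rewrite ?exprn_ge0//.
  by rewrite lerXn2r// nnegrE.
pose z1 := lam * (2 * t * a + a ^+ 2) + L * v.
have E1 : Ea * Ev = expR z1 by rewrite -expRD; congr expR; rewrite /z1; ring.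
have hz1 : `|z1| <= Z2 * del.
  rewrite (le_trans (ler_normD _ _))// /Z2 [leRHS]mulrDl; apply: lerD.
    rewrite normrM -[leRHS]mulrA ler_wpM2l// (le_trans (ler_normD _ _))// [leRHS]mulrDl; apply: lerD.
      by rewrite !normrM ger0_norm// ler_wpM2l// mulr_ge0.
    by rewrite normrX expr2 ler_pM.
  by rewrite normrM (ger0_norm L0) ler_wpM2l.
have hz2 : `|z1| <= Z2 by apply: le_trans hz1 _; rewrite ler_piMr.
have hE1 : `|Ea * Ev - 1| <= expR Z2 * Z2 * del.
  by rewrite E1 (le_trans (expR_sub1 hz2))// -[leRHS]mulrA ler_wpM2l ?expR_ge0.
have hEE : `|Ea * Ev| <= expR Z2.
  by rewrite E1 ger0_norm ?expR_ge0// ler_expR (le_trans (ler_norm _)).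
(* The five differences match the five summands of [K] in order: cut of the product, Taylor
   remainders in [a] and in [v], second order in [b], and interaction of [b] with [(a, v)]. *)
have -> : Ea * Ev * expR zb - (trunc lam t r a v + 2 * t * lam * b * x) =
   (Pa * Pv - trunc lam t r a v) + (Ea - Pa) * Ev + Pa * (Ev - Pv) +
   Ea * Ev * (expR zb - 1 - 2 * t * lam * b * x) +
   (Ea * Ev - 1) * (2 * t * lam * b * x).
  ring.
have hb2 : `|2 * t * lam * b * x| <= 2 * `|t| * `|lam| * B * b.
  rewrite !normrM (ger0_norm b0) ger0_norm// -!mulrA !ler_wpM2l// mulrC.
  by rewrite ler_wpM2r.
have dbE : del * b <= del * Er by rewrite ler_wpM2l.
have dE0 : 0 <= del * Er by rewrite mulr_ge0// (le_trans b0).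
have -> : K * (del * Er) = KT * (del * Er) + Ka * CL * (del * Er) + CP * Kv * (del * Er)
    + expR Z2 * Kb * (del * Er) + expR Z2 * Z2 * (2 * `|t| * `|lam| * B) * (del * Er).
  by rewrite /K; ring.
apply: ler_normD2; last first.
  rewrite normrM; apply: le_trans (_ : expR Z2 * Z2 * del * (2 * `|t| * `|lam| * B * b) <= _).
    exact: ler_pM.
  rewrite (_ : _ * (_ * b) = expR Z2 * Z2 * (2 * `|t| * `|lam| * B) * (del * b)); last by ring.
  by apply: ler_wpM2l => //; rewrite !mulr_ge0// expR_ge0.
apply: ler_normD2; last first.
  rewrite normrM -[leRHS]mulrA; apply: ler_pM => //; apply: le_trans hEb _.
  exact: ler_wpM2l.
apply: ler_normD2; last first.
  by rewrite normrM -[leRHS]mulrA; apply: ler_pM.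
apply: ler_normD2 => //.
by rewrite normrM mulrAC; apply: ler_pM.
Qed.

End Expansions.

(** * Local models; regular atoms *)

Section LocalModels.
Variable R : realType.
Local Notation D := (R * R * R)%type.
Implicit Types (th d : D).

Definition small (del : R) (d : D) : bool :=
  [&& `|d.1.1| <= del, `|d.1.2| <= del & `|d.2| <= del].

(* [coef d l m] is the coefficient of [lam ^+ l * x ^+ m] in an expansion of
   [hexp lam x (th + d) / hexp lam x th] with remainder [o(E d)]; the last clause says that
   the coefficients of at most [s] weighted atoms, once summed, still control [E]. *)
Definition local_model (th : D) (s : nat) (E : D -> R) : Prop :=
  exists (A0 : nat) (coef : D -> nat -> nat -> R),
  [/\ forall d, coef d 0%N 0%N = 1,
      forall A B lam, (A0 <= A)%N -> 0 <= B -> exists2 K : R, 0 <= K &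
        forall del d x, del <= 1 -> small del d -> quadrant (th + d) -> `|x| <= B ->
        `|hexp lam x (th + d) - hexp lam x th *
            (\sum_(l < A) \sum_(m < A) coef d l m * lam ^+ l * x ^+ m)| <= K * (del * E d) &
      exists2 K : R, 0 <= K & exists2 del0 : R, 0 < del0 &
        forall A del (xs : seq (R * D)), (A0 <= A)%N -> 0 <= del <= del0 -> (size xs <= s)%N ->
          {in xs, forall x, [&& 0 <= x.1, small del x.2 & quadrant (th + x.2)]} ->
          \sum_(x <- xs) x.1 <= 1 ->
          \sum_(x <- xs) x.1 * E x.2 <=
            K * (\sum_(l < A) \sum_(m < A | (0 < l + m)%N)
                   `|\sum_(x <- xs) x.1 * coef x.2 l m| + del * \sum_(x <- xs) x.1 * E x.2)].

Lemma sum2_widen (A0 A : nat) (f : nat -> nat -> R) : (A0 <= A)%N ->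
  (forall l m, ~~ ((l < A0) && (m < A0))%N -> f l m = 0) ->
  \sum_(l < A) \sum_(m < A) f l m = \sum_(l < A0) \sum_(m < A0) f l m.
Proof.
move=> AA f0.
rewrite [RHS](big_ord_widen A (fun l => \sum_(m < A0) f l m))// [RHS]big_mkcond.
apply: eq_bigr => l _; case: ifPn => lA; last first.
  by apply: big1 => m _; rewrite f0// (negbTE lA).
rewrite [RHS](big_ord_widen A (fun m => f l m))// [RHS]big_mkcond.
apply: eq_bigr => m _; case: ifPn => // mA.
by rewrite f0// lA (negbTE mA).
Qed.

Lemma coef_le_sum (A : nat) (u : nat -> nat -> R) l m : (l < A)%N -> (m < A)%N ->
  (0 < l + m)%N -> `|u l m| <= \sum_(l < A) \sum_(m < A | (0 < l + m)%N) `|u l m|.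
Proof.
move=> lA mA lm; rewrite (bigD1 (Ordinal lA))//= (bigD1 (Ordinal mA))//= -addrA lerDl.
by rewrite addr_ge0// ?sumr_ge0// => i _; rewrite sumr_ge0.
Qed.

Section Regular.
Variable th : D.
(** [m0], [m1] and [m2] are the coefficients of 1, x and x^2 in the increment of the mean [h1] from
    [th] to [th + d]. *)
Definition m0 d := 2 * th.1.1 * d.1.1 + d.1.1 ^+ 2.
Definition m1 d := 2 * (th.1.1 * d.1.2 + th.1.2 * d.1.1) + 2 * d.1.1 * d.1.2.
Definition m2 d := 2 * th.1.2 * d.1.2 + d.1.2 ^+ 2.

(* The coefficients of [1 + z + z ^+ 2 / 2] in [lam] and [x], where
   [z = lam * (m0 + m1 * x + m2 * x ^+ 2) + lam ^+ 2 * v / 2]. *)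
Definition regular_coef d (l m : nat) : R :=
  match l, m with
  | 0, 0 => 1
  | 1, 0 => m0 d | 1, 1 => m1 d | 1, 2 => m2 d
  | 2, 0 => d.2 / 2 + m0 d ^+ 2 / 2 | 2, 1 => m0 d * m1 d
  | 2, 2 => m1 d ^+ 2 / 2 + m0 d * m2 d | 2, 3 => m1 d * m2 d | 2, 4 => m2 d ^+ 2 / 2
  | 3, 0 => d.2 / 2 * m0 d | 3, 1 => d.2 / 2 * m1 d | 3, 2 => d.2 / 2 * m2 d
  | 4, 0 => d.2 ^+ 2 / 8
  | _, _ => 0
  end.

Definition sqnorm d : R := d.1.1 ^+ 2 + d.1.2 ^+ 2 + d.2 ^+ 2.

Lemma sqnorm_ge0 d : 0 <= sqnorm d.
Proof. by rewrite !addr_ge0// sqr_ge0. Qed.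

Lemma hexp_bound (B lam : R) : 0 <= B -> exists2 H : R, 0 <= H &
  forall x, `|x| <= B -> hexp lam x th <= H.
Proof.
move=> B0; eexists => [|x xB]; last exact: hexp_le xB.
exact: expR_ge0.
Qed.

Definition hexp_exponent lam d x : R :=
  lam * (m0 d + m1 d * x + m2 d * x ^+ 2) + lam ^+ 2 * (d.2 / 2).

Lemma hexp_shift lam d x : hexp lam x (th + d) = hexp lam x th * expR (hexp_exponent lam d x).
Proof.
by rewrite -expRD; congr expR; rewrite /hexp_exponent /h1 /m0 /m1 /m2 /=; field.
Qed.

Lemma hexp_exponent_bound (B lam : R) : 0 <= B -> exists2 Z : R, 0 <= Z &
  forall del d x, del <= 1 -> small del d -> `|x| <= B ->
    `|hexp_exponent lam d x| <= Z * (`|d.1.1| + `|d.1.2| + `|d.2|).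
Proof.
move=> B0.
pose Z := `|lam| * (2 * (`|th.1.1| + `|th.1.2| * B) + 2 * (1 + B)) * (1 + B) + lam ^+ 2 / 2.
have Z0 : 0 <= Z.
  rewrite addr_ge0 ?divr_ge0 ?sqr_ge0// mulr_ge0 ?addr_ge0// mulr_ge0// addr_ge0//.
    by rewrite mulr_ge0// addr_ge0// mulr_ge0.
  by rewrite mulr_ge0// addr_ge0.
exists Z => // del d x d1 /and3P[ad bd vd] xB.
set S := `|d.1.1| + `|d.1.2| + `|d.2|; set z := hexp_exponent lam d x.
have S0 : 0 <= S by rewrite !addr_ge0.
have del0 : 0 <= del := le_trans (normr_ge0 _) ad.
have -> : z = lam * ((2 * (th.1.1 + th.1.2 * x) + (d.1.1 + d.1.2 * x)) * (d.1.1 + d.1.2 * x)) +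
   lam ^+ 2 / 2 * d.2 by rewrite /z /hexp_exponent /m0 /m1 /m2; ring.
have abx : `|d.1.1 + d.1.2 * x| <= (1 + B) * (`|d.1.1| + `|d.1.2|).
  rewrite (le_trans (ler_normD _ _))// normrM.
  have : `|d.1.2| * `|x| <= `|d.1.2| * B by rewrite ler_wpM2l.
  have : 0 <= `|d.1.1| * B by rewrite mulr_ge0.
  have : 0 <= `|d.1.2| by []. lra.
have abx2 : `|d.1.1 + d.1.2 * x| <= 2 * (1 + B).
  apply: le_trans abx _; rewrite mulrC ler_wpM2r ?addr_ge0//; lra.
have tx : `|2 * (th.1.1 + th.1.2 * x)| <= 2 * (`|th.1.1| + `|th.1.2| * B).
  rewrite normrM ger0_norm// ler_wpM2l// (le_trans (ler_normD _ _))// lerD2l.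
  by rewrite normrM ler_wpM2l.
rewrite (le_trans (ler_normD _ _))// (_ : Z * S = `|lam| *
   ((2 * (`|th.1.1| + `|th.1.2| * B) + 2 * (1 + B)) * ((1 + B) * (`|d.1.1| + `|d.1.2|))) +
   lam ^+ 2 / 2 * `|d.2| + (lam ^+ 2 / 2 * (`|d.1.1| + `|d.1.2|) +
   `|lam| * (2 * (`|th.1.1| + `|th.1.2| * B) + 2 * (1 + B)) * (1 + B) * `|d.2|));
  last by rewrite /Z /S; ring.
rewrite ler_wpDr//.
  have h1 : 0 <= lam ^+ 2 / 2 by rewrite divr_ge0 ?sqr_ge0.
  have h2 : 0 <= 2 * (`|th.1.1| + `|th.1.2| * B) + 2 * (1 + B).
    by rewrite !(addr_ge0, mulr_ge0).
  have h3 : 0 <= `|d.1.1| + `|d.1.2| by rewrite addr_ge0.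
  have h4 : 0 <= 1 + B by rewrite addr_ge0.
  by apply: addr_ge0; [exact: mulr_ge0|do 3 (apply: mulr_ge0 => //)].
apply: lerD; last by rewrite normrM ger0_norm// divr_ge0 ?sqr_ge0.
rewrite normrM ler_wpM2l// normrM; apply: ler_pM => //.
by rewrite (le_trans (ler_normD _ _))// lerD.
Qed.

Lemma hexp_continuous_at (B lam : R) : 0 <= B -> exists2 C : R, 0 <= C &
  forall del d x, del <= 1 -> small del d -> `|x| <= B ->
    `|hexp lam x (th + d) - hexp lam x th| <= C * del.
Proof.
move=> B0; have [H H0 hH] := hexp_bound lam B0.
have [Z Z0 hZ] := hexp_exponent_bound lam B0.
exists (H * (expR (3 * Z) * (Z * 3))) => [|del d x d1 sd xB].
  by rewrite !mulr_ge0// expR_ge0.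
have /and3P[ad bd vd] := sd; have del0 : 0 <= del := le_trans (normr_ge0 _) ad.
have zS := hZ del d x d1 sd xB.
have S3 : `|d.1.1| + `|d.1.2| + `|d.2| <= 3 * del by lra.
have z3 : `|hexp_exponent lam d x| <= Z * (3 * del).
  by apply: le_trans zS _; rewrite ler_wpM2l.
have z1 : `|hexp_exponent lam d x| <= 3 * Z.
  by apply: le_trans z3 _; rewrite mulrC ler_wpM2r//; lra.
rewrite hexp_shift -[X in _ - X]mulr1 -mulrBr normrM (ger0_norm (expR_ge0 _)).
rewrite -[leRHS]mulrA; apply: ler_pM; rewrite ?expR_ge0//; first exact: hH.
apply: le_trans (expR_sub1 z1) _; rewrite -[leRHS]mulrA ler_wpM2l ?expR_ge0//.
by rewrite -[leRHS]mulrA.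
Qed.

(** With [S] the l1 norm of [d], the exponent is at most [Z * S], and [S <= 3 * del],
    [S ^ 2 <= 3 * sqnorm d]; the cubic remainder is therefore of order [del * sqnorm d]. The table
    of coefficients is 5 by 5, whence [5 <= A]. *)
Lemma regular_expansion (A : nat) (B lam : R) : (5 <= A)%N -> 0 <= B ->
  exists2 K : R, 0 <= K & forall del d x, del <= 1 -> small del d -> `|x| <= B ->
    `|hexp lam x (th + d) - hexp lam x th *
       (\sum_(l < A) \sum_(m < A) regular_coef d l m * lam ^+ l * x ^+ m)| <=
    K * (del * sqnorm d).
Proof.
move=> A5 B0.
have [H H0 hH] := hexp_bound lam B0.
have [Z Z0 hZ] := hexp_exponent_bound lam B0.
exists (H * (expR (3 * Z) * (Z ^+ 3 * 9))) => [|del d x d1 sd xB].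
  by rewrite mulr_ge0// mulr_ge0 ?expR_ge0// mulr_ge0// exprn_ge0.
have /and3P[ad bd vd] := sd; have del0 : 0 <= del := le_trans (normr_ge0 _) ad.
pose z := hexp_exponent lam d x.
rewrite hexp_shift -/z.
have -> : \sum_(l < A) \sum_(m < A) regular_coef d l m * lam ^+ l * x ^+ m =
   1 + z + z ^+ 2 / 2.
  rewrite (@sum2_widen 5 A (fun l m => regular_coef d l m * lam ^+ l * x ^+ m))//; last first.
    by move=> [|[|[|[|[|l]]]]] [|[|[|[|[|m]]]]] //= _; rewrite !mul0r.
  by rewrite !big_ord_recr !big_ord0 /= /z /hexp_exponent; field.
rewrite -mulrBr normrM (ger0_norm (expR_ge0 _)) -[leRHS]mulrA.
apply: ler_pM; rewrite ?expR_ge0//; first exact: hH.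
pose S := `|d.1.1| + `|d.1.2| + `|d.2|.
have S0 : 0 <= S by rewrite !addr_ge0.
have S3 : S <= 3 * del by rewrite /S; lra.
have zS : `|z| <= Z * S by exact: (hZ del).
have z3 : `|z| <= 3 * Z.
  apply: le_trans zS _; rewrite mulrC ler_wpM2r//; lra.
apply: le_trans (expR_sub3 z3) _; rewrite -[leRHS]mulrA ler_wpM2l ?expR_ge0//.
apply: le_trans (_ : (Z * S) ^+ 3 <= _).
  by apply: lerXn2r => //; rewrite nnegrE mulr_ge0.
rewrite exprMn -[leRHS]mulrA ler_wpM2l ?exprn_ge0//.
have SS : S ^+ 2 <= 3 * sqnorm d.
  rewrite /sqnorm -(real_normK (num_real d.1.1)) -(real_normK (num_real d.1.2)).
  rewrite -(real_normK (num_real d.2)) /S.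
  have := sqr_ge0 (`|d.1.1| - `|d.1.2|); have := sqr_ge0 (`|d.1.1| - `|d.2|).
  have := sqr_ge0 (`|d.1.2| - `|d.2|); lra.
rewrite exprS; apply: le_trans (_ : (3 * del) * (3 * sqnorm d) <= _).
  by apply: ler_pM => //; rewrite exprn_ge0.
by rewrite le_eqVlt; apply/orP; left; apply/eqP; ring.
Qed.

(** A linear combination is sought because the coefficients of several atoms will be summed before
    absolute values are taken. At order lam^2 and degrees 2, 3, 4 in [x] the variance is absent and
    the squared mean increment yields the squares of both increments; [v ^ 2] stands alone at lam^4.
    In the singular case, slope zero and intercept nonzero, every coefficient of positive degree in
    [x] has a factor [b], so the intercept increment is tied to the variance. *)
Lemma regular_control : (th.1.2 = 0 -> th.1.1 = 0) ->
  exists c : R * R * R * R * R, exists2 K : R, 0 <= K &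
  forall del d, del <= 1 -> small del d ->
   `|sqnorm d - (c.1.1.1.1 * regular_coef d 1 0 + c.1.1.1.2 * regular_coef d 1 2 +
      c.1.1.2 * regular_coef d 2 2 + c.1.2 * regular_coef d 2 3 +
      c.2 * regular_coef d 2 4 + 8 * regular_coef d 4 0)| <= K * (del * sqnorm d).
Proof.
rewrite /regular_coef /m0 /m1 /m2 /sqnorm.
set t1 := th.1.1; set t2 := th.1.2.
have [t20|t20] := eqVneq t2 0.
  (* With slope and intercept both zero, [m0] and [m2] are exact squares and the combination has no
     remainder. *)
  move=> /(_ t20) t10; exists (1, 1, 0, 0, 0), 0 => // del d _ _ /=.
  rewrite t10 t20 !(mul0r, mulr0, add0r, mul1r, addr0).
  by rewrite (_ : _ - _ = 0) ?normr0//; field.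
move=> _.
(* [c22], [c23], [c24] invert the quadratic parts of the coefficients (2, 2), (2, 3), (2, 4). *)
pose c22 := (2 * t2 ^+ 2)^-1; pose c23 := - (t1 / t2 ^+ 3).
pose c24 := (1 + 3 * t1 ^+ 2 / t2 ^+ 2) / (2 * t2 ^+ 2).
exists (0, 0, c22, c23, c24).
exists (`|c22| * (6 * `|t1| + 6 * `|t2| + 3) + `|c23| * (2 * `|t1| + 6 * `|t2| + 2) +
  `|c24| * (2 * `|t2| + 1)).
  have h1 : 0 <= 6 * `|t1| + 6 * `|t2| + 3 by rewrite !(addr_ge0, mulr_ge0).
  have h2 : 0 <= 2 * `|t1| + 6 * `|t2| + 2 by rewrite !(addr_ge0, mulr_ge0).
  have h3 : 0 <= 2 * `|t2| + 1 by rewrite !(addr_ge0, mulr_ge0).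
  by apply: addr_ge0; [apply: addr_ge0|]; exact: mulr_ge0.
move=> del [[a b] v] d1 /and3P[/= ad bd vd].
set e := del * _.
have del0 : 0 <= del := le_trans (normr_ge0 _) ad.
(* The combination is exact at second order; [e22], [e23] and [e24] collect its cubic and quartic
   terms, each of size [del * sqnorm d]. *)
pose e22 := 6 * t1 * (a * b * b) + 6 * t2 * (a * a * b) + 3 * (a * a * (b * b)).
pose e23 := 2 * t1 * (b * b * b) + 6 * t2 * (a * b * b) + 2 * (a * b * (b * b)).
pose e24 := 2 * t2 * (b * b * b) + (b * b * (b * b)) / 2.
have -> : a ^+ 2 + b ^+ 2 + v ^+ 2 -
   (0 * (2 * t1 * a + a ^+ 2) + 0 * (2 * t2 * b + b ^+ 2) +
    c22 * ((2 * (t1 * b + t2 * a) + 2 * a * b) ^+ 2 / 2 +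
    (2 * t1 * a + a ^+ 2) * (2 * t2 * b + b ^+ 2)) +
    c23 * ((2 * (t1 * b + t2 * a) + 2 * a * b) * (2 * t2 * b + b ^+ 2)) +
    c24 * ((2 * t2 * b + b ^+ 2) ^+ 2 / 2) + 8 * (v ^+ 2 / 8)) =
  - (c22 * e22 + c23 * e23 + c24 * e24).
  by rewrite /c22 /c23 /c24 /e22 /e23 /e24; field.
rewrite normrN.
have a1 : `|a| <= 1 by exact: le_trans d1.
have b1 : `|b| <= 1 by exact: le_trans d1.
have ab2 : `|a * b| <= a ^+ 2 + b ^+ 2 + v ^+ 2.
  rewrite normrM -(real_normK (num_real a)) -(real_normK (num_real b)).
  have := sqr_ge0 (`|a| - `|b|); have := sqr_ge0 v; have := sqr_ge0 (`|a| + `|b|); lra.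
have aa2 : `|a * a| <= a ^+ 2 + b ^+ 2 + v ^+ 2.
  rewrite -expr2 ger0_norm ?sqr_ge0//; have := sqr_ge0 b; have := sqr_ge0 v; lra.
have bb2 : `|b * b| <= a ^+ 2 + b ^+ 2 + v ^+ 2.
  rewrite -expr2 ger0_norm ?sqr_ge0//; have := sqr_ge0 a; have := sqr_ge0 v; lra.
have cub (p q : R) : `|p| <= a ^+ 2 + b ^+ 2 + v ^+ 2 -> `|q| <= del -> `|p * q| <= e.
  by move=> hp hq; rewrite normrM /e mulrC; apply: ler_pM.
have bbd : `|b * b| <= del by rewrite normrM -[del]mulr1; apply: ler_pM.
have e0 : 0 <= e by rewrite mulr_ge0// !addr_ge0// sqr_ge0.
have abb := cub _ _ ab2 bd; have aab := cub _ _ aa2 bd; have bbb := cub _ _ bb2 bd.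
have aabb := cub _ _ aa2 bbd; have abbb := cub _ _ ab2 bbd; have bbbb := cub _ _ bb2 bbd.
have sc (k y : R) : `|y| <= e -> `|k * y| <= `|k| * e by move=> h; rewrite normrM ler_wpM2l.
have H22 : `|e22| <= (6 * `|t1| + 6 * `|t2| + 3) * e.
  have -> : (6 * `|t1| + 6 * `|t2| + 3) * e = 6 * `|t1| * e + 6 * `|t2| * e + 3 * e by ring.
  apply: ler_normD2.
    apply: ler_normD2.
      by apply: le_trans (sc _ _ abb) _; rewrite normrM ger0_norm.
    by apply: le_trans (sc _ _ aab) _; rewrite normrM ger0_norm.
  by apply: le_trans (sc _ _ aabb) _; rewrite ger0_norm.
have H23 : `|e23| <= (2 * `|t1| + 6 * `|t2| + 2) * e.
  have -> : (2 * `|t1| + 6 * `|t2| + 2) * e = 2 * `|t1| * e + 6 * `|t2| * e + 2 * e by ring.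
  apply: ler_normD2.
    apply: ler_normD2.
      by apply: le_trans (sc _ _ bbb) _; rewrite normrM ger0_norm.
    by apply: le_trans (sc _ _ abb) _; rewrite normrM ger0_norm.
  by apply: le_trans (sc _ _ abbb) _; rewrite ger0_norm.
have H24 : `|e24| <= (2 * `|t2| + 1) * e.
  rewrite /e24 [leRHS]mulrDl; apply: ler_normD2.
    by apply: le_trans (sc _ _ bbb) _; rewrite normrM ger0_norm.
  rewrite mul1r normrM [`|2^-1|]ger0_norm ?invr_ge0//.
  by apply: le_trans bbbb; rewrite ler_piMr// invf_le1// ler1n.
set K1 := 6 * _ + _ + _; set K2 := 2 * _ + _ + 2; set K3 := 2 * _ + 1.
have -> : (`|c22| * K1 + `|c23| * K2 + `|c24| * K3) * e =
  `|c22| * (K1 * e) + `|c23| * (K2 * e) + `|c24| * (K3 * e) by ring.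
apply: ler_normD2; last by rewrite normrM ler_wpM2l.
by apply: ler_normD2; rewrite normrM ler_wpM2l.
Qed.

(** The control is linear in the coefficients of each atom, so it can be summed with nonnegative
    weights over any number of atoms. *)
Lemma regular_model s : (th.1.2 = 0 -> th.1.1 = 0) -> local_model th s sqnorm.
Proof.
move=> hth; exists 5%N, regular_coef; split=> //.
  move=> A B lam A5 B0; have [K K0 hK] := regular_expansion lam A5 B0.
  by exists K => // del d x d1 sd _ xB; exact: hK.
have [[[[[c10 c12] c22] c23] c24] [K K0 /= hK]] := regular_control hth.
pose C := `|c10| + `|c12| + `|c22| + `|c23| + `|c24| + 8.
have C0 : 0 <= C by rewrite !addr_ge0.
exists (C + K); first exact: addr_ge0.
exists 1 => // A del xs A5 /andP[del0 del1] _ hxs _.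
set Q := \sum_(l < A) _; set S := \sum_(x <- xs) _ * sqnorm _.
pose u l m := \sum_(x <- xs) x.1 * regular_coef x.2 l m.
have uQ l m : (l < 5)%N -> (m < 5)%N -> (0 < l + m)%N -> `|u l m| <= Q.
  by move=> l5 m5 lm; apply: (coef_le_sum u) => //; [exact: leq_trans A5|exact: leq_trans A5].
have Q0 : 0 <= Q by apply: le_trans (uQ 1%N 0%N _ _ _).
have S0 : 0 <= S.
  rewrite /S big_seq; apply: sumr_ge0 => x /hxs /and3P[w0 _ _].
  by rewrite mulr_ge0// sqnorm_ge0.
have : `|S - (c10 * u 1%N 0%N + c12 * u 1%N 2 + c22 * u 2 2 + c23 * u 2 3 +
    c24 * u 2 4 + 8 * u 4 0%N)| <= K * (del * S).
  rewrite /u !mulr_sumr -!big_split -sumrB/= (le_trans (ler_norm_sum _ _ _))//.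
  rewrite big_seq [leRHS]big_seq; apply: ler_sum => x /hxs /and3P[w0 sx _].
  have := ler_wpM2l w0 (hK del x.2 del1 sx).
  rewrite -[X in X * `|_|](ger0_norm w0) -normrM => h.
  rewrite (_ : K * _ = x.1 * (K * (del * sqnorm x.2))); last by ring.
  by apply: le_trans h; rewrite le_eqVlt; apply/orP; left; apply/eqP; congr `|_|; ring.
move=> h.
have h8 : `|c10 * u 1%N 0%N + c12 * u 1%N 2 + c22 * u 2 2 + c23 * u 2 3 +
    c24 * u 2 4 + 8 * u 4 0%N| <= C * Q.
  have -> : C * Q = `|c10| * Q + `|c12| * Q + `|c22| * Q + `|c23| * Q + `|c24| * Q + 8 * Q.
    by rewrite /C; ring.
  do 5 (apply: ler_normD2;
    last by rewrite normrM ?[`|8|]ger0_norm// ler_wpM2l// uQ).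
  by rewrite normrM ler_wpM2l// uQ.
have dS0 : 0 <= del * S by exact: mulr_ge0.
move: h h8; set L := _ + 8 * _ => h h8.
have h1 : S <= `|S - L| + `|L|.
  by rewrite (le_trans (ler_norm S))// -{1}(subrK L S) ler_normD.
have h2 : 0 <= C * (del * S) + K * Q by rewrite addr_ge0// mulr_ge0.
have -> : (C + K) * (Q + del * S) = C * Q + K * (del * S) + (C * (del * S) + K * Q) by ring.
apply: (le_trans h1); apply: ler_wpDr => //; rewrite [leRHS]addrC; exact: lerD.
Qed.

End Regular.
End LocalModels.

(** * Singular atoms *)

Section SingularModel.
Variable R : realType.
Local Notation D := (R * R * R)%type.

(** The numerators are linear in the weights, so one atom of weight one gives the expansion
    coefficient of that atom. *)
Definition sys1 (t : R) (r l : nat) (a v : R) : R :=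
  sys_num t r l (fun _ : 'I_1 => a) (fun=> v) (fun=> 1).

Lemma sys_num_linear (t : R) (s r l : nat) (a b c : 'I_s -> R) :
  sys_num t r l a b c = \sum_(i < s) c i * sys1 t r l (a i) (b i).
Proof.
rewrite /sys1 /sys_num.
under [RHS]eq_bigr do rewrite mulr_sumr.
rewrite [RHS]exchange_big/=; apply: eq_bigr => g1 _.
under [RHS]eq_bigr do rewrite mulr_sumr.
rewrite [RHS]exchange_big/=; apply: eq_bigr => g2 _.
under [RHS]eq_bigr do rewrite mulr_sumr.
rewrite [RHS]exchange_big/=; apply: eq_bigr => u _.
rewrite mulr_sumr; apply: eq_bigr => i _; rewrite big_ord1; ring.
Qed.

Lemma sys1_0 (t : R) (r : nat) (a v : R) : sys1 t r 0 a v = 1.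
Proof.
rewrite /sys1 /sys_num (bigD1 ord0)//= [X in _ + X]big1 ?addr0; last first.
  move=> g1 g10; apply: big1 => g2 _; apply: big1 => u /and3P[_ _ /eqP h].
  by exfalso; move: g10; rewrite -val_eqE/=; lia.
rewrite (bigD1 ord0)//= [X in _ + X]big1 ?addr0; last first.
  move=> g2 g20; apply: big1 => u /and3P[_ _ /eqP h].
  by exfalso; move: g20; rewrite -val_eqE/=; lia.
rewrite (bigD1 ord0)//= [X in _ + X]big1 ?addr0; last first.
  by move=> u /andP[/andP[h _]]; rewrite -val_eqE/=; lia.
by rewrite big_ord1 /Ppoly /= hornerC !expr0 fact0 !(mulr1, mul1r, invr1).
Qed.

(** Since the slope of the atom is zero, [x] enters the kept terms only through the linear term
    [2 * t * lam * b * x]; the column of degree zero is the polynomial system. *)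
Definition singular_coef (t : R) (r : nat) (d : D) (l m : nat) : R :=
  match m with
  | 0 => if (l <= r.*2)%N then sys1 t r l d.1.1 d.2 else 0
  | 1 => if l == 1%N then 2 * t * d.1.2 else 0
  | _ => 0
  end.

Definition singular_err (r : nat) (d : D) : R :=
  `|d.1.1| ^+ r + `|d.1.2| + `|d.2| ^+ uphalf r.

Lemma sum_nth_seq (T : Type) (s : nat) (xs : seq T) (x0 : T) (f : T -> R) :
  (size xs <= s)%N -> f x0 = 0 ->
  \sum_(i < s) f (nth x0 xs i) = \sum_(x <- xs) f x.
Proof.
move=> xss f0; rewrite (big_nth x0) big_mkord.
rewrite [RHS](big_ord_widen s (fun i => f (nth x0 xs i)))// [RHS]big_mkcond.
by apply: eq_bigr => i _; case: ltnP => // h; rewrite nth_default.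
Qed.

(** The slope of [th] is zero, so membership of [th + d] in the quadrant forces [d.1.2 >= 0]: the
    coefficient of [lam * x] is a sum without cancellation and controls the slopes. The remaining
    error is the denominator of the system, controlled by its numerators because the order [r] has
    no solution. *)
Lemma singular_model (th : D) (s r : nat) : quadrant th -> th.1.1 != 0 -> th.1.2 = 0 ->
  (0 < r)%N -> ~ sys_solvable th.1.1 s r -> local_model th s (singular_err r).
Proof.
move=> qth t0 t20 r0 nsol.
have tpos : 0 < th.1.1 by case/andP: qth => h _; rewrite lt_neqAle eq_sym t0.
set t := th.1.1 in t0 nsol tpos *.
exists r.*2.+1, (singular_coef t r); split.
- by move=> d /=; exact: sys1_0.
- move=> A B lam AA B0.
  have [K K0 hK] := singular_expansion t lam r B0.
  exists (hexp lam 0 th * K); first by rewrite mulr_ge0// expR_ge0.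
  move=> del d x d1 /and3P[ad bd vd] /andP[_ b0] xB.
  have b0' : 0 <= d.1.2 by move: b0; rewrite /= t20 add0r.
  have b0d : 0 <= d.1.2 <= del by rewrite b0' (le_trans (ler_norm _)).
  have := hK del d.1.1 d.1.2 d.2 x d1 ad b0d vd xB.
  have hx : hexp lam x th = hexp lam 0 th.
    by rewrite /hexp /h1 t20 !mul0r !addr0.
  have -> : hexp lam x (th + d) = hexp lam 0 th *
      expR (lam * ((t + d.1.1 + d.1.2 * x) ^+ 2 - t ^+ 2) + lam ^+ 2 / 2 * d.2).
    by rewrite -expRD; congr expR; rewrite /h1 /= t20 /t; field.
  have -> : \sum_(l < A) \sum_(m < A) singular_coef t r d l m * lam ^+ l * x ^+ m =
      trunc lam t r d.1.1 d.2 + 2 * t * lam * d.1.2 * x.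
    have A1 : (1 < A)%N by apply: leq_trans AA; rewrite ltnS double_gt0.
    transitivity (\sum_(l < A) (\sum_(m < 2) singular_coef t r d l m * lam ^+ l * x ^+ m)).
      apply: eq_bigr => l _.
      rewrite [RHS](big_ord_widen A (fun m => singular_coef t r d l m * lam ^+ l * x ^+ m))//.
      rewrite [RHS]big_mkcond; apply: eq_bigr => m _; case: ifPn => //.
      by case: m => [[|[|m]] hm] //=; rewrite !mul0r.
    under eq_bigr do rewrite big_ord_recr big_ord1 /= expr0 expr1 mulr1.
    rewrite big_split/=; congr (_ + _).
      have := sys_num_generating lam t r (fun _ : 'I_1 => d.1.1) (fun=> d.2) (fun=> 1).
      rewrite big_ord1 mul1r => <-.
      rewrite [RHS](big_ord_widen A (fun l => sys_num t r l (fun _ : 'I_1 => d.1.1)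
        (fun=> d.2) (fun=> 1) * lam ^+ l))// [RHS]big_mkcond; apply: eq_bigr => l _.
      by rewrite ltnS; case: ifP => //; rewrite mul0r.
    rewrite (bigD1 (Ordinal A1))//= big1 ?addr0; first by ring.
    by move=> l; rewrite -val_eqE/= => /negbTE ->; rewrite !mul0r.
  rewrite hx -mulrBr normrM ger0_norm ?expR_ge0// => h.
  by rewrite -[leRHS]mulrA ler_wpM2l ?expR_ge0// /singular_err (ger0_norm b0').
have [eps eps0 [del0 del00 hb]] := sys_lower_bound nsol.
exists (eps^-1 + (2 * t)^-1); first by rewrite addr_ge0// invr_ge0 ltW// mulr_gt0.
exists del0 => // A del xs AA /andP[d0 dd0] xss hxs sum1.
set Q := \sum_(l < A) _; set S := \sum_(x <- xs) _ * singular_err r _.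
have S0 : 0 <= S.
  rewrite /S big_seq; apply: sumr_ge0 => x /hxs /and3P[w0 _ _].
  by rewrite mulr_ge0// !addr_ge0// exprn_ge0.
pose u l m := \sum_(x <- xs) x.1 * singular_coef t r x.2 l m.
have uQ l m : (l < A)%N -> (m < A)%N -> (0 < l + m)%N -> `|u l m| <= Q.
  exact: (coef_le_sum u).
have A1 : (1 < A)%N by apply: leq_trans AA; rewrite ltnS double_gt0.
have Q0 : 0 <= Q by apply: (le_trans (normr_ge0 _) (uQ 1%N 0%N _ _ _)) => //; exact: ltnW.
(* The system is stated for exactly [s] sequences; shorter lists are padded with atoms of weight
   zero. *)
pose x0 : R * D := (0, (0, 0, 0)).
pose a (i : 'I_s) := (nth x0 xs i).2.1.1.
pose v (i : 'I_s) := (nth x0 xs i).2.2.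
pose c (i : 'I_s) := (nth x0 xs i).1.
have hnth i : [&& 0 <= (nth x0 xs i).1, `|(nth x0 xs i).2.1.1| <= del0 &
    `|(nth x0 xs i).2.2| <= del0].
  have [isz|isz] := ltnP i (size xs).
    have /hxs /and3P[-> /and3P[ha _ hv] _] := mem_nth x0 isz.
    by rewrite !(le_trans _ dd0).
  by rewrite nth_default//= lexx normr0 ltW.
have csum : \sum_i c i = \sum_(x <- xs) x.1 by exact: (@sum_nth_seq _ s xs x0 (fun x => x.1)).
have hS1 : eps * sys_den r a v c <= \sum_(l < r.*2.+1 | (0 < l)%N) `|sys_num t r l a v c|.
  by apply: hb; rewrite ?csum// => i; case/and3P: (hnth i).
have denE : sys_den r a v c = \sum_(x <- xs) x.1 * (`|x.2.1.1| ^+ r + `|x.2.2| ^+ uphalf r).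
  rewrite -(@sum_nth_seq _ s xs x0 (fun x => x.1 * (`|x.2.1.1| ^+ r + `|x.2.2| ^+ uphalf r)))//.
  by rewrite mul0r.
rewrite denE in hS1; move: hS1; set S1 := \sum_(x <- xs) x.1 * (_ + _) => hS1.
have sysu l : (l < r.*2.+1)%N -> sys_num t r l a v c = u l 0%N.
  move=> lr; rewrite sys_num_linear /u -(@sum_nth_seq _ s xs x0 (fun x => x.1 * singular_coef t r x.2 l 0))//.
    by apply: eq_bigr => i _; rewrite /= -ltnS lr.
  by rewrite mul0r.
have S1Q : eps * S1 <= Q.
  apply: le_trans hS1 _.
  rewrite /Q (big_ord_widen_cond A (fun l => (0 < l)%N) (fun l => `|sys_num t r l a v c|))//.
  rewrite big_mkcond; apply: ler_sum => l _.
  case: ifPn => [/andP[l0 lr]|_]; last exact: sumr_ge0.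
  have A0 : (0 < A)%N by apply: leq_trans AA.
  by rewrite (bigD1 (Ordinal A0)) /= ?addn0// sysu// lerDl sumr_ge0.
(* Here the sign of the slope increments turns the sum of absolute values into the absolute value of
   the coefficient. *)
have hb1 : 2 * t * \sum_(x <- xs) x.1 * `|x.2.1.2| <= Q.
  apply: le_trans (uQ 1%N 1%N A1 A1 isT).
  rewrite /u /= mulr_sumr (le_trans _ (ler_norm _))// big_seq [leRHS]big_seq.
  apply: ler_sum => x /hxs /and3P[_ _ /andP[_]]; rewrite /= t20 add0r => xb.
  by rewrite ger0_norm// mulrCA.
have SE : S = S1 + \sum_(x <- xs) x.1 * `|x.2.1.2|.
  by rewrite -big_split/=; apply: eq_bigr => x _; rewrite /singular_err; ring.
have t2 : 0 < 2 * t by rewrite mulr_gt0.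
rewrite [leLHS]SE mulrDl; apply: lerD.
  rewrite -ler_pdivrMl ?invr_gt0// invrK (le_trans S1Q)// lerDl mulr_ge0//.
rewrite -ler_pdivrMl ?invr_gt0// invrK (le_trans hb1)// lerDl mulr_ge0//.
Qed.

End SingularModel.

(** * Orders one and two of the polynomial system *)

Lemma deriv_one (R : realType) : (1 : {poly R})^`() = 0.
Proof. exact: derivC. Qed.

Local Ltac expand_sys :=
  rewrite /sys1 /sys_num; under eq_bigr do under eq_bigr do rewrite big_mkcond;
  rewrite !big_ord_recr !big_ord0 /= /Ppoly /=;
  rewrite ?(derivD, derivMn, derivM, derivX, deriv0, deriv_one);
  rewrite ?(hornerD, hornerM, hornerMn, hornerX, hornerC, horner0);
  try have -> : (1`! = 1)%N by [];
  try have -> : (0`! = 1)%N by [];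
  try have -> : (2`! = 2)%N by [];
  rewrite ?(expr0, expr1, mulr1, mul1r, invr1, add0r, addr0, mulr0, mul0r).

Section SolvableLowOrder.
Variable R : realType.
Implicit Types t a v : R.

Lemma sys1_1_1 t a v : sys1 t 1 1 a v = 2 * t * a.
Proof. by expand_sys; field. Qed.

Lemma sys1_1_2 t a v : sys1 t 1 2 a v = v / 2.
Proof. by expand_sys; field. Qed.

Lemma sys1_2_1 t a v : sys1 t 2 1 a v = 2 * t * a + a ^+ 2.
Proof. by expand_sys; field. Qed.

Lemma sys1_2_2 t a v : sys1 t 2 2 a v = 2 * t ^+ 2 * a ^+ 2 + v / 2.
Proof. by expand_sys; field. Qed.

Lemma sys1_2_3 t a v : sys1 t 2 3 a v = t * a * v.
Proof. by expand_sys; field. Qed.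

Lemma sys1_2_4 t a v : sys1 t 2 4 a v = v ^+ 2 / 8.
Proof. by expand_sys; field. Qed.

Lemma cvg0_harmonic (C : R) (u : nat -> R) : (forall n, `|u n| <= C * n.+1%:R^-1) ->
  u @ \oo --> (0 : R).
Proof.
move=> hu.
have Ch : (fun n : nat => C * n.+1%:R^-1 : R) @ \oo --> (0 : R).
  by rewrite -[X in _ --> X](mulr0 C); apply: cvgM; [exact: cvg_cst|exact: cvg_harmonic].
apply: (@squeeze_cvgr _ _ _ _ (fun n => - (C * n.+1%:R^-1)) (fun n => C * n.+1%:R^-1)) => //.
  by near=> n; rewrite -ler_norml.
by rewrite -[X in _ --> X]oppr0; exact: cvgN.
Unshelve. all: by end_near.
Qed.

(* Two atoms [a = +- 2 t h], with [b] and the weights chosen so that the equations [l = 1] and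
   [l = 2] of order [r = 2] hold exactly. *)
Lemma sys_solvable_low (t : R) (s r : nat) : 0 < t -> (r = 1 \/ r = 2)%N ->
  sys_solvable t s.+2 r.
Proof.
move=> t0 r12; exists 1; split=> //.
pose h (n : nat) : R := n.+1%:R^-1.
have h0 n : 0 < h n by rewrite invr_gt0.
have h1 n : h n <= 1 by rewrite invf_le1// ler1n.
(* The weighted first and second moments of [a] are [- 2 t h^2] and [4 t^2 h^2]. The imbalance [h]
   of the weights makes [2 t] times the first cancel the second, and [b / 2] cancels [2 t^2] times
   the second. *)
pose a (n : nat) (i : 'I_s.+2) : R := match val i with 0 => 2 * t * h n | _ => - (2 * t * h n) end.
pose b (n : nat) (i : 'I_s.+2) : R := - (16 * t ^+ 4 * h n ^+ 2).
pose c (n : nat) (i : 'I_s.+2) : R :=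
  match val i with 0 => (1 - h n) / 2 | 1 => (1 + h n) / 2 | _ => 0 end.
have sumc n (f : R -> R -> R) : \sum_i c n i * f (a n i) (b n i) =
    (1 - h n) / 2 * f (2 * t * h n) (- (16 * t ^+ 4 * h n ^+ 2)) +
    (1 + h n) / 2 * f (- (2 * t * h n)) (- (16 * t ^+ 4 * h n ^+ 2)).
  by rewrite 2!big_ord_recl/= big1 ?addr0// => i _; rewrite mul0r.
have hh n : h n ^+ 2 <= h n by rewrite expr2 ler_piMr// ltW.
have den n : sys_den r (a n) (b n) (c n) =
    (2 * t * h n) ^+ r + (16 * t ^+ 4 * h n ^+ 2).
  rewrite /sys_den (sumc n (fun a b => `|a| ^+ r + `|b| ^+ (uphalf r))) !normrN.
  rewrite !ger0_norm; last 2 first.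
  - by rewrite !mulr_ge0// ?exprn_ge0// ltW.
  - by rewrite !mulr_ge0// ltW.
  have -> : uphalf r = 1%N by case: r12 => ->.
  by rewrite expr1; field.
have t4 : 0 < 16 * t ^+ 4 by rewrite mulr_gt0// exprn_gt0.
exists a, b, c; split.
- move=> i; apply: (@cvg0_harmonic (2 * t)) => n; rewrite /a; case: (val i) => [|_].
    by rewrite ger0_norm// !mulr_ge0// ltW.
  by rewrite normrN ger0_norm// !mulr_ge0// ltW.
- move=> i; apply: (@cvg0_harmonic (16 * t ^+ 4)) => n; rewrite /b normrN ger0_norm.
    by rewrite ler_wpM2l ?(ltW t4)// hh.
  by rewrite mulr_ge0 ?(ltW t4)// exprn_ge0// ltW.
- move=> n i; rewrite /c; case: (val i) => [|[|_]] //.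
    by rewrite divr_ge0// subr_ge0.
  by rewrite divr_ge0// addr_ge0// ltW.
- split => n; last first.
    by rewrite den addr_gt0// ?exprn_gt0 ?mulr_gt0 ?exprn_gt0 ?mulr_gt0.
  rewrite (_ : \sum_i c n i = 1)//.
  transitivity (\sum_i c n i * (fun _ _ => 1) (a n i) (b n i)).
    by apply: eq_bigr => i _; rewrite mulr1.
  by rewrite (sumc n (fun _ _ => 1)); field.
move=> l /andP[l1 l2].
apply: (@cvg0_harmonic (4 * t + 8 * t ^+ 3 + 8 * t ^+ 4 + 8 * t ^+ 6)) => n.
rewrite den sys_num_linear (sumc n (sys1 t r l)) -/(h n).
set dn := (2 * t * h n) ^+ r + _.
have dn0 : 0 < dn by rewrite addr_gt0// ?exprn_gt0 ?mulr_gt0 ?exprn_gt0 ?mulr_gt0.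
rewrite normrM normfV (gtr0_norm dn0) ler_pdivrMr// /dn.
have t3 : 0 < t ^+ 3 by rewrite exprn_gt0.
have t44 : 0 < t ^+ 4 by rewrite exprn_gt0.
have t6 : 0 < t ^+ 6 by rewrite exprn_gt0.
have := h0 n; have := h1 n; set y := h n => y1 y0.
(* Of the denominator only the summand [(2 t y) ^ r] is used; one factor [y] is left over and tends
   to zero. *)
have dom (k S P Q V : R) : 0 <= k -> k <= S -> 0 <= P -> 0 <= Q -> V <= k * y * P ->
    V <= S * y * (P + Q).
  move=> k0 kS P0 Q0 hV; apply: le_trans hV _; apply: ler_pM => //.
  - by rewrite mulr_ge0// ltW.
  - by rewrite ler_wpM2r// ltW.
  - by rewrite lerDl.
have y2 : 0 <= y ^+ 2 by rewrite exprn_ge0// ltW.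
have Q0 : 0 <= 16 * t ^+ 4 * y ^+ 2 by rewrite mulr_ge0// ltW.
have t2 : 0 <= t ^+ 2 by rewrite sqr_ge0.
have t8 : 0 <= t ^+ 8 by rewrite exprn_ge0// ltW.
have y3 : 0 <= y ^+ 3 by rewrite exprn_ge0// ltW.
have y43 : y ^+ 4 <= y ^+ 3 by rewrite exprS ler_piMl.
case: r12 l1 l2 => ->; case: l => [|[|[|[|[|l]]]]] // _ _.
- rewrite !sys1_1_1 [X in `|X| <= _](_ : _ = - (4 * t ^+ 2 * y ^+ 2)); last by field.
  rewrite normrN ger0_norm; last by apply: mulr_ge0 => //; apply: mulr_ge0.
  apply: (dom (4 * t)) => //; [lra|lra|by rewrite !mulr_ge0// ltW|].
  rewrite expr1 (_ : 4 * t * y * (2 * t * y) = 8 * (t ^+ 2 * y ^+ 2)); last by ring.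
  have : 0 <= t ^+ 2 * y ^+ 2 by rewrite mulr_ge0.
  lra.
- rewrite !sys1_1_2 [X in `|X| <= _](_ : _ = - (8 * t ^+ 4 * y ^+ 2)); last by field.
  rewrite normrN ger0_norm; last by rewrite !mulr_ge0// ltW.
  apply: (dom (8 * t ^+ 3)) => //; [lra|lra|by rewrite !mulr_ge0// ltW|].
  rewrite expr1 (_ : 8 * t ^+ 3 * y * (2 * t * y) = 16 * (t ^+ 4 * y ^+ 2)); last by ring.
  have : 0 <= t ^+ 4 * y ^+ 2 by rewrite mulr_ge0// ltW.
  lra.
- rewrite !sys1_2_1 [X in `|X| <= _](_ : _ = 0); last by field.
  by rewrite normr0; apply: (dom 0); rewrite ?mul0r ?mulr_ge0//; lra.
- rewrite !sys1_2_2 [X in `|X| <= _](_ : _ = 0); last by field.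
  by rewrite normr0; apply: (dom 0); rewrite ?mul0r ?mulr_ge0//; lra.
- rewrite !sys1_2_3 [X in `|X| <= _](_ : _ = 32 * t ^+ 6 * y ^+ 4); last by field.
  rewrite ger0_norm; last by rewrite !mulr_ge0// ?exprn_ge0// ltW.
  apply: (dom (8 * t ^+ 4)) => //; [lra|lra|by rewrite sqr_ge0|].
  rewrite (_ : 8 * t ^+ 4 * y * (2 * t * y) ^+ 2 = 32 * t ^+ 6 * y ^+ 3); last by ring.
  by rewrite ler_wpM2l// mulr_ge0// ltW.
- rewrite !sys1_2_4 [X in `|X| <= _](_ : _ = 32 * t ^+ 8 * y ^+ 4); last by field.
  rewrite ger0_norm; last by rewrite !mulr_ge0// ?exprn_ge0// ltW.
  apply: (dom (8 * t ^+ 6)) => //; [lra|lra|by rewrite sqr_ge0|].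
  rewrite (_ : 8 * t ^+ 6 * y * (2 * t * y) ^+ 2 = 32 * t ^+ 8 * y ^+ 3); last by ring.
  by rewrite ler_wpM2l// mulr_ge0.
Qed.

(** The bound 3 rests on having at least two atoms around one, i.e. on [k > k0]. It gives
    [uphalf r >= 2], so that squares dominate every power occurring in the transport cost. *)
Lemma rtilde_spec (t : R) (s : nat) : 0 < t -> (exists r, rtilde_pred t s.+2 r) ->
  (3 <= rtilde t s.+2)%N /\ ~ sys_solvable t s.+2 (rtilde t s.+2).
Proof.
move=> t0 ex; rewrite /rtilde; case: pselect => // H.
case: ex_minnP => r /asboolP[r0 nsol] _; split=> //.
case: r r0 nsol => [|[|[|r]]] // _ nsol; exfalso; apply: nsol.
  by apply: sys_solvable_low => //; left.
by apply: sys_solvable_low => //; right.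
Qed.

End SolvableLowOrder.

(** * Local lower bound for the transport error *)

Section LocalRate.
Variables (R : realType) (Xs : set R) (fbar : R -> R).
Hypotheses (Xs_compact : compact Xs) (fbar_ge0 : forall x, 0 <= fbar x).
Hypothesis fbar_out : forall x, ~ Xs x -> fbar x = 0.
Hypothesis fbar_meas : measurable_fun setT fbar.
Hypothesis fbar_int : (\int[@lebesgue_measure R]_(x in Xs) (fbar x)%:E = 1)%E.
Local Notation D := (R * R * R)%type.
Variables (k0 : nat) (pi0 : 'I_k0 -> R) (th0 : 'I_k0 -> D).
Hypotheses (th0_inj : injective th0) (th0_quad : forall j, quadrant (th0 j)).

Definition Delta (m : nat) (w : 'I_m -> R) (e : 'I_m -> D) (n : nat) (x : R) : R :=
  \sum_i w i * hexp n%:R x (e i) - \sum_j pi0 j * hexp n%:R x (th0 j).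

Lemma tame_Delta m (w : 'I_m -> R) e n : tame Xs (Delta w e n).
Proof.
apply: tameD; last apply: tameN; apply: tame_sum => i;
  by apply: tameM; [exact: tame_cst|exact: tame_hexp].
Qed.

Definition class_mass m (w : 'I_m -> R) (J : 'I_m -> 'I_k0) j := \sum_(i | J i == j) w i.

Lemma local_dominated (s : nat) (E : 'I_k0 -> D -> R) :
  (forall j, local_model (th0 j) s (E j)) -> (forall j d, 0 <= E j d) ->
  exists2 del : R, 0 < del <= 1 & exists2 K : R, 0 < K & exists L : nat,
  forall m (w : 'I_m -> R) (e : 'I_m -> D) (J : 'I_m -> 'I_k0),
    (forall i, 0 <= w i) -> \sum_i w i = 1 -> (forall i, quadrant (e i)) ->
    (forall i, small del (e i - th0 (J i))) ->
    (forall j, (#|[pred i | J i == j]| <= s)%N) ->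
    \sum_j `|class_mass w J j - pi0 j| + \sum_i w i * E (J i) (e i - th0 (J i)) <=
    K * \sum_(n < L) L1 fbar (Delta w e n).
Proof.
move=> mod E0.
have /choice[A0 /choice[coef Hmod]] := mod.
pose A := (\sum_j A0 j).+2.
have AA j : (A0 j <= A)%N by rewrite /A (bigD1 j)//= -addn2 -addnA leq_addr.
have [B B1 hB] := support_bounded Xs_compact.
have B0 : 0 <= B := le_trans ler01 B1.
have [K1 K10 [L hL]] := coef_dominated Xs_compact fbar_ge0 fbar_out fbar_meas fbar_int
  A th0_inj th0_quad.
have /choice[KR hKR] : forall nj : nat * 'I_k0, exists K : R, 0 <= K /\
    forall del d x, del <= 1 -> small del d -> quadrant (th0 nj.2 + d) -> `|x| <= B ->
    `|hexp nj.1%:R x (th0 nj.2 + d) - hexp nj.1%:R x (th0 nj.2) *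
      (\sum_(l < A) \sum_(m < A) coef nj.2 d l m * nj.1%:R ^+ l * x ^+ m)| <= K * (del * E nj.2 d).
  move=> [n j]; have [_ /(_ A B n%:R (AA j) B0)[K K00 hK] _] := Hmod j.
  by exists K.
have /choice[Ka hKa] : forall j, exists Kd : R * R, [/\ 0 <= Kd.1, 0 < Kd.2 &
    forall del (xs : seq (R * D)), 0 <= del <= Kd.2 -> (size xs <= s)%N ->
          {in xs, forall x, [&& 0 <= x.1, small del x.2 & quadrant (th0 j + x.2)]} ->
          \sum_(x <- xs) x.1 <= 1 ->
          \sum_(x <- xs) x.1 * E j x.2 <=
            Kd.1 * (\sum_(l < A) \sum_(m < A | (0 < l + m)%N)
                   `|\sum_(x <- xs) x.1 * coef j x.2 l m| + del * \sum_(x <- xs) x.1 * E j x.2)].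
  move=> j; have [_ _ [K K00 [d d0 h]]] := Hmod j.
  by exists (K, d); split => // del xs; exact: h.
pose Kmax := \sum_j (Ka j).1.
have Kmax0 : 0 <= Kmax by apply: sumr_ge0 => j _; have [] := hKa j.
have Kmaxj j : (Ka j).1 <= Kmax.
  by rewrite /Kmax (bigD1 j)//= lerDl sumr_ge0// => i _; have [] := hKa i.
pose KRs n := \sum_j KR (n, j).
have KRs0 n : 0 <= KRs n by apply: sumr_ge0 => j _; have [] := hKR (n, j).
have KRsj n j : KR (n, j) <= KRs n.
  by rewrite /KRs (bigD1 j)//= lerDl sumr_ge0// => i _; have [] := hKR (n, i).
pose KT := \sum_(n < L) KRs n.
have KT0 : 0 <= KT by apply: sumr_ge0.
(* [C] is the total factor of [del * S] collected by the end; [del] is then taken with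
   [del * C <= 1 / 2]. *)
pose C := (1 + Kmax) * K1 * KT + Kmax.
have C0 : 0 <= C by rewrite addr_ge0// !mulr_ge0// ?addr_ge0// ltW.
pose dmin := \big[Num.min/1]_j (Ka j).2.
have dmin0 : 0 < dmin by apply: lt_bigmin => // j _; have [] := hKa j.
have dminj j : dmin <= (Ka j).2 by apply: bigmin_le_cond.
have dmin1 : dmin <= 1 by apply: bigmin_le_id.
pose del := Num.min dmin (2 * (C + 1))^-1.
have C10 : 0 < 2 * (C + 1) by rewrite mulr_gt0// ltr_wpDl.
have del0 : 0 < del by rewrite lt_min dmin0 invr_gt0.
have deld : del <= dmin by rewrite ge_min lexx.
have delC : del * C <= 2^-1.
  apply: le_trans (_ : (2 * (C + 1))^-1 * C <= _).
    by rewrite ler_wpM2r// ge_min lexx orbT.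
  rewrite mulrC ler_pdivrMr//; lra.
have del1 : del <= 1 := le_trans deld dmin1.
exists del; first by rewrite del0.
exists (2 * ((1 + Kmax) * K1)).
  by rewrite !mulr_gt0// ltr_wpDr.
exists L => m w e J w0 w1 eq ed Js.
(* The atoms assigned to [th0 j], in the list form that the local models take. *)
pose xs j := [seq (w i, e i - th0 j) | i <- enum 'I_m & J i == j].
have sum_xs j (f : R * D -> R) : \sum_(x <- xs j) f x = \sum_(i | J i == j) f (w i, e i - th0 j).
  by rewrite /xs big_map big_filter big_enum_cond.
pose Sj j := \sum_(x <- xs j) x.1 * E j x.2.
pose S := \sum_i w i * E (J i) (e i - th0 (J i)).
have Sj0 j : 0 <= Sj j by rewrite /Sj sum_xs; apply: sumr_ge0 => i _; rewrite mulr_ge0/=.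
have SE : S = \sum_j Sj j.
  rewrite /S (partition_big J xpredT)//=; apply: eq_bigr => j _.
  by rewrite /Sj sum_xs; apply: eq_bigr => i /eqP ->.
have S0 : 0 <= S by rewrite SE sumr_ge0.
pose cs j l mm := \sum_(x <- xs j) x.1 * coef j x.2 l mm.
pose Qj j := \sum_(l < A) \sum_(mm < A | (0 < l + mm)%N) `|cs j l mm|.
have algj j : Sj j <= Kmax * (Qj j + del * Sj j).
  have [Ka0 _ /(_ del (xs j))h] := hKa j.
  apply: le_trans (_ : (Ka j).1 * (Qj j + del * Sj j) <= _).
    apply: h.
    - by rewrite (ltW del0) (le_trans deld).
    - rewrite /xs size_map -[X in (X <= _)%N]/(size _) (leq_trans _ (Js j))//.
      by rewrite cardE /enum_mem -filter_predI; apply: eq_leq; congr size; apply: eq_filter => i; rewrite !inE andbT.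
    - move=> x /mapP[i]; rewrite mem_filter => /andP[/eqP Jij _] ->/=.
      by rewrite w0 -Jij ed addrC subrK eq.
    - rewrite sum_xs/= -w1 [leRHS](bigID (fun i => J i == j))/= lerDl.
      by rewrite sumr_ge0.
  rewrite ler_wpM2r// addr_ge0 ?mulr_ge0 ?(ltW del0)//.
  by apply: sumr_ge0 => l _; apply: sumr_ge0.
(* Coefficients of the expanded difference of the two mixtures: G_0 contributes only at order
   zero. *)
pose u (p : 'I_k0 * 'I_A * 'I_A) := cs p.1.1 p.1.2 p.2 -
   (if (p.1.2 + p.2)%N == 0%N then pi0 p.1.1 else 0).
have uE : \sum_p `|u p| = \sum_j (`|class_mass w J j - pi0 j| + Qj j).
  transitivity (\sum_j \sum_l \sum_mm `|u (j, l, mm)|).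
    rewrite (pair_bigA _ (fun i l => \sum_mm `|u (i, l, mm)|))/=.
    rewrite (pair_bigA _ (fun p mm => `|u (p.1, p.2, mm)|))/=.
    by apply: eq_bigr => -[[? ?] ?].
  apply: eq_bigr => j _; rewrite /Qj.
  have z0 : \sum_(l < A) \sum_(mm < A | ~~ (0 < l + mm)%N) `|u (j, l, mm)| =
      `|class_mass w J j - pi0 j|.
    rewrite big_ord_recl/= [X in _ + X]big1 ?addr0; last by move=> l _; apply: big_pred0.
    rewrite big_mkcond big_ord_recl/= [X in _ + X]big1 ?addr0//.
    rewrite /u/= /cs sum_xs /class_mass; congr `|_ - _|; apply: eq_bigr => i _ /=.
    by have [-> _ _] := Hmod j; rewrite mulr1.
  rewrite -z0 addrC -big_split/=; apply: eq_bigr => l _.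
  rewrite [LHS](bigID (fun mm : 'I_A => (0 < l + mm)%N))/=; congr (_ + _).
  apply: eq_bigr => mm lm; rewrite /u/= ifF ?subr0//.
  by apply/negbTE; rewrite -lt0n.
have hu : \sum_p `|u p| <= K1 * (\sum_(n < L) L1 fbar (Delta w e n) + KT * (del * S)).
  apply: le_trans (hL u) _; rewrite ler_pM2l// /KT mulr_suml -big_split/=.
  apply: ler_sum => n _.
  have cst0 : 0 <= KRs n * (del * S) by rewrite !mulr_ge0// ltW.
  apply: le_trans (_ : L1 fbar (Delta w e n) + L1 fbar (fun=> KRs n * (del * S)) <= _); last first.
    rewrite lerD2l; apply: (L1_le fbar_ge0 fbar_out fbar_meas fbar_int) => //.
    by move=> x _; rewrite ger0_norm.
  apply: (L1_triangle fbar_ge0 fbar_out fbar_meas fbar_int).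
  - exact: tame_comb.
  - exact: tame_Delta.
  - exact: tame_cst.
  move=> x Xx; rewrite -[X in `|X| <= _](subrK (Delta w e n x)) addrC.
  rewrite (le_trans (ler_normD _ _))// lerD2l [leRHS]ger0_norm//.
  (* What separates the expanded combination from [Delta] is the weighted sum of the expansion
     remainders, of size [del * S]. *)
  have -> : \sum_p u p * basis th0 n p x - Delta w e n x = - \sum_i w i *
      (hexp n%:R x (th0 (J i) + (e i - th0 (J i))) - hexp n%:R x (th0 (J i)) *
      (\sum_(l < A) \sum_(mm < A) coef (J i) (e i - th0 (J i)) l mm * n%:R ^+ l * x ^+ mm)).
    rewrite [X in _ = - X](_ : _ = \sum_i w i * hexp n%:R x (e i) - \sum_i w i *
        (hexp n%:R x (th0 (J i)) * (\sum_(l < A) \sum_(mm < A)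
          coef (J i) (e i - th0 (J i)) l mm * n%:R ^+ l * x ^+ mm))); last first.
      by rewrite -sumrB; apply: eq_bigr => i _; rewrite -mulrBr [th0 _ + _]addrC subrK.
    set B2 := \sum_i w i * (_ * _).
    suff -> : \sum_p u p * basis th0 n p x = B2 - \sum_j pi0 j * hexp n%:R x (th0 j).
      by rewrite /Delta; ring.
    transitivity (\sum_j \sum_(l < A) \sum_(mm < A) u (j, l, mm) * basis th0 n (j, l, mm) x).
      rewrite (pair_bigA _ (fun i l => \sum_mm u (i, l, mm) * basis th0 n (i, l, mm) x))/=.
      rewrite (pair_bigA _ (fun p mm => u (p.1, p.2, mm) * basis th0 n (p.1, p.2, mm) x))/=.
      by apply: eq_bigr => -[[? ?] ?].
    rewrite /B2 [X in _ = X - _](partition_big J xpredT)//= -sumrB.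
    apply: eq_bigr => j _.
    set h := hexp n%:R x (th0 j).
    have P1 : \sum_(l < A) \sum_(mm < A) cs j l mm * (n%:R ^+ l * x ^+ mm * h) =
      \sum_(i < m | J i == j) w i * (hexp n%:R x (th0 (J i)) * \sum_(l < A)
         \sum_(mm < A) coef (J i) (e i - th0 (J i)) l mm * n%:R ^+ l * x ^+ mm).
      rewrite (eq_bigr (fun i => \sum_(l < A) \sum_(mm < A)
        w i * coef j (e i - th0 j) l mm * (n%:R ^+ l * x ^+ mm * h))); last first.
        move=> i /eqP ->; rewrite -/h !mulr_sumr; apply: eq_bigr => l _.
        by rewrite !mulr_sumr; apply: eq_bigr => mm _; ring.
      rewrite [RHS]exchange_big/=; apply: eq_bigr => l _.
      rewrite [RHS]exchange_big/=; apply: eq_bigr => mm _.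
      by rewrite /cs sum_xs mulr_suml; apply: eq_bigr.
    have P2 : \sum_(l < A) \sum_(mm < A) (if (l + mm)%N == 0%N then pi0 j else 0) *
        (n%:R ^+ l * x ^+ mm * h) = pi0 j * h.
      rewrite big_ord_recl [X in _ + X]big1 ?addr0 => [|l _]; last first.
        by apply: big1 => mm _; rewrite mul0r.
      rewrite big_ord_recl [X in _ + X]big1 ?addr0 => [|mm _]; last by rewrite mul0r.
      by rewrite /= !expr0 !mul1r.
    rewrite -P1 -P2 -sumrB; apply: eq_bigr => l _; rewrite -sumrB; apply: eq_bigr => mm _.
    by rewrite /u /basis /= -/h; ring.
  rewrite normrN (le_trans (ler_norm_sum _ _ _))// /S !mulr_sumr; apply: ler_sum => i _.
  rewrite normrM (ger0_norm (w0 i)).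
  rewrite (_ : _ * (_ * (_ * _)) = w i * (KRs n * (del * E (J i) (e i - th0 (J i))))); last by ring.
  rewrite ler_wpM2l//.
  have [_ h] := hKR (val n, J i).
  apply: le_trans (h del _ x del1 (ed i) _ (hB x Xx)) _; first by rewrite addrC subrK.
  by rewrite ler_wpM2r// mulr_ge0// ltW.
set LL := \sum_(n < L) _ in hu *.
set M := \sum_j `|_|.
have M0 : 0 <= M by exact: sumr_ge0.
have Q0 : 0 <= \sum_j Qj j by apply: sumr_ge0 => j _; apply: sumr_ge0 => l _; apply: sumr_ge0.
rewrite -/S; move: uE; rewrite big_split/= -/M => uE; rewrite uE in hu.
have hS : S <= Kmax * (\sum_j Qj j + del * S).
  rewrite SE mulr_sumr -big_split/= mulr_sumr.
  by apply: ler_sum => j _; exact: algj.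
have h3 : Kmax * \sum_j Qj j <= Kmax * (K1 * (LL + KT * (del * S))).
  rewrite ler_wpM2l//; apply: le_trans hu; by rewrite lerDr.
have h4 : del * C * S <= 2^-1 * S by rewrite ler_wpM2r.
have : M + S <= (1 + Kmax) * (K1 * (LL + KT * (del * S))) + Kmax * (del * S).
  have -> : (1 + Kmax) * (K1 * (LL + KT * (del * S))) + Kmax * (del * S) =
    K1 * (LL + KT * (del * S)) + (Kmax * (K1 * (LL + KT * (del * S))) + Kmax * (del * S)) by ring.
  apply: lerD; first by apply: le_trans hu; rewrite lerDl.
  by apply: le_trans hS _; rewrite mulrDr lerD2r.
have -> : (1 + Kmax) * (K1 * (LL + KT * (del * S))) + Kmax * (del * S) =
  (1 + Kmax) * K1 * LL + del * C * S by rewrite /C; ring.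
move=> h5; rewrite -[leRHS]mulrA.
have {}h5 : M + S <= (1 + Kmax) * K1 * LL + 2^-1 * S by apply: le_trans h5 _; rewrite lerD2l.
lra.
Qed.

End LocalRate.

(** * Gaussian mixtures and their affinity *)

Section GaussianMixtures.
Variable R : realType.
Local Notation leb := (@lebesgue_measure R).
Local Notation wt G := (@mwt R G).
Local Notation atom G := (@matom R G).
Implicit Types (G : mixmeas R).

Lemma gauss_normal_pdf (y m s : R) : 0 < s -> gauss y m s = normal_pdf m s y.
Proof.
move=> s0; rewrite normal_pdfE ?gt_eqF// /gauss /normal_peak /normal_fun.
have -> : s ^+ 2 * pi *+ 2 = s ^+ 2 * (2 * pi) by rewrite -mulr_natl; ring.
rewrite [in RHS]sqrtrM ?sqr_ge0// sqrtr_sqr gtr0_norm//.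
by rewrite [2 * s ^+ 2]mulr_natl.
Qed.

Lemma gauss_gt0 (y m s : R) : 0 < s -> 0 < gauss y m s.
Proof.
move=> s0; rewrite mulr_gt0 ?expR_gt0// invr_gt0 mulr_gt0// sqrtr_gt0.
by rewrite mulr_gt0// pi_gt0.
Qed.

(** Completing the square: an exponential tilt moves the mean by [l * s ^ 2] and leaves the
    variance. *)
Lemma gauss_tilt (l y m s : R) : 0 < s ->
  expR (l * y) * gauss y m s = expR (l * m + l ^+ 2 * (s ^+ 2 / 2)) * gauss y (m + l * s ^+ 2) s.
Proof.
move=> s0; rewrite /gauss mulrCA [RHS]mulrCA; congr (_ * _); rewrite -!expRD.
by congr expR; field; rewrite gt_eqF.
Qed.

Lemma integral_gauss_mgf (l m s : R) : 0 < s ->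
  (\int[leb]_y (expR (l * y) * gauss y m s)%:E =
   (expR (l * m + l ^+ 2 * (s ^+ 2 / 2)))%:E)%E.
Proof.
move=> s0.
under eq_integral => y _ do rewrite (gauss_tilt l y m s0) (gauss_normal_pdf _ _ s0) EFinM.
rewrite ge0_integralZl//; last 2 first.
- by apply/measurable_EFinP; exact: measurable_normal_pdf.
- by move=> y _; rewrite lee_fin normal_pdf_ge0.
by rewrite integral_normal_pdf ?gt_eqF// mule1.
Qed.

(** The conditions common to G and G_0 under which the mixture is a positive density with all
    exponential moments; the weight bound stays outside. *)
Definition proper G : Prop :=
  [/\ forall i, 0 <= wt G i, \sum_i wt G i = 1 & forall i, 0 < (atom G i).2].

Lemma gmix_gt0 G x y : proper G -> 0 < gmix G x y.
Proof.
move=> [w0 w1 v0]; rewrite /gmix lt_neqAle sumr_ge0 ?andbT => [|i _]; last first.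
  by rewrite mulr_ge0// ltW// gauss_gt0// sqrtr_gt0.
rewrite eq_sym psumr_neq0 => [|i _]; last first.
  by rewrite mulr_ge0// ltW// gauss_gt0// sqrtr_gt0.
apply/hasP; have /hasP[i _ wi] : has (fun i => 0 < wt G i) (index_enum 'I_(mnum G)).
  by rewrite -(@psumr_neq0 _ _ _ xpredT) ?w1 ?oner_eq0.
by exists i; rewrite ?mem_index_enum//= mulr_gt0// gauss_gt0// sqrtr_gt0.
Qed.

Lemma measurable_gmix G : measurable_fun [set: R * R] (fun z : R * R => gmix G z.1 z.2).
Proof.
apply: measurable_sum => i; apply: measurable_funM => //.
rewrite /gauss /h2; apply: measurable_funM => //.
apply: (measurableT_comp (@measurable_expR R)); apply: measurable_funM => //.
apply: (measurableT_comp (@oppr_measurable R setT)); apply: measurable_funX.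
apply: measurable_funB => //.
exact: (measurableT_comp (measurable_h1 (atom G i).1) measurable_fst).
Qed.

Lemma measurable_gmix2 G x : measurable_fun [set: R] (gmix G x).
Proof.
have mp : measurable_fun [set: R] (fun y : R => (x, y)) by exact: pair1_measurable.
exact: (measurableT_comp (measurable_gmix G) mp).
Qed.

Definition MG (l x : R) G := \sum_i wt G i * hexp l x (atom G i).

Lemma integral_gmix_mgf G (l x : R) : proper G ->
  (\int[leb]_y (expR (l * y) * gmix G x y)%:E = (MG l x G)%:E)%E.
Proof.
move=> [w0 w1 v0].
transitivity (\int[leb]_y \sum_i ((wt G i)%:E *
   (expR (l * y) * gauss y (h1 x (atom G i).1) (h2 x (atom G i).2))%:E))%E.
  apply: eq_integral => y _; rewrite /gmix mulr_sumr -sumEFin.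
  by apply: eq_bigr => i _; rewrite -EFinM mulrCA.
have mf i : measurable_fun [set: R] (fun y : R =>
    (expR (l * y) * gauss y (h1 x (atom G i).1) (h2 x (atom G i).2))%:E).
  apply/measurable_EFinP; apply: measurable_funM.
    by apply: measurableT_comp => //; exact: measurable_funM.
  have -> : (fun y => gauss y (h1 x (atom G i).1) (h2 x (atom G i).2)) =
      normal_pdf (h1 x (atom G i).1) (h2 x (atom G i).2).
    by apply/funext => y; rewrite gauss_normal_pdf// sqrtr_gt0.
  exact: measurable_normal_pdf.
have f0 i y : (0 <= (expR (l * y) * gauss y (h1 x (atom G i).1) (h2 x (atom G i).2))%:E)%E.
  by rewrite lee_fin mulr_ge0 ?expR_ge0// ltW// gauss_gt0// sqrtr_gt0.
rewrite ge0_integral_sum//; last 2 first.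
- by move=> i; apply: measurable_funeM; exact: mf.
- by move=> i y _; rewrite mule_ge0// lee_fin.
rewrite -sumEFin; apply: eq_bigr => i _.
rewrite ge0_integralZl//; last 2 first.
- exact: mf.
- by rewrite lee_fin.
rewrite integral_gauss_mgf ?sqrtr_gt0// -EFinM /hexp /h2 sqr_sqrtr//.
by rewrite ltW.
Qed.

Lemma integral_gmix G x : proper G -> (\int[leb]_y (gmix G x y)%:E = 1)%E.
Proof.
move=> pG; transitivity (\int[leb]_y (expR (0 * y) * gmix G x y)%:E)%E.
  by apply: eq_integral => y _; rewrite mul0r expR0 mul1r.
rewrite integral_gmix_mgf// /MG (eq_bigr (fun i => wt G i)) => [|i _].
  by have [_ -> _] := pG.
by rewrite /hexp mul0r expr0n/= mul0r addr0 expR0 mulr1.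
Qed.

End GaussianMixtures.

Lemma measurable_sqrtr (R : realType) d (T : measurableType d) (f : T -> R) :
  measurable_fun setT f -> measurable_fun setT (fun x => Num.sqrt (f x)).
Proof.
by apply: measurableT_comp; apply: continuous_measurable_fun; exact: sqrt_continuous.
Qed.

(** * Hellinger affinity against moment generating functions *)

Section Affinity.
Variables (R : realType) (Xs : set R) (fbar : R -> R).
Hypotheses (Xs_compact : compact Xs) (fbar_ge0 : forall x, 0 <= fbar x).
Hypothesis fbar_out : forall x, ~ Xs x -> fbar x = 0.
Hypothesis fbar_meas : measurable_fun setT fbar.
Hypothesis fbar_int : (\int[@lebesgue_measure R]_(x in Xs) (fbar x)%:E = 1)%E.
Local Notation leb := (@lebesgue_measure R).
Implicit Types (G : mixmeas R).

(** The Hellinger affinity of the conditional laws at [x]. It is the mean under G_0 of the root of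
    the likelihood ratio, which multiplies over a sample, and it controls unbounded test functions
    once their second moments are bounded. *)
Definition affinity_at G G0 (x : R) : \bar R :=
  (\int[leb]_y (Num.sqrt (gmix G x y * gmix G0 x y))%:E)%E.

Definition affinity G G0 : \bar R := (\int[leb]_x ((fbar x)%:E * affinity_at G G0 x))%E.

Lemma measurable_sqrt_gmix G G0 : measurable_fun [set: R * R]
  (fun z : R * R => (Num.sqrt (gmix G z.1 z.2 * gmix G0 z.1 z.2))%:E).
Proof.
apply/measurable_EFinP; apply: measurable_sqrtr.
by apply: measurable_funM; exact: measurable_gmix.
Qed.

Lemma affinity_at_ge0 G G0 x : (0 <= affinity_at G G0 x)%E.
Proof. by apply: integral_ge0 => y _; rewrite lee_fin sqrtr_ge0. Qed.

Lemma measurable_affinity_at G G0 : measurable_fun [set: R] (affinity_at G G0).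
Proof.
apply: (@measurable_fun_fubini_tonelli_F _ _ _ _ R leb
  (fun z : R * R => (Num.sqrt (gmix G z.1 z.2 * gmix G0 z.1 z.2))%:E)).
  exact: measurable_sqrt_gmix.
by move=> z; rewrite lee_fin sqrtr_ge0.
Qed.

Let I (f : R -> R) : \bar R := (\int[leb]_y (f y)%:E)%E.

Let I_D (f g : R -> R) : measurable_fun [set: R] f -> measurable_fun [set: R] g ->
  (forall y, 0 <= f y) -> (forall y, 0 <= g y) -> (I (f \+ g)%R = I f + I g)%E.
Proof.
move=> mf mg f0 g0; rewrite /I -ge0_integralD//.
- by move=> y _; rewrite lee_fin.
- exact/measurable_EFinP.
- by move=> y _; rewrite lee_fin.
- exact/measurable_EFinP.
Qed.

Let I_Z (k : R) (f : R -> R) : measurable_fun [set: R] f ->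
  (forall y, 0 <= f y) -> 0 <= k -> (I (fun y => k * f y)%R = k%:E * I f)%E.
Proof.
move=> mf f0 k0; rewrite /I -ge0_integralZl//.
- exact/measurable_EFinP.
- by move=> y _; rewrite lee_fin.
Qed.

(* AM-GM: with [p = sqrt g] and [q = sqrt g0],
   [e (p - q) (p + q) <= (p - q) ^+ 2 / (2 eps) + eps e ^+ 2 (p + q) ^+ 2 / 2]. *)
Lemma tilt_diff_le (e g g0 eps : R) : 0 < eps -> 0 <= g -> 0 <= g0 ->
  e * g + eps^-1 * Num.sqrt (g * g0) <=
  e * g0 + ((2 * eps)^-1 * g + (2 * eps)^-1 * g0) + (eps * (e ^+ 2 * g) + eps * (e ^+ 2 * g0)).
Proof.
move=> eps0 g_ge0 g0_ge0; rewrite sqrtrM//.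
set p := Num.sqrt g; set q := Num.sqrt g0.
have -> : g = p ^+ 2 by rewrite sqr_sqrtr.
have -> : g0 = q ^+ 2 by rewrite sqr_sqrtr.
rewrite -subr_ge0.
have -> : e * q ^+ 2 + ((2 * eps)^-1 * p ^+ 2 + (2 * eps)^-1 * q ^+ 2) +
   (eps * (e ^+ 2 * p ^+ 2) + eps * (e ^+ 2 * q ^+ 2)) -
   (e * p ^+ 2 + eps^-1 * (p * q)) =
   (2 * eps)^-1 * ((p - q) - eps * e * (p + q)) ^+ 2 + eps / 2 * e ^+ 2 * (p - q) ^+ 2.
  by field; rewrite gt_eqF.
have e2 : 0 <= (2 * eps)^-1 by rewrite invr_ge0; apply: mulr_ge0 => //; exact: ltW.
have e3 : 0 <= eps / 2 by rewrite divr_ge0// ltW.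
by apply: addr_ge0; [|apply: mulr_ge0]; rewrite ?sqr_ge0//; apply: mulr_ge0; rewrite ?sqr_ge0.
Qed.

(** [tilt_diff_le] with [e = expR (l * y)], integrated in [y]; the square of [e] gives the exponent
    [2 * l]. Terms are placed so that no extended real is subtracted. *)
Lemma mgf_diff_le_affinity_at G G0 (l eps x : R) : proper G -> proper G0 -> 0 < eps ->
  ((MG l x G)%:E + eps^-1%:E * affinity_at G G0 x <=
   (MG l x G0 + eps^-1 + eps * (MG (2 * l) x G + MG (2 * l) x G0))%:E)%E.
Proof.
move=> pG pG0 eps0.
have mg G' : measurable_fun [set: R] (gmix G' x) := measurable_gmix2 G' x.
have g_ge0 G' y : proper G' -> 0 <= gmix G' x y by move=> ?; rewrite ltW// gmix_gt0.
have mE (k : R) : measurable_fun [set: R] (fun y : R => expR (k * y)).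
  by apply: measurableT_comp => //; exact: measurable_funM.
have mEg k G' : measurable_fun [set: R] (fun y : R => expR (k * y) * gmix G' x y).
  exact: measurable_funM.
have Eg0 k G' y : proper G' -> 0 <= expR (k * y) * gmix G' x y.
  by move=> pG'; rewrite mulr_ge0 ?expR_ge0// g_ge0.
have ms : measurable_fun [set: R] (fun y => Num.sqrt (gmix G x y * gmix G0 x y)).
  by apply: measurable_sqrtr; exact: measurable_funM.
have ei0 : 0 <= eps^-1 by rewrite invr_ge0 ltW.
have e2i0 : 0 <= (2 * eps)^-1 by rewrite invr_ge0; apply: mulr_ge0 => //; exact: ltW.
have e0 : 0 <= eps := ltW eps0.
have mkg k G' : measurable_fun [set: R] (fun y => k * gmix G' x y).
  exact: (measurable_funM (measurable_cst _) (mg G')).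
have mkEg k k' G' : measurable_fun [set: R] (fun y => k * (expR (k' * y) * gmix G' x y)).
  exact: (measurable_funM (measurable_cst _) (mEg k' G')).
have -> : ((MG l x G)%:E + eps^-1%:E * affinity_at G G0 x =
    I (fun y => (expR (l * y) * gmix G x y) + eps^-1 * Num.sqrt (gmix G x y * gmix G0 x y))%R)%E.
  rewrite (I_D (mEg l G) (measurable_funM (measurable_cst eps^-1) ms)); last 2 first.
  - by move=> y; exact: Eg0.
  - by move=> y; rewrite mulr_ge0// sqrtr_ge0.
  rewrite I_Z//; congr (_ + _)%E; exact/esym/integral_gmix_mgf.
apply: (@le_trans _ _ (I (fun y => expR (l * y) * gmix G0 x y +
   ((2 * eps)^-1 * gmix G x y + (2 * eps)^-1 * gmix G0 x y) +
   (eps * (expR (2 * l * y) * gmix G x y) + eps * (expR (2 * l * y) * gmix G0 x y))))).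
  apply: ge0_le_integral => //.
  - move=> y _; rewrite lee_fin addr_ge0 ?Eg0// mulr_ge0// sqrtr_ge0.
  - apply/measurable_EFinP; apply: measurable_funD; first exact: mEg.
    exact: (measurable_funM (measurable_cst _) ms).
  - apply/measurable_EFinP; apply: measurable_funD; first apply: measurable_funD.
    + exact: mEg.
    + by apply: measurable_funD; exact: mkg.
    + by apply: measurable_funD; exact: mkEg.
  - move=> y _; rewrite lee_fin.
    have -> : expR (2 * l * y) = expR (l * y) ^+ 2.
      by rewrite expr2 -expRD; congr expR; ring.
    by apply: tilt_diff_le; rewrite ?g_ge0.
have kg0 k G' y : 0 <= k -> proper G' -> 0 <= k * gmix G' x y.
  by move=> k0 pG'; rewrite mulr_ge0// g_ge0.
have kEg0 k k' G' y : 0 <= k -> proper G' -> 0 <= k * (expR (k' * y) * gmix G' x y).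
  by move=> k0 pG'; rewrite mulr_ge0// Eg0.
rewrite (@I_D (fun y => expR (l * y) * gmix G0 x y +
   ((2 * eps)^-1 * gmix G x y + (2 * eps)^-1 * gmix G0 x y))
   (fun y => eps * (expR (2 * l * y) * gmix G x y) + eps * (expR (2 * l * y) * gmix G0 x y)));
  last 4 first.
- by apply: measurable_funD; [exact: mEg|apply: measurable_funD; exact: mkg].
- by apply: measurable_funD; exact: mkEg.
- by move=> y; rewrite !addr_ge0// ?Eg0// kg0.
- by move=> y; rewrite !addr_ge0// kEg0.
rewrite (@I_D (fun y => expR (l * y) * gmix G0 x y)
   (fun y => (2 * eps)^-1 * gmix G x y + (2 * eps)^-1 * gmix G0 x y)); last 4 first.
- exact: mEg.
- by apply: measurable_funD; exact: mkg.
- by move=> y; exact: Eg0.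
- by move=> y; rewrite !addr_ge0// kg0.
rewrite (@I_D (fun y => (2 * eps)^-1 * gmix G x y) (fun y => (2 * eps)^-1 * gmix G0 x y))//;
  last 2 first.
- by move=> y; exact: kg0.
- by move=> y; exact: kg0.
rewrite (@I_D (fun y => eps * (expR (2 * l * y) * gmix G x y))
  (fun y => eps * (expR (2 * l * y) * gmix G0 x y)))//; last 2 first.
- by move=> y; exact: kEg0.
- by move=> y; exact: kEg0.
rewrite (@I_Z _ (gmix G x))// ?(@I_Z _ (gmix G0 x))//; last 2 first.
- by move=> y; exact: g_ge0.
- by move=> y; exact: g_ge0.
rewrite (@I_Z _ (fun y => expR (2 * l * y) * gmix G x y))//; last by move=> y; exact: Eg0.
rewrite (@I_Z _ (fun y => expR (2 * l * y) * gmix G0 x y))//; last by move=> y; exact: Eg0.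
rewrite /I !integral_gmix// !integral_gmix_mgf// !mule1 -!EFinM -!EFinD lee_fin.
rewrite le_eqVlt; apply/orP; left; apply/eqP; field; rewrite gt_eqF//.
Qed.

(** The pointwise bound, used for [(G, G0)] and for [(G0, G)] since the affinity is symmetric,
    yields the absolute value. The affinity deficit [eps ^ 2] divided by [eps] gives the term [eps],
    the second moments give [2 * eps * H]. *)
Lemma affinity_mgf G G0 (l eps H : R) : proper G -> proper G0 -> 0 < eps -> 0 <= H ->
  (forall x, Xs x -> MG (2 * l) x G <= H) -> (forall x, Xs x -> MG (2 * l) x G0 <= H) ->
  ((1 - eps ^+ 2)%:E <= affinity G G0)%E ->
  L1 fbar (fun x => MG l x G - MG l x G0) <= eps * (1 + 2 * H).
Proof.
move=> pG pG0 eps0 H0 HG HG0 aff.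
have affsym x : affinity_at G0 G x = affinity_at G G0 x.
  by rewrite /affinity_at; apply: eq_integral => y _; rewrite mulrC.
have tM G' : tame Xs (fun x => MG l x G').
  by apply: tame_sum => i; apply: tameM; [exact: tame_cst|exact: tame_hexp].
have tD : tame Xs (fun x => MG l x G - MG l x G0) by apply: tameD => //; exact: tameN.
have ei0 : 0 <= eps^-1 by rewrite invr_ge0 ltW.
have pt x : Xs x -> (`|MG l x G - MG l x G0|%:E + eps^-1%:E * affinity_at G G0 x <=
    (eps^-1 + 2 * eps * H)%:E)%E.
  move=> Xx.
  have h1 := mgf_diff_le_affinity_at l x pG pG0 eps0.
  have h2 := mgf_diff_le_affinity_at l x pG0 pG eps0.
  rewrite affsym in h2.
  (* Finiteness is read off the bound itself, whose right side is real; afterwards the argument is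
     linear arithmetic. *)
  have afin : affinity_at G G0 x \is a fin_num.
    rewrite ge0_fin_numE ?affinity_at_ge0//.
    have : (eps^-1%:E * affinity_at G G0 x < +oo)%E.
      rewrite -(@lteD2lE _ (MG l x G)%:E)//; exact: le_lt_trans h1 (ltry _).
    by case: (affinity_at G G0 x) => [r _| |_] //; rewrite ?ltry ?ltNyr// gt0_muley ?lte_fin ?invr_gt0.
  move: h1 h2; rewrite -(fineK afin) -!EFinM -!EFinD !lee_fin => h1 h2.
  have := HG x Xx; have := HG0 x Xx => H1 H2.
  have h3 : eps * (MG (2 * l) x G + MG (2 * l) x G0) <= 2 * eps * H.
    rewrite (_ : 2 * eps * H = eps * (H + H)); last by ring.
    by rewrite ler_pM2l// lerD.
  rewrite [X in eps * X]addrC in h2.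
  have [d0|d0] := leP 0 (MG l x G - MG l x G0).
    by rewrite ger0_norm//; lra.
  by rewrite ltr0_norm//; lra.
have ineq : (\int[leb]_x ((fbar x * `|MG l x G - MG l x G0|)%:E +
     eps^-1%:E * ((fbar x)%:E * affinity_at G G0 x)) <=
     \int[leb]_x ((eps^-1 + 2 * eps * H)%:E * (fbar x)%:E))%E.
  apply: ge0_le_integral => //.
  - move=> x _; rewrite adde_ge0// ?lee_fin ?mulr_ge0// mule_ge0 ?lee_fin//.
    by rewrite mule_ge0 ?lee_fin// affinity_at_ge0.
  - apply: emeasurable_funD; first exact: measurable_wabs tD.1.
    apply: measurable_funeM; apply: emeasurable_funM; first exact/measurable_EFinP.
    exact: measurable_affinity_at.
  - by apply: measurable_funeM; exact/measurable_EFinP.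
  - move=> x _; have [Xx|/fbar_out->] := pselect (Xs x); last first.
      by rewrite mul0r mul0e !mule0 adde0.
    rewrite muleCA EFinM -ge0_muleDr ?lee_fin ?mule_ge0 ?lee_fin ?affinity_at_ge0//.
    by rewrite [leRHS]muleC lee_wpmul2l ?lee_fin// pt.
have maff : measurable_fun [set: R] (fun x => (fbar x)%:E * affinity_at G G0 x)%E.
  apply: emeasurable_funM; first exact/measurable_EFinP.
  exact: measurable_affinity_at.
have aff0 x : (0 <= (fbar x)%:E * affinity_at G G0 x)%E.
  by rewrite mule_ge0 ?lee_fin// affinity_at_ge0.
move: ineq; rewrite ge0_integralD//; last 4 first.
- by move=> x _; rewrite lee_fin mulr_ge0.
- exact: measurable_wabs tD.1.
- by move=> x _; rewrite mule_ge0.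
- exact: measurable_funeM.
rewrite ge0_integralZl// ?lee_fin// [in leRHS]ge0_integralZl//; last 3 first.
- exact/measurable_EFinP.
- by move=> x _; rewrite lee_fin.
- by rewrite lee_fin addr_ge0// !mulr_ge0// ltW.
rewrite (density_integralT fbar_out fbar_int) mule1 -(L1E fbar_ge0 fbar_out fbar_meas fbar_int tD).
rewrite -/(affinity G G0) => ineq.
have : ((L1 fbar (fun x => MG l x G - MG l x G0))%:E + eps^-1%:E * (1 - eps ^+ 2)%:E <=
   (eps^-1 + 2 * eps * H)%:E)%E.
  by apply: le_trans ineq; rewrite leeD2l// lee_wpmul2l.
rewrite -EFinM -EFinD lee_fin.
have -> : eps^-1 * (1 - eps ^+ 2) = eps^-1 - eps by field; rewrite gt_eqF.
lra.
Qed.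

End Affinity.

(** * Expectation of a product over an i.i.d. sample *)

Section WeightedPushforward.
Local Open Scope ereal_scope.
Context d d' (T : measurableType d) (T' : measurableType d') (R : realType).
Variables (m : {measure set T -> \bar R}) (W : T -> R) (phi : T -> T').
Hypotheses (mW : measurable_fun setT W) (W0 : forall t, (0 <= W t)%R).
Hypothesis mphi : measurable_fun setT phi.

(** The image under [phi] of the measure with density [W]. As a measure on the target it can be
    identified from its values on rectangles. *)
Definition wpush (C : set T') : \bar R := \int[m]_(t in phi @^-1` C) (W t)%:E.

Lemma measurable_preimage_phi C : measurable C -> measurable (phi @^-1` C).
Proof. by move=> mC; rewrite -[X in measurable X]setTI; exact: mphi. Qed.

Lemma wpush0 : wpush set0 = 0.
Proof. by rewrite /wpush preimage_set0 integral_set0. Qed.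

Lemma wpush_ge0 C : 0 <= wpush C.
Proof. by apply: integral_ge0 => t _; rewrite lee_fin. Qed.

Lemma wpush_sigma_additive : semi_sigma_additive wpush.
Proof.
move=> F mF tF mUF.
rewrite /wpush preimage_bigcup ge0_integral_bigcup//; last 4 first.
- by move=> k; exact: measurable_preimage_phi.
- by apply: measurable_funTS; exact/measurable_EFinP.
- by move=> t _; rewrite lee_fin.
- move=> i j _ _ [t [/= Fi Fj]]; apply: tF => //.
  by exists (phi t).
by apply: is_cvg_ereal_nneg_natsum_cond => n _ _; exact: wpush_ge0.
Qed.

Definition wpush_measure : {measure set T' -> \bar R} :=
  HB.pack wpush (isMeasure.Build _ _ _ wpush wpush0 wpush_ge0 wpush_sigma_additive).

Import HBNNSimple.

(** Monotone approximation by simple functions reduces the change of variables to indicators, where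
    it is the definition of [wpush]. *)
Lemma integral_wpush (F : T' -> \bar R) : measurable_fun setT F -> (forall z, 0 <= F z) ->
  \int[wpush_measure]_z F z = \int[m]_t ((W t)%:E * F (phi t)).
Proof.
move=> mF F0.
pose f_ := nnsfun_approx measurableT mF.
have mWE : measurable_fun setT (fun t => (W t)%:E) by exact/measurable_EFinP.
have mfphi n : measurable_fun setT (fun t => (f_ n (phi t))%:E).
  by apply/measurable_EFinP; exact: measurableT_comp.
have cvgF z : (f_ n z)%:E @[n --> \oo] --> F z by apply: cvg_nnsfun_approx.
transitivity (limn (fun n => \int[wpush_measure]_z (f_ n z)%:E)).
  rewrite -monotone_convergence//.
  - by apply: eq_integral => z _; apply/esym/cvg_lim.
  - by move=> n; exact/measurable_EFinP/measurable_funP.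
  - by move=> n z _; rewrite lee_fin.
  - by move=> z _ a b ab; rewrite lee_fin; exact/lefP/nd_nnsfun_approx.
transitivity (limn (fun n => \int[m]_t ((W t)%:E * (f_ n (phi t))%:E))); last first.
  rewrite -monotone_convergence//.
  - apply: eq_integral => t _; apply/cvg_lim => //.
    by apply: cvgeZl => //; exact: cvgF.
  - by move=> n; exact: emeasurable_funM.
  - by move=> n t _; rewrite mule_ge0// lee_fin.
  - move=> t _ a b ab; rewrite lee_wpmul2l ?lee_fin//; exact/lefP/nd_nnsfun_approx.
apply: congr_lim; apply/funext => n.
rewrite integralT_nnsfun sintegralE.
have mI k : measurable_fun setT (fun t => \1_(f_ n @^-1` [set k]) (phi t) : R).
  have mA : measurable (f_ n @^-1` [set k]).
    by rewrite -[X in measurable X]setTI; exact: measurable_funP.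
  exact: (measurableT_comp (measurable_indic mA) mphi).
have mind k : measurable_fun setT (fun t => (k * \1_(f_ n @^-1` [set k]) (phi t))%:E).
  by apply/measurable_EFinP; exact: measurable_funM.
transitivity (\int[m]_t (\sum_(k \in range (f_ n))
    ((W t)%:E * (k * \1_(f_ n @^-1` [set k]) (phi t))%:E))).
  rewrite ge0_integral_fsum//; last 2 first.
  - by move=> k; apply: emeasurable_funM.
  - by move=> k t _; rewrite mule_ge0 ?lee_fin// -lee_fin nnfun_muleindic_ge0.
  apply: eq_fsbigr => k _.
  have [k0|k0] := ltP k 0%R.
    rewrite preimage_nnfun0// [X in _ * X]wpush0 mule0 integral0_eq// => t _.
    by rewrite indic0 mulr0 mule0.
  transitivity (k%:E * \int[m]_t ((W t)%:E * (\1_(f_ n @^-1` [set k]) (phi t))%:E)).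
    congr (_ * _); rewrite -[LHS]/(wpush (f_ n @^-1` [set k])) /wpush integral_mkcond epatch_indic.
    by apply: eq_integral => t _.
  rewrite -ge0_integralZl//; last 2 first.
  - by apply: emeasurable_funM => //; exact/measurable_EFinP.
  - by move=> t _; rewrite mule_ge0 ?lee_fin.
  by apply: eq_integral => t _; rewrite EFinM muleCA.
apply: eq_integral => t _.
rewrite [in RHS]fimfunE -fsumEFin// ge0_mule_fsumr// => k.
exact: nnfun_muleindic_ge0.
Qed.

End WeightedPushforward.

Section ProductExpectation.
Variables (R : realType) (fbar : R -> R) (g0 : R -> R -> R).
Hypothesis fbar_ge0 : forall x, 0 <= fbar x.
Hypothesis fbar_meas : measurable_fun [set: R] fbar.
Hypothesis g0_ge0 : forall x y, 0 <= g0 x y.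
Hypothesis g0_meas : measurable_fun [set: R * R] (fun z : R * R => g0 z.1 z.2).
Local Notation leb := (@lebesgue_measure R).

Definition rect_law (A B : set R) : \bar R :=
  (\int[leb]_(x in A) ((fbar x)%:E * \int[leb]_(y in B) (g0 x y)%:E))%E.

Definition joint_density (z : R * R) : R := fbar z.1 * g0 z.1 z.2.

Lemma joint_density_ge0 z : 0 <= joint_density z.
Proof. exact: mulr_ge0. Qed.

Lemma measurable_joint_density : measurable_fun [set: R * R] joint_density.
Proof. by apply: measurable_funM => //; exact: measurableT_comp. Qed.

Lemma integral_joint (F : R * R -> \bar R) : measurable_fun setT F -> (forall z, (0 <= F z)%E) ->
  (\int[leb \x leb]_z ((joint_density z)%:E * F z) =
   \int[leb]_x ((fbar x)%:E * \int[leb]_y ((g0 x y)%:E * F (x, y))))%E.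
Proof.
move=> mF F0; rewrite fubini_tonelli1/=.
- apply: eq_integral => x _; rewrite /fubini_F -ge0_integralZl//.
  + by apply: eq_integral => y _; rewrite /joint_density EFinM muleA.
  + apply: emeasurable_funM.
      apply/measurable_EFinP; exact: (measurableT_comp g0_meas (pair1_measurable x)).
    exact: (measurableT_comp mF (pair1_measurable x)).
  + by move=> y _; rewrite mule_ge0// lee_fin.
  + by rewrite lee_fin.
- by apply: emeasurable_funM => //; apply/measurable_EFinP; exact: measurable_joint_density.
- by move=> z; rewrite mule_ge0// lee_fin joint_density_ge0.
Qed.

Lemma rect_law_joint (A B : set R) : measurable A -> measurable B ->
  (\int[leb \x leb]_(z in A `*` B) (joint_density z)%:E = rect_law A B)%E.
Proof.
move=> mA mB; rewrite integral_mkcond epatch_indic.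
have mI : measurable_fun setT (EFin \o \1_(A `*` B) : R * R -> \bar R).
  by apply/measurable_EFinP; apply: measurable_indic; exact: measurableX.
rewrite (integral_joint mI); last by move=> z; rewrite /= lee_fin.
rewrite /rect_law [RHS]integral_mkcond; apply: eq_integral => x _.
rewrite patchE; case: ifPn => [xA|xA].
  congr (_ * _)%E; rewrite [RHS]integral_mkcond; apply: eq_integral => y _.
  rewrite patchE /= indicE in_setX xA /=; case: ifPn => _; rewrite ?mule1 ?mule0//.
rewrite integral0_eq ?mule0// => y _.
by rewrite /= indicE in_setX (negbTE xA) mule0.
Qed.

(** Independence and the common law are encoded by probabilities of rectangles alone; expectations
    of products have to be recovered from these. *)
Definition iid_law d (T : measurableType d) (P : probability T R) (X Y : nat -> T -> R) :=
  forall (n : nat) (A B : nat -> set R),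
  (forall j, measurable (A j)) -> (forall j, measurable (B j)) ->
  P (\bigcap_(j < n) (X j @^-1` A j `&` Y j @^-1` B j)) = (\prod_(j < n) rect_law (A j) (B j))%E.

Context d (T : measurableType d) (P : probability T R) (X Y : nat -> T -> R).
Hypotheses (mX : forall j, measurable_fun setT (X j)) (mY : forall j, measurable_fun setT (Y j)).
Hypothesis law : iid_law P X Y.

Lemma rect_law_prob (A B : set R) : measurable A -> measurable B ->
  rect_law A B = P (X 0%N @^-1` A `&` Y 0%N @^-1` B).
Proof.
move=> mA mB; have := law 1 (fun=> mA) (fun=> mB).
rewrite big_ord1 => <-; congr (P _).
by rewrite bigcap_mkord big_ord1.
Qed.

Lemma rect_law_fin (A B : set R) : measurable A -> measurable B ->
  rect_law A B \is a fin_num.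
Proof.
move=> mA mB; rewrite rect_law_prob// fin_num_measure//.
by apply: measurableI; rewrite -[X in measurable X]setTI; [exact: mX|exact: mY].
Qed.

Lemma rect_lawT : rect_law setT setT = 1%E.
Proof. by rewrite rect_law_prob// !preimage_setT setTI probability_setT. Qed.

Variables (F : R -> R -> R) (rho : R).
Hypothesis F_ge0 : forall x y, 0 <= F x y.
Hypothesis F_meas : measurable_fun [set: R * R] (fun z : R * R => F z.1 z.2).
Hypothesis F_int : (\int[leb]_x ((fbar x)%:E * \int[leb]_y (g0 x y * F x y)%:E) = rho%:E)%E.

Let Sn n (A B : nat -> set R) := \bigcap_(j < n) (X j @^-1` A j `&` Y j @^-1` B j).
Let prodF m (t : T) : R := \prod_(i < m) F (X i t) (Y i t).

Let mSn n A B : (forall j, measurable (A j)) -> (forall j, measurable (B j)) ->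
  measurable (Sn n A B).
Proof.
move=> mA mB; apply: bigcap_measurableType => j _.
by apply: measurableI; rewrite -[X in measurable X]setTI; [exact: mX|exact: mY].
Qed.

Let mZ j : measurable_fun setT (fun t => (X j t, Y j t)).
Proof. exact: measurable_fun_pair. Qed.

Let mprodF m : measurable_fun setT (prodF m).
Proof. by apply: measurable_prod => i _; exact: (measurableT_comp F_meas (mZ i)). Qed.

Let prodF_ge0 m t : 0 <= prodF m t. Proof. exact: prodr_ge0. Qed.

(* The first [m] coordinates are integrated against [F], the others restricted to rectangles:
   induction on [m] replaces one rectangle at a time by [F]. *)
Lemma hybrid_expectation m : forall n (A B : nat -> set R), (m <= n)%N ->
  (forall j, measurable (A j)) -> (forall j, measurable (B j)) ->
  (forall j, (j < m)%N -> A j = setT /\ B j = setT) ->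
  (\int[P]_(t in Sn n A B) (prodF m t)%:E =
    (rho ^+ m * \prod_(j < n) fine (rect_law (A j) (B j)))%:E)%E.
Proof.
have prodE n (A B : nat -> set R) : (forall j, measurable (A j)) -> (forall j, measurable (B j)) ->
    (\prod_(j < n) rect_law (A j) (B j) = (\prod_(j < n) fine (rect_law (A j) (B j)))%:E)%E.
  move=> mA mB; elim: n => [|n IH]; first by rewrite !big_ord0.
  by rewrite !big_ord_recr/= IH EFinM fineK// rect_law_fin.
elim: m => [|m IHm] n A B mn mA mB AT.
  rewrite mul1r -prodE// -law//; rewrite -[RHS]mul1e -integral_cst//; last exact: mSn.
  by apply: eq_integral => t _; rewrite /prodF big_ord0.
pose W t := \1_(Sn n A B) t * prodF m t.
have mW : measurable_fun setT W.
  by apply: measurable_funM => //; apply: measurable_indic; exact: mSn.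
have W0 t : 0 <= W t by rewrite mulr_ge0.
pose K := rho ^+ m * \prod_(j < n) fine (rect_law (A j) (B j)).
have SnT : Sn n (fun j => if j == m then setT else A j) (fun j => if j == m then setT else B j) =
    Sn n A B.
  by apply: eq_bigcapr => j _; case: eqP => // ->; have [-> ->] := AT m (ltnSn m).
have rect A' B' : measurable A' -> measurable B' ->
    (\int[P]_(t in (fun t => (X m t, Y m t)) @^-1` (A' `*` B')) (W t)%:E =
    K%:E * rect_law A' B')%E.
  move=> mA' mB'.
  (* Coordinate [m] is unconstrained in [A] and [B], so an arbitrary rectangle can be placed there
     and the induction hypothesis applied. *)
  pose A1 j := if j == m then A' else A j.
  pose B1 j := if j == m then B' else B j.
  have prod2 (q : set R -> set R -> R) : q setT setT = 1 ->
      \prod_(j < n) q (A1 j) (B1 j) = q A' B' * \prod_(j < n) q (A j) (B j).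
    move=> qT; rewrite (bigD1 (Ordinal mn))//= [in RHS](bigD1 (Ordinal mn))//= /A1 /B1 eqxx.
    have [-> ->] := AT m (ltnSn m); rewrite qT mul1r; congr (_ * _).
    by apply: eq_bigr => j; rewrite -val_eqE => /negbTE/= ->.
  have := IHm n A1 B1 (ltnW mn).
  have -> : Sn n A1 B1 = (fun t => (X m t, Y m t)) @^-1` (A' `*` B') `&` Sn n A B.
    apply/seteqP; split=> [t St|t [[/= At Bt] St] j /= jn].
      split; first by have := St m mn; rewrite /A1 /B1 eqxx.
      move=> j /= jn; have := St j jn; rewrite /A1 /B1; case: eqP => // ->.
      by have [-> ->] := AT m (ltnSn m).
    by rewrite /A1 /B1; case: eqP => [->|_] //; exact: St.
  rewrite integral_mkcondr => IH.
  transitivity (\int[P]_(t in (fun t => (X m t, Y m t)) @^-1` (A' `*` B'))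
     ((EFin \o prodF m) \_ (Sn n A B)) t)%E.
    apply: eq_integral => t _; rewrite epatch_indic /= /W -EFinM mulrC.
    by [].
  rewrite IH.
  - rewrite -[in RHS](fineK (rect_law_fin mA' mB')) -EFinM; congr EFin.
    rewrite /K -mulrA (prod2 (fun A B => fine (rect_law A B))) ?rect_lawT//.
    by rewrite [fine (rect_law A' B') * _]mulrC.
  - by move=> j; rewrite /A1; case: ifP.
  - by move=> j; rewrite /B1; case: ifP.
  - move=> j jm; rewrite /A1 /B1 ltn_eqF//; apply: AT; exact: ltnW.
have K0 : 0 <= K.
  have := rect setT setT measurableT measurableT; rewrite rect_lawT mule1 => KE.
  by rewrite -lee_fin -KE; apply: integral_ge0 => t _; rewrite lee_fin.
(* [nu1] is the law of the observation [m] weighted by [W], [nu2] is [K] times the joint law. They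
   agree on rectangles, an intersection-stable generating class, hence everywhere; integrating [F]
   against both performs the replacement. *)
pose nu1 := wpush_measure P mW W0 (mZ m).
have mKd : measurable_fun [set: R * R] (fun z => K * joint_density z).
  by apply: measurable_funM => //; exact: measurable_joint_density.
have Kd0 z : 0 <= K * joint_density z by rewrite mulr_ge0// joint_density_ge0.
have mid : measurable_fun setT
    (fun z : measurableTypeR R * measurableTypeR R => (z : (R * R)%type)) by exact: measurable_id.
pose nu2 := wpush_measure (leb \x leb)%E mKd Kd0 mid.
have nu2rect A' B' : measurable A' -> measurable B' -> nu2 (A' `*` B') = (K%:E * rect_law A' B')%E.
  move=> mA' mB'; rewrite -(rect_law_joint mA' mB') -ge0_integralZl//; last 3 first.
  - exact: measurableX.
  - by apply: measurable_funTS; apply/measurable_EFinP; exact: measurable_joint_density.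
  - by move=> z _; rewrite lee_fin joint_density_ge0.
have nuE C : measurable C -> nu1 C = nu2 C.
  rewrite measurable_prod_measurableType => mC; move: C mC.
  have U := @g_sigma_algebra_measure_unique _ R _
    [set A `*` B | A in measurable & B in measurable] _ (fun=> setT) _ _ nu1 nu2.
  apply: U.
  - by move=> _ [A' mA'] [B' mB'] <-; exact: measurableX.
  - by move=> _; exists setT => //; exists setT => //; rewrite setXTT.
  - by rewrite bigcup_const.
  - move=> _ _ [A1 mA1] [B1 mB1] <- [A2 mA2] [B2 mB2] <-.
    exists (A1 `&` A2); first exact: measurableI.
    exists (B1 `&` B2); first exact: measurableI.
    by rewrite setXI.
  - by move=> _ [A' mA'] [B' mB'] <-; rewrite nu2rect// -rect.
  - move=> _; rewrite -setXTT; have -> : nu1 (setT `*` setT) = (K%:E * rect_law setT setT)%E.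
      by rewrite -rect.
    by rewrite rect_lawT mule1 ltry.
have mFE : measurable_fun [set: R * R] (fun z : R * R => (F z.1 z.2)%:E).
  exact/measurable_EFinP.
have F0E (z : R * R) : (0 <= (F z.1 z.2)%:E)%E by rewrite lee_fin.
have : (\int[nu1]_z (F z.1 z.2)%:E = \int[nu2]_z (F z.1 z.2)%:E)%E.
  by apply: eq_measure_integral => C mC _; exact: nuE.
rewrite integral_wpush// integral_wpush//= => E1.
rewrite integral_mkcond epatch_indic.
transitivity (\int[P]_t ((W t)%:E * (F (X m t) (Y m t))%:E))%E.
  apply: eq_integral => t _ /=; rewrite /W /prodF big_ord_recr/= -!EFinM; congr EFin; ring.
rewrite E1.
transitivity (K%:E * \int[leb \x leb]_z ((joint_density z)%:E * (F z.1 z.2)%:E))%E.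
  rewrite -ge0_integralZl//; last 2 first.
  - by apply: emeasurable_funM => //; apply/measurable_EFinP; exact: measurable_joint_density.
  - by move=> z _; rewrite mule_ge0// lee_fin joint_density_ge0.
  by apply: eq_integral => z _; rewrite EFinM muleA.
rewrite integral_joint//=.
transitivity (K%:E * rho%:E)%E.
  by congr (_ * _)%E; rewrite -F_int.
by rewrite -EFinM /K exprSr; congr EFin; ring.
Qed.

Lemma expectation_prod n : (\int[P]_t (\prod_(i < n) F (X i t) (Y i t))%:E = (rho ^+ n)%:E)%E.
Proof.
have := @hybrid_expectation n n (fun=> setT) (fun=> setT) (leqnn n) (fun=> measurableT)
  (fun=> measurableT) (fun _ _ => conj erefl erefl).
rewrite rect_lawT/= prodr_const expr1n mulr1 => <-.
congr integral; apply/esym; rewrite -subTset => t _ j _.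
by split.
Qed.

End ProductExpectation.

(** * Identifiability and compactness *)

Section GlobalIdentifiability.
Variables (R : realType) (Xs : set R) (fbar : R -> R).
Hypotheses (Xs_compact : compact Xs) (fbar_ge0 : forall x, 0 <= fbar x).
Hypothesis fbar_out : forall x, ~ Xs x -> fbar x = 0.
Hypothesis fbar_meas : measurable_fun setT fbar.
Hypothesis fbar_int : (\int[@lebesgue_measure R]_(x in Xs) (fbar x)%:E = 1)%E.
Local Notation D := (R * R * R)%type.
Variables (k0 : nat) (pi0 : 'I_k0 -> R) (th0 : 'I_k0 -> D).
Hypothesis pi0_gt0 : forall j, 0 < pi0 j.
Hypothesis th0_quad : forall j, quadrant (th0 j).

(** Group the atoms of both mixtures by value. The difference of the masses at a value is a constant
    coefficient in [hexp_free], hence zero; positive weights do not cancel within a group, so both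
    mixtures have the same set of atoms. *)
Lemma identifiable m (w : 'I_m -> R) (e : 'I_m -> D) : (forall i, 0 < w i) ->
  (forall i, quadrant (e i)) -> (forall n, L1 fbar (Delta pi0 th0 w e n) = 0) ->
  (forall i, exists j, e i = th0 j) /\ (forall j, exists i, e i = th0 j).
Proof.
move=> w0 eq D0.
pose s : seq D := codom e ++ codom th0.
have es i : e i \in s by rewrite mem_cat codom_f.
have ths j : th0 j \in s by rewrite mem_cat codom_f orbT.
pose I := seq_sub s.
pose c (p : I) : R := \sum_(i | e i == val p) w i - \sum_(j | th0 j == val p) pi0 j.
have dense := L1_null_dense fbar_ge0 fbar_out fbar_meas fbar_int
  (fun n => tame_Delta Xs_compact pi0 th0 w e n) D0.
have c0 : forall p, (c p)%:P%:P = 0 :> {poly {poly R}}.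
  apply: (@hexp_free R I val (fun p => (c p)%:P%:P)
    [set x | Xs x /\ forall n, Delta pi0 th0 w e n x = 0]).
  - exact: val_inj.
  - move=> p; have := valP p; rewrite mem_cat => /orP[] /codomP[i ->] //.
  - by move=> q hq; apply: dense => x Xx hx; exact: hq.
  - move=> x [Xx hx] n; rewrite -[RHS](hx n) /Delta.
    rewrite (partition_big (fun i => SeqSub (es i) : I) xpredT)//=.
    rewrite [X in _ - X](partition_big (fun j => SeqSub (ths j) : I) xpredT)//= -sumrB.
    apply: eq_bigr => p _; rewrite !hornerC /c mulrBl !mulr_suml; congr (_ - _).
      by apply: eq_big => [i|i /eqP->//]; rewrite -val_eqE.
    by apply: eq_big => [i|i /eqP->//]; rewrite -val_eqE.
have {}c0 p : c p = 0.
  by apply: (@polyC_inj R); apply: (@polyC_inj _); rewrite c0 !polyC0.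
split=> [i|j].
  apply: contrapT => /forallNP nj.
  have := c0 (SeqSub (es i)); rewrite /c/= [X in _ - X]big1 ?subr0; last first.
    by move=> j /eqP ej; case: (nj j).
  rewrite (bigD1 i)//= => /eqP; rewrite paddr_eq0 ?(ltW (w0 _)) ?sumr_ge0//.
    by rewrite gt_eqF.
  by move=> i' _; exact: ltW.
apply: contrapT => /forallNP ni.
have := c0 (SeqSub (ths j)); rewrite /c/= big1 ?sub0r; last first.
  by move=> i /eqP ei; case: (ni i).
rewrite (bigD1 j)//= => /eqP; rewrite oppr_eq0 paddr_eq0 ?(ltW (pi0_gt0 _)) ?sumr_ge0//.
  by rewrite gt_eqF.
by move=> j' _; exact: ltW.
Qed.

Definition near_truth (del : R) m (e : 'I_m -> D) : Prop :=
  (forall i, exists j, small del (e i - th0 j)) /\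
  (forall j, exists i, small del (e i - th0 j)).

Lemma smallD (d1 d2 : R) (x y : D) : small d1 x -> small d2 y -> small (d1 + d2) (x + y).
Proof.
move=> /and3P[a1 b1 v1] /and3P[a2 b2 v2]; apply/and3P; split;
  by rewrite (le_trans (ler_normD _ _))// lerD.
Qed.

Variables (tau1 tau2 : R) (Om2 : set R).
Hypothesis Om2_compact : compact Om2.

(** Lower semicontinuity is enough for the compactness argument: a positive value has to stay
    positive nearby. The change of [w * hexp] is split into a change of weight, a change of atom and
    their product. *)
Lemma L1_Delta_continuous m (w0 : 'I_m -> R) (e0 : 'I_m -> D) n (eps : R) : 0 < eps ->
  exists2 rho : R, 0 < rho <= 1 & forall w e,
    (forall i, `|w i - w0 i| <= rho) -> (forall i, small rho (e i - e0 i)) ->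
    L1 fbar (Delta pi0 th0 w0 e0 n) <= L1 fbar (Delta pi0 th0 w e n) + eps.
Proof.
move=> eps0.
have [B B1 hB] := support_bounded Xs_compact.
have B0 : 0 <= B := le_trans ler01 B1.
have /choice[HC hHC] : forall i, exists HC : R * R, [/\ 0 <= HC.1, 0 <= HC.2,
    forall x, `|x| <= B -> hexp n%:R x (e0 i) <= HC.1 & forall del d x, del <= 1 -> small del d ->
    `|x| <= B -> `|hexp n%:R x (e0 i + d) - hexp n%:R x (e0 i)| <= HC.2 * del].
  move=> i; have [H H0 hH] := hexp_bound (e0 i) n%:R B0.
  by have [C C0 hC] := hexp_continuous_at (e0 i) n%:R B0; exists (H, C).
pose S := \sum_i ((HC i).1 + (HC i).2 + `|w0 i| * (HC i).2).
have S0 : 0 <= S.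
  by apply: sumr_ge0 => i _; have [? ? _ _] := hHC i; rewrite !addr_ge0// mulr_ge0.
pose rho := Num.min 1 (eps / (S + 1)).
have S10 : 0 < S + 1 by rewrite ltr_wpDl.
have rho0 : 0 < rho by rewrite lt_min ltr01 divr_gt0.
have rho1 : rho <= 1 by rewrite ge_min lexx.
exists rho; first by rewrite rho0.
move=> w e hw he.
apply: le_trans (_ : _ <= L1 fbar (Delta pi0 th0 w e n) + L1 fbar (fun=> eps)) _; last first.
  rewrite lerD2l; apply: (L1_le fbar_ge0 fbar_out fbar_meas fbar_int) => //; first exact: ltW.
  by move=> x _; rewrite gtr0_norm.
apply: (L1_triangle fbar_ge0 fbar_out fbar_meas fbar_int).
- exact: tame_Delta.
- exact: tame_Delta.
- exact: tame_cst.
move=> x Xx; rewrite [`|eps|]gtr0_norm//.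
rewrite -[X in `|X| <= _](subrK (Delta pi0 th0 w e n x)) addrC (le_trans (ler_normD _ _))// lerD2l.
have -> : Delta pi0 th0 w0 e0 n x - Delta pi0 th0 w e n x =
   - \sum_i (w i * hexp n%:R x (e i) - w0 i * hexp n%:R x (e0 i)).
  by rewrite /Delta sumrB; ring.
rewrite normrN (le_trans (ler_norm_sum _ _ _))//.
apply: le_trans (_ : rho * S <= _); last first.
  apply: le_trans (_ : eps / (S + 1) * S <= _).
    by rewrite ler_wpM2r// ge_min lexx orbT.
  by rewrite mulrAC ler_pdivrMr// ler_pM2l// lerDl.
rewrite mulr_sumr; apply: ler_sum => i _.
have [H0 C0 hH hC] := hHC i.
have hc := hC rho (e i - e0 i) x rho1 (he i) (hB x Xx).
rewrite [e0 i + _]addrC subrK in hc.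
have hh := hH x (hB x Xx).
set he' := hexp _ _ (e i) in hc *; set h0 := hexp _ _ (e0 i) in hc hh *.
have h0p : 0 <= h0 by exact: expR_ge0.
have -> : w i * he' - w0 i * h0 = (w i - w0 i) * h0 + (w i - w0 i) * (he' - h0) + w0 i * (he' - h0).
  by ring.
apply: le_trans (ler_normD _ _) _; rewrite [leRHS]mulrDr; apply: lerD; last first.
  by rewrite normrM [rho * _]mulrC -mulrA ler_wpM2l.
apply: le_trans (ler_normD _ _) _; rewrite [leRHS]mulrDr; apply: lerD.
  by rewrite normrM (ger0_norm h0p); apply: ler_pM.
rewrite normrM; apply: ler_pM => //; apply: le_trans hc _.
by rewrite ler_piMr.
Qed.

Local Notation params m := ('rV[R]_m * ('rV[R]_m * 'rV[R]_m * 'rV[R]_m))%type.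

(** Near a point of the compact parameter set, either all [Delta] have norm zero and identifiability
    puts the atoms on those of G_0, or one norm is positive and excludes small [eta]. The bound
    [cbar] passes to limits, which therefore have the positive weights that identifiability uses.
    The number [m] of atoms is fixed to work in one product of row vectors. *)
Lemma global_near_fixed m (cbar del : R) (Kn : nat -> R) : 0 < cbar -> 0 < del ->
  (forall n, 0 < Kn n) -> exists2 eta : R, 0 < eta & forall (w : 'I_m -> R) (e : 'I_m -> D),
    (forall i, cbar <= w i <= 1) -> (forall i, inOmega tau1 tau2 Om2 (e i)) ->
    (forall n, L1 fbar (Delta pi0 th0 w e n) <= Kn n * eta) -> near_truth del e.
Proof.
move=> cbar0 del0 Kn0.
pose wv (v : (params m)) i := v.1 ord0 i.
pose ev (v : (params m)) i : D := (v.2.1.1 ord0 i, v.2.1.2 ord0 i, v.2.2 ord0 i).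
pose box (A : set R) := [set v : 'rV[R]_m | forall i, A (v ord0 i)].
have box_compact A : compact A -> compact (box A) by move=> Ac; exact: (@rV_compact R m (fun=> A)).
pose K : set (params m) := box `[cbar, 1]%classic `*` ((box `[0, tau1]%classic `*` box `[0, tau2]%classic) `*` box Om2).
have VKc : compact K.
  apply: compact_setX; first by apply: box_compact; exact: segment_compact.
  apply: compact_setX; last exact: box_compact.
  by apply: compact_setX; apply: box_compact; exact: segment_compact.
pose Pp (eta : R) v := (forall n, L1 fbar (Delta pi0 th0 (wv v) (ev v) n) <= Kn n * eta) ->
  near_truth del (ev v).
have nbh (v : (params m)) rho : 0 < rho -> \forall v' \near v,
    (forall i, `|wv v' i - wv v i| <= rho) /\ (forall i, small rho (ev v' i - ev v i)).
  move=> rho0.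
  have coord (f : (params m) -> 'rV[R]_m) : f @ v --> f v ->
      \forall v' \near v, forall i, `|f v' ord0 i - f v ord0 i| <= rho.
    move=> fc; apply: (@filter_forall _ _ (fun i v' => `|f v' ord0 i - f v ord0 i| <= rho)
      (nbhs v)) => i.
    have : (fun v' => f v' ord0 i) @ v --> f v ord0 i.
      exact: (cvg_comp _ _ fc (@coord_continuous R _ _ ord0 i (f v))).
    by move/cvgrPdist_le => /(_ _ rho0); apply: filterS => v'; rewrite distrC.
  have c0 : (fun v' : (params m) => v'.1) @ v --> v.1 by exact: cvg_fst.
  have cf (U1 U2 : topologicalType) (f : params m -> (U1 * U2)%type) : f @ v --> f v ->
      (fun v' => (f v').1) @ v --> (f v).1 /\ (fun v' => (f v').2) @ v --> (f v).2.
    move=> fc; split.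
      exact: (@cvg_comp _ _ _ f fst (nbhs v) (nbhs (f v)) (nbhs (f v).1) fc cvg_fst).
    exact: (@cvg_comp _ _ _ f snd (nbhs v) (nbhs (f v)) (nbhs (f v).2) fc cvg_snd).
  have [_ cs] := cf _ _ id (@cvg_id _ _).
  have [cs1 c3] := cf _ _ (fun v' : params m => v'.2) cs.
  have [c1 c2] := cf _ _ (fun v' : params m => v'.2.1) cs1.
  have n0 := coord _ c0; have n1 := coord _ c1; have n2 := coord _ c2; have n3 := coord _ c3.
  near=> v'; split; first by near: v'.
  by move=> i; apply/and3P; split; move: i; near: v'.
have : \forall eta \near (0 : R)^'+,
    K `<=` Pp eta.
  move/compact_near_coveringP : VKc; apply => v Kv.
  have [/= Kw [[Ka Kb] Kvar]] := Kv.
  have wvpos i : 0 < wv v i.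
    by have := Kw i; rewrite /= in_itv/= => /andP[h _]; exact: lt_le_trans h.
  have quad i : quadrant (ev v i).
    have := Ka i; have := Kb i; rewrite /= !in_itv/= => /andP[h1 _] /andP[h2 _].
    by rewrite /quadrant h1 h2.
  have [Z|NZ] := pselect (forall n, L1 fbar (Delta pi0 th0 (wv v) (ev v) n) = 0).
    have [h1 h2] := identifiable wvpos quad Z.
    near=> v' eta => _.
    have [_ hs] : (forall i, `|wv v' i - wv v i| <= del) /\ (forall i, small del (ev v' i - ev v i)).
      by near: v'; exact: nbh.
    split=> [i|j]; first by have [j ej] := h1 i; exists j; rewrite -ej; exact: hs.
    by have [i ei] := h2 j; exists i; rewrite -ei; exact: hs.
  have [n nz] : exists n, 0 < L1 fbar (Delta pi0 th0 (wv v) (ev v) n).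
    apply: contrapT => /forallNP h; apply: NZ => n; apply/eqP.
    by rewrite eq_le L1_ge0// andbT leNgt; apply/negP/h.
  set a := L1 _ _ in nz.
  have a2 : 0 < a / 2 by rewrite divr_gt0.
  have [rho /andP[rho0 _] hrho] := L1_Delta_continuous (wv v) (ev v) n a2.
  near=> v' eta => hn; exfalso.
  have [hw he] : (forall i, `|wv v' i - wv v i| <= rho) /\ (forall i, small rho (ev v' i - ev v i)).
    by near: v'; exact: nbh.
  have h1 := hrho _ _ hw he.
  have h2 := hn n.
  have h3 : eta < a / 2 / Kn n by near: eta; apply: nbhs_right_lt; rewrite divr_gt0.
  rewrite ltr_pdivlMr// mulrC in h3.
  have {}h1 : a <= L1 fbar (Delta pi0 th0 (wv v') (ev v') n) + a / 2 := h1.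
  have h4 := le_trans h1 (lerD h2 (lexx _)).
  have : Kn n * eta + a / 2 < a by rewrite [ltRHS](splitr a) ltrD2r.
  by rewrite ltNge h4.
move=> hnear; near (0 : R)^'+ => eta.
have eta0 : 0 < eta by near: eta; exact: nbhs_right_gt.
have H : K `<=` Pp eta by near: eta.
exists eta => // w e hw he hD.
pose v : (params m) := (\row_i w i, (\row_i (e i).1.1, \row_i (e i).1.2, \row_i (e i).2)).
have wE : wv v = w by apply/funext => i; rewrite /wv /= mxE.
have eE : ev v = e by apply/funext => i; rewrite /ev /= !mxE; case: (e i) => [[? ?] ?].
have := H v; rewrite /Pp wE eE; apply => //.
split; first by move=> i; rewrite /= mxE in_itv/=.
by split; [split|] => i; rewrite /= mxE; have [h1 h2 h3] := he i; rewrite ?in_itv.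
Unshelve. all: by end_near.
Qed.

End GlobalIdentifiability.

(** * From affinity to transport distance *)

Section Coupling.
Variables (R : realType) (kappa : nat * nat * nat) (G G0 : mixmeas R).
Local Notation w := (@mwt R G).
Local Notation w0 := (@mwt R G0).
Local Notation e := (@matom R G).
Local Notation e0 := (@matom R G0).
Local Notation W := (class_mass w).

Lemma dkappa_pow_ge0 (x y : R * R * R) : 0 <= dkappa_pow kappa x y.
Proof. by rewrite /dkappa_pow !addr_ge0// exprn_ge0. Qed.

(* Atom [i] keeps the fraction [min(1, w0 j / W j)] of its mass on [j = J i]; the leftover
   masses are coupled independently. *)
Lemma coupling_bound (J : 'I_(mnum G) -> 'I_(mnum G0)) (D : R) :
  (forall i, 0 <= w i) -> (forall j, 0 <= w0 j) -> \sum_i w i = 1 -> \sum_j w0 j = 1 ->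
  0 <= D -> (forall i j, dkappa_pow kappa (e i) (e0 j) <= D) ->
  exists2 q : 'I_(mnum G) -> 'I_(mnum G0) -> R, is_coupling q &
    \sum_i \sum_j q i j * dkappa_pow kappa (e i) (e0 j) <=
    \sum_i w i * dkappa_pow kappa (e i) (e0 (J i)) + D * \sum_j `|W J j - w0 j|.
Proof.
move=> wp w0p w1 w01 D0 hD.
have Wp j : 0 <= W J j by apply: sumr_ge0.
(* For a class of mass zero the quotient is 0 by convention, and [fW] still holds with both sides
   zero. *)
pose f j := Num.min 1 (w0 j / W J j).
have f0 j : 0 <= f j by rewrite le_min ler01 divr_ge0.
have f1 j : f j <= 1 by rewrite ge_min lexx.
have fW j : f j * W J j = Num.min (W J j) (w0 j).
  have [W0|Wn0] := eqVneq (W J j) 0; first by rewrite W0 mulr0 min_l.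
  by rewrite /f minr_pMl// mul1r divfK.
pose l i := w i * (1 - f (J i)).
pose l' j := w0 j - f j * W J j.
have lp i : 0 <= l i by rewrite mulr_ge0// subr_ge0.
have l'p j : 0 <= l' j by rewrite subr_ge0 fW ge_min lexx orbT.
pose r := \sum_i l i.
have sumf : \sum_i w i * f (J i) = \sum_j f j * W J j.
  rewrite (partition_big J xpredT)//=; apply: eq_bigr => j _.
  by rewrite mulr_sumr; apply: eq_bigr => i /eqP <-; rewrite mulrC.
have rE : r = \sum_j l' j.
  rewrite /r /l' sumrB w01 -sumf -w1 -sumrB; apply: eq_bigr => i _.
  by rewrite /l mulrBr mulr1.
have r0 : 0 <= r by exact: sumr_ge0.
(* If [r = 0] then [r / r] is 0 by convention, but all leftovers vanish as well, so the formula for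
   [q] needs no case distinction. *)
have lr i : l i * (r / r) = l i.
  have [r00|rn0] := eqVneq r 0; last by rewrite divff// mulr1.
  have /(_ i isT) -> : forall i, true -> l i = 0 by apply: psumr_eq0P => // *; exact: lp.
  by rewrite mul0r.
have l'r j : l' j * (r / r) = l' j.
  have [r00|rn0] := eqVneq r 0; last by rewrite divff// mulr1.
  have r01 : \sum_j l' j = 0 by rewrite -rE.
  have /(_ j isT) -> : forall j, true -> l' j = 0 by apply: psumr_eq0P => // *; exact: l'p.
  by rewrite mul0r.
pose q i j := (if j == J i then w i * f (J i) else 0) + l i * l' j / r.
exists q; first split.
- move=> i j; apply: addr_ge0; last by rewrite divr_ge0// mulr_ge0.
  by case: ifP => // _; rewrite mulr_ge0.
- move=> i; rewrite big_split/= -big_mkcond big_pred1_eq.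
  have -> : \sum_j l i * l' j / r = l i by rewrite -mulr_suml -mulr_sumr -rE -mulrA lr.
  by rewrite /l mulrBr mulr1 addrC subrK.
- move=> j; rewrite big_split/= -big_mkcond/=.
  rewrite (eq_bigl (fun i => J i == j)); last by move=> i; rewrite eq_sym.
  have -> : \sum_i l i * l' j / r = l' j.
    by rewrite -!mulr_suml -/r [r * _]mulrC -mulrA l'r.
  rewrite /l' addrC -[RHS](subrK (f j * W J j)); congr (_ + _).
  by rewrite /class_mass mulr_sumr; apply: eq_bigr => i /eqP <-; rewrite mulrC.
rewrite (_ : \sum_i _ = \sum_i (w i * f (J i)) * dkappa_pow kappa (e i) (e0 (J i)) +
  \sum_i \sum_j l i * l' j / r * dkappa_pow kappa (e i) (e0 j)); last first.
  rewrite -big_split/=; apply: eq_bigr => i _.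
  under eq_bigr do rewrite mulrDl.
  rewrite big_split/=; congr (_ + _).
  rewrite (bigD1 (J i))//= eqxx big1 ?addr0// => j /negPf ->; exact: mul0r.
apply: lerD.
  apply: ler_sum => i _; rewrite ler_wpM2r ?dkappa_pow_ge0//.
  by rewrite ler_piMr.
have rle : r <= \sum_j `|W J j - w0 j|.
  rewrite rE; apply: ler_sum => j _.
  rewrite /l' fW; case: (leP (W J j) (w0 j)) => h; last by rewrite subrr.
  by rewrite distrC ler_norm.
apply: le_trans (_ : \sum_i \sum_j l i * l' j / r * D <= _).
  by apply: ler_sum => i _; apply: ler_sum => j _; rewrite ler_wpM2l// divr_ge0// mulr_ge0.
rewrite (_ : \sum_i _ = D * r); last first.
  rewrite /r mulr_sumr; apply: eq_bigr => i _.
  by rewrite -mulr_suml -mulr_suml -mulr_sumr -rE -[l i * r / r]mulrA lr mulrC.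
by rewrite ler_wpM2l.
Qed.

Lemma Wkappa_le_coupling (q : 'I_(mnum G) -> 'I_(mnum G0) -> R) (c : R) : is_coupling q ->
  \sum_i \sum_j q i j * dkappa_pow kappa (e i) (e0 j) <= c ->
  Wkappa kappa G G0 <= c `^ ((kappa_norm kappa)%:R^-1).
Proof.
move=> qc hc; rewrite /Wkappa; set S := (X in inf X).
have lb : lbound S 0.
  move=> x [q' [[q'0 _ _] ->]]; apply: sumr_ge0 => i _; apply: sumr_ge0 => j _.
  by rewrite mulr_ge0// dkappa_pow_ge0.
have Sn0 : S !=set0 by eexists; exists q; split; first exact: qc.
have i0 : 0 <= inf S by exact: lb_le_inf.
have ic : inf S <= c.
  by apply: le_trans hc; apply: ge_inf; [exists 0 | exists q].
apply: ge0_ler_powR => //.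
by rewrite nnegrE (le_trans i0).
Qed.

End Coupling.

Section DistanceFromAffinity.
Variables (R : realType) (Xs : set R) (fbar : R -> R).
Hypotheses (Xs_compact : compact Xs) (fbar_ge0 : forall x, 0 <= fbar x).
Hypothesis fbar_out : forall x, ~ Xs x -> fbar x = 0.
Hypothesis fbar_meas : measurable_fun setT fbar.
Hypothesis fbar_int : (\int[@lebesgue_measure R]_(x in Xs) (fbar x)%:E = 1)%E.
Variables (tau1 tau2 : R) (Om2 : set R).
Hypotheses (tau1_gt0 : 0 < tau1) (tau2_gt0 : 0 < tau2).
Hypotheses (Om2_compact : compact Om2) (Om2_gt0 : Om2 `<=` [set x | 0 < x]).
Local Notation D := (R * R * R)%type.
Local Notation inO := (inOmega tau1 tau2 Om2).
Implicit Types (e : D) (G : mixmeas R).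

Lemma inOmega_quadrant e : inO e -> quadrant e.
Proof. by case=> /andP[h1 _] /andP[h2 _] _; rewrite /quadrant h1 h2. Qed.

Lemma inOkc_proper k cbar0 G : 0 < cbar0 -> inOkc tau1 tau2 Om2 k cbar0 G -> proper G.
Proof.
move=> c0 [_ _ hw sw he]; split=> // i; first exact: le_trans (ltW c0) (hw i).
by have [_ _ /Om2_gt0] := he i.
Qed.

Lemma hexp_Omega_bounded (lam : R) :
  exists2 H : R, 0 < H & forall e x, inO e -> Xs x -> hexp lam x e <= H.
Proof.
have [V V1 hV] := support_bounded Om2_compact; have [B B1 hB] := support_bounded Xs_compact.
exists (expR (`|lam| * (tau1 + tau2 * B) ^+ 2 + lam ^+ 2 * (V / 2))); first exact: expR_gt0.
move=> e x [/andP[a0 a1] /andP[b0 b1] /hV v1] /hB xB.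
by apply: hexp_le => //; rewrite ger0_norm.
Qed.

Lemma MG_le (lam x H : R) G : (forall i, 0 <= @mwt R G i) -> \sum_i @mwt R G i = 1 ->
  (forall i, hexp lam x (@matom R G i) <= H) -> @MG R lam x G <= H.
Proof.
move=> w0 w1 hH; rewrite -[H]mul1r -w1 mulr_suml; apply: ler_sum => i _.
by rewrite ler_wpM2l.
Qed.

Lemma dkappa_pow_bounded (kappa : nat * nat * nat) :
  exists2 M : R, 0 <= M & forall e e', inO e -> inO e' -> dkappa_pow kappa e e' <= M.
Proof.
have [V V1 hV] := support_bounded Om2_compact.
have V0 : 0 <= V := le_trans ler01 V1.
exists (tau1 ^+ kappa.1.1 + tau2 ^+ kappa.1.2 + (V + V) ^+ kappa.2).
  by rewrite !addr_ge0// exprn_ge0// ?addr_ge0// ltW.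
move=> e e' [/andP[a0 a1] /andP[b0 b1] /hV v1] [/andP[a0' a1'] /andP[b0' b1'] /hV v1'].
rewrite /dkappa_pow; apply: lerD; first apply: lerD.
- by apply: lerXn2r; rewrite ?nnegrE ?(ltW tau1_gt0) ?(ltW tau2_gt0)// ler_norml; lra.
- by apply: lerXn2r; rewrite ?nnegrE ?(ltW tau1_gt0) ?(ltW tau2_gt0)// ler_norml; lra.
- by rewrite lerXn2r ?nnegrE ?addr_ge0// (le_trans (ler_normB _ _))// lerD.
Qed.

Variables (k0 : nat) (pi0 : 'I_k0 -> R) (th0 : 'I_k0 -> D).
Hypotheses (pi0_gt0 : forall j, 0 < pi0 j) (pi0_sum : \sum_j pi0 j = 1).
Hypotheses (th0_inj : injective th0) (th0_inO : forall j, inO (th0 j)).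

Let th0_quad j : quadrant (th0 j). Proof. exact: inOmega_quadrant. Qed.

Lemma atoms_separated : exists2 del : R, 0 < del &
  forall (d : D) j j', small del (d - th0 j) -> small del (d - th0 j') -> j = j'.
Proof.
have /choice[sep hsep] : forall p : 'I_k0 * 'I_k0, exists del : R, 0 < del /\
    (small del (th0 p.1 - th0 p.2) -> p.1 = p.2).
  move=> [j j'] /=; have [->|jj'] := eqVneq j j'; first by exists 1.
  pose nm (d : D) := Num.max `|d.1.1| (Num.max `|d.1.2| `|d.2|).
  have nm0 : 0 < nm (th0 j - th0 j').
    rewrite !lt_max !normr_gt0.
    apply/negP => /negP; rewrite !negb_or !negbK => /and3P[/eqP h1 /eqP h2 /eqP h3].
    case/eqP: jj'; apply: th0_inj; apply/eqP; rewrite -subr_eq0; apply/eqP.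
    by move: h1 h2 h3; case: (_ - _) => [[? ?] ?] /= -> -> ->.
  exists (nm (th0 j - th0 j') / 2); split; first by rewrite divr_gt0.
  move=> /and3P[h1 h2 h3]; exfalso.
  have : nm (th0 j - th0 j') <= nm (th0 j - th0 j') / 2 by rewrite !ge_max h1 h2 h3.
  by lra.
pose del := (\big[Num.min/1]_p sep p) / 2.
have dle p : del + del <= sep p.
  by rewrite -splitr; apply: (@bigmin_le _ R _ _ p sep).
exists del; first by rewrite divr_gt0//; apply: lt_bigmin => // p _; have [] := hsep p.
move=> d j j' s1 s2.
have s3 : small del (th0 j - d).
  by case/and3P: s1 => h1 h2 h3; apply/and3P; split; rewrite /= distrC.
have [_] := hsep (j, j'); apply => /=.
have := smallD s3 s2; rewrite addrA subrK => /and3P[h1 h2 h3].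
by apply/and3P; split; apply: le_trans (dle _).
Qed.

(** Counting: separation makes the assignment [J] onto, so the other [k0 - 1] classes take at least
    one atom each and at most [k - (k0 - 1)] are left for class [j]. This is the size of the
    polynomial system. *)
Lemma nearest_atom m k (e : 'I_m -> D) (del : R) : near_truth th0 del e -> (m <= k)%N ->
  (forall (d : D) j j', small del (d - th0 j) -> small del (d - th0 j') -> j = j') ->
  exists2 J : 'I_m -> 'I_k0, forall i, small del (e i - th0 (J i)) &
    forall j, (#|[pred i | J i == j]| <= (k - k0).+1)%N.
Proof.
move=> [/choice[J hJ] /choice[I hI]] mk sep; exists J => // j.
have JI j' : J (I j') = j' by apply: sep (hJ _) (hI j').
have : (\sum_j' #|[pred i | J i == j']| = m)%N.
  rewrite -[RHS]card_ord -sum1_card (partition_big J xpredT)//=.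
  by apply: eq_bigr => j' _; rewrite sum1_card; apply: eq_card => i; rewrite !inE.
rewrite (bigD1 j)//= => mE.
have h : (k0.-1 <= \sum_(j' | j' != j) #|[pred i | J i == j']|)%N.
  have -> : k0.-1 = (\sum_(j' < k0 | j' != j) 1)%N.
    by rewrite sum1_card; have := cardC1 j; rewrite card_ord => <-; apply: eq_card => i; rewrite !inE.
  by apply: leq_sum => j' _; apply/card_gt0P; exists (I j'); rewrite inE JI.
set S := (\sum_(j' | _) _)%N in mE h; set c := #|_| in mE *.
move: (ltn_ord j) mE h; move: S c (nat_of_ord j) => S c j'.
by clear -mk; lia.
Qed.

Variable k : nat.
Hypothesis k0k : (k0 < k)%N.
Hypothesis settingII : exists i, (th0 i).1.1 != 0 /\ (th0 i).1.2 = 0.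
Hypothesis rtilde_ex : forall i, (th0 i).1.1 != 0 -> (th0 i).1.2 = 0 ->
  exists r, rtilde_pred (th0 i).1.1 (k - k0).+1 r.

Let sing j := ((th0 j).1.1 != 0) && ((th0 j).1.2 == 0).
Let s := (k - k0).+1.
Let r_ j := rtilde (th0 j).1.1 s.
Let rsin := (\max_(j < k0 | sing j) r_ j)%N.
Let kappa := (rsin, 2%N, uphalf rsin).
Let G0 := @MixMeas R k0 pi0 th0.

Let r_spec j : sing j -> (3 <= r_ j)%N /\ ~ sys_solvable (th0 j).1.1 s (r_ j).
Proof.
case/andP=> t0 /eqP t2; rewrite /r_ /s.
have -> : (k - k0).+1 = (k - k0).-1.+2 by rewrite prednK// subn_gt0.
apply: rtilde_spec; last by have := rtilde_ex t0 t2; rewrite prednK// subn_gt0.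
by have /andP[h _] := th0_quad j; rewrite lt_neqAle eq_sym t0.
Qed.

Let r_le j : sing j -> (r_ j <= rsin)%N.
Proof. by move=> sj; rewrite /rsin (bigD1 j)//= leq_max leqnn. Qed.

Let rsin_ge3 : (3 <= rsin)%N.
Proof.
have [j [t0 t2]] := settingII.
have sj : sing j by rewrite /sing t0 t2 eqxx.
by have [h _] := r_spec sj; exact: leq_trans (r_le sj).
Qed.

Lemma kappa_norm_rsin : kappa_norm kappa = rsin.
Proof. by rewrite /kappa_norm/= (maxn_idPl _)// geq_max (ltnW rsin_ge3)/=; move: rsin_ge3; lia. Qed.

Let E j (d : D) : R := if sing j then singular_err (r_ j) d else sqnorm d.

Let E_model j : local_model (th0 j) s (E j).
Proof.
rewrite /E; case: (boolP (sing j)) => [sj|nsj].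
  have [t0 /eqP t2] := andP sj; have [r3 nsol] := r_spec sj.
  by apply: singular_model => //; exact: leq_trans r3.
by apply: regular_model => t2; move: nsj; rewrite /sing t2 eqxx andbT negbK => /eqP.
Qed.

Let E_ge0 j d : 0 <= E j d.
Proof.
rewrite /E; case: ifP => _; last exact: sqnorm_ge0.
by rewrite /singular_err !addr_ge0// exprn_ge0.
Qed.

(** Increments are at most one, so larger exponents give smaller powers: at a singular atom
    [r_ j <= rsin], at a regular one [rsin >= 3] makes the exponents [rsin] and [uphalf rsin] at
    least 2. *)
Let dkappa_le_E j (e : D) : small 1 (e - th0 j) -> dkappa_pow kappa e (th0 j) <= E j (e - th0 j).
Proof.
rewrite /small /dkappa_pow /kappa /E /singular_err /sqnorm /=.
move: (e.1.1 - _) (e.1.2 - _) (e.2 - _) => a b v /and3P[a1 b1 v1].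
have sq (z : R) : `|z| ^+ 2 = z ^+ 2 by rewrite -normrX ger0_norm ?sqr_ge0.
case: (boolP (sing j)) => [sj|nsj].
  have rr := r_le sj.
  apply: lerD; first apply: lerD.
  - exact: ler_wiXn2l.
  - by rewrite expr2 ler_piMr.
  - by apply: ler_wiXn2l => //; move: rr; lia.
apply: lerD; first apply: lerD.
- by rewrite -(sq a); apply: ler_wiXn2l => //; exact: ltnW.
- by rewrite sq.
- by rewrite -(sq v); apply: ler_wiXn2l => //; move: rsin_ge3; lia.
Qed.

(** The order of the quantifiers matters: [C] comes from the local bound and precedes [cbar0], while
    the threshold [eta] comes from compactness and follows it. *)
Lemma distance_of_affinity : exists2 C : R, 0 < C & forall cbar0, 0 < cbar0 ->
  exists2 eta : R, 0 < eta & forall eps G, 0 < eps -> eps <= eta ->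
    inOkc tau1 tau2 Om2 k cbar0 G -> ((1 - eps ^+ 2)%:E <= affinity fbar G G0)%E ->
    Wkappa kappa G G0 <= (C * eps) `^ (rsin%:R^-1).
Proof.
have /choice[H hH] : forall n : nat, exists H : R, 0 < H /\
    forall e x, inO e -> Xs x -> hexp (2 * n%:R) x e <= H.
  by move=> n; have [H ? ?] := hexp_Omega_bounded (2 * n%:R); exists H.
(* The factor of [eps] in [affinity_mgf]; it depends on [n], but the local bound uses only
   [n < L]. *)
pose Kn n := 1 + 2 * H n.
have Kn0 n : 0 < Kn n by rewrite addr_gt0// mulr_gt0//; have [] := hH n.
have [del1 /andP[del10 del11] [K K0 [L hL]]] := local_dominated Xs_compact fbar_ge0 fbar_out
  fbar_meas fbar_int pi0 th0_inj th0_quad E_model E_ge0.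
have [del2 del20 hsep] := atoms_separated.
have [M M0 hM] := dkappa_pow_bounded kappa.
pose del := Num.min del1 del2.
have del0 : 0 < del by rewrite lt_min del10.
have small_le (a b : R) d : a <= b -> small a d -> small b d.
  by move=> ab /and3P[h1 h2 h3]; apply/and3P; split; exact: le_trans ab.
pose S := \sum_(n < L) Kn n.
have S0 : 0 <= S by apply: sumr_ge0 => n _; exact: ltW.
have prop0 : proper G0.
  split=> [j|//|j]; first exact: ltW.
  by have [_ _ /Om2_gt0] := th0_inO j.
exists ((1 + M) * (K * S) + 1).
  by rewrite ltr_wpDl// !mulr_ge0 ?addr_ge0// ltW.
move=> cbar0 c0.
(* The compactness lemma treats one number of atoms; a minimum over all numbers up to [k] is taken
   by induction. *)
have [eta eta0 heta] : exists2 eta : R, 0 < eta & forall m (w : 'I_m -> R) (e : 'I_m -> D),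
    (m <= k)%N -> (forall i, cbar0 <= w i <= 1) -> (forall i, inO (e i)) ->
    (forall n, L1 fbar (Delta pi0 th0 w e n) <= Kn n * eta) -> near_truth th0 del e.
  elim: k => [|k' [eta1 eta10 h1]].
    have [eta eta0 h] := global_near_fixed Xs_compact fbar_ge0 fbar_out fbar_meas fbar_int
      pi0_gt0 th0_quad tau1 tau2 Om2_compact 0%N c0 del0 Kn0.
    by exists eta => // m w e; rewrite leqn0 => /eqP m0; subst m; exact: h.
  have [eta eta0 h] := global_near_fixed Xs_compact fbar_ge0 fbar_out fbar_meas fbar_int
      pi0_gt0 th0_quad tau1 tau2 Om2_compact k'.+1 c0 del0 Kn0.
  exists (Num.min eta1 eta); first by rewrite lt_min eta10.
  move=> m w e; rewrite leq_eqVlt => /orP[/eqP mE|mk] hw he hn.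
    subst m; apply: h hw he _ => n; apply: le_trans (hn n) _.
    by apply: ler_wpM2l; [exact: ltW|rewrite ge_min lexx orbT].
  apply: h1 mk hw he _ => n; apply: le_trans (hn n) _.
  by apply: ler_wpM2l; [exact: ltW|rewrite ge_min lexx].
exists eta => // eps G eps0 epseta GO aff.
have pG := inOkc_proper c0 GO.
have [w0 w1 _] := pG.
have [mk _ hw _ he] := GO.
have hD n : L1 fbar (Delta pi0 th0 (@mwt R G) (@matom R G) n) <= Kn n * eps.
  have [Hn0 hHn] := hH n; rewrite [Kn n * _]mulrC.
  apply: (affinity_mgf Xs_compact fbar_ge0 fbar_out fbar_meas fbar_int pG prop0 eps0 (ltW Hn0) _ _ aff).
    by move=> x Xx; apply: MG_le => // i; exact: hHn.
  by move=> x Xx; apply: MG_le => // [j|j]; [exact: ltW|exact: hHn].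
have near : near_truth th0 del (@matom R G).
  apply: (heta _ (@mwt R G)) => // [i|n].
    rewrite hw/= -w1 (bigD1 i)//= lerDl; exact: sumr_ge0.
  by apply: le_trans (hD n) _; rewrite ler_wpM2l// ltW.
have near2 : forall (d : D) j j', small del (d - th0 j) -> small del (d - th0 j') -> j = j'.
  by move=> d j j' s1 s2; apply: hsep; [apply: small_le s1|apply: small_le s2];
    rewrite ge_min lexx orbT.
have [J hJ cardJ] := nearest_atom near mk near2.
have hJ1 i : small del1 (matom i - th0 (J i)) by apply: small_le (hJ i); rewrite ge_min lexx.
have dom := hL _ (@mwt R G) (@matom R G) J w0 w1 (fun i => inOmega_quadrant (he i)) hJ1 cardJ.
have [q qc hq] := @coupling_bound R kappa G G0 J M w0 (fun j => ltW (pi0_gt0 j)) w1 pi0_sum M0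
  (fun i j => hM _ _ (he i) (th0_inO j)).
rewrite -kappa_norm_rsin; apply: (Wkappa_le_coupling qc); apply: le_trans hq _.
have KS : K * \sum_(n < L) L1 fbar (Delta pi0 th0 (@mwt R G) (@matom R G) n) <= K * S * eps.
  by rewrite -mulrA ler_wpM2l ?(ltW K0)// mulr_suml; apply: ler_sum => n _.
set T1 := \sum_j `|_ - _| in dom.
have T10 : 0 <= T1 by exact: sumr_ge0.
set T2 := \sum_i _ in dom.
have T2le : \sum_i @mwt R G i * dkappa_pow kappa (matom i) (@matom R G0 (J i)) <= T2.
  apply: ler_sum => i _; rewrite ler_wpM2l//; apply: dkappa_le_E.
  exact: small_le del11 (hJ1 i).
have T20 : 0 <= T2 by apply: sumr_ge0 => i _; rewrite mulr_ge0.
have T12 : T1 + T2 <= K * S * eps := le_trans dom KS.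
apply: le_trans (lerD T2le (lexx _)) _.
rewrite -/T1 [leRHS]mulrDl mul1r -[_ * _ * eps]mulrA.
have h1 : M * T1 <= M * (K * S * eps) by rewrite ler_wpM2l// (le_trans _ T12)// lerDl.
have h2 : T2 <= K * S * eps by rewrite (le_trans _ T12)// lerDr.
by rewrite mulrDl mul1r; lra.
Qed.

End DistanceFromAffinity.

(** * Likelihood ratios over a mesh of parameters *)

Section GaussianRatio.
Variable R : realType.

(** The three summands of the exponent pay, in order, for the normalising factor, the change of
    variance under the squared residual, and the change of mean. *)
Lemma gauss_ratio (y m m' v v' h vmin L C : R) : 0 < vmin -> vmin <= v -> vmin <= v' ->
  0 <= h -> 0 <= C -> `|v - v'| <= h -> `|m - m'| <= C * h -> `|y - m| <= L -> `|y - m'| <= L ->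
  gauss y m' (Num.sqrt v') <=
  gauss y m (Num.sqrt v) * expR (h * (vmin^-1 + L ^+ 2 / vmin ^+ 2 + C * L / vmin)).
Proof.
move=> vm0 vv vv' h0 C0 dv dm ym ym'.
have v0 : 0 < v := lt_le_trans vm0 vv.
have v'0 : 0 < v' := lt_le_trans vm0 vv'.
have L0 : 0 <= L := le_trans (normr_ge0 _) ym.
have sv : 0 < Num.sqrt v by rewrite sqrtr_gt0.
have sv' : 0 < Num.sqrt v' by rewrite sqrtr_gt0.
have spi : 0 < Num.sqrt (2 * pi : R) by rewrite sqrtr_gt0 mulr_gt0// pi_gt0.
have -> : expR (h * (vmin^-1 + L ^+ 2 / vmin ^+ 2 + C * L / vmin)) =
    expR (h / vmin) * expR (h * (L ^+ 2 / vmin ^+ 2 + C * L / vmin)).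
  by rewrite -expRD; congr expR; rewrite -addrA mulrDr.
rewrite /gauss !sqr_sqrtr ?(ltW v0) ?(ltW v'0)// mulrACA.
apply: ler_pM; rewrite ?expR_ge0//.
- have hv : v <= v' * expR (h / vmin) ^+ 2.
    have e1 : 1 + h / vmin <= expR (h / vmin) by exact: expR_ge1Dx.
    have hp : 0 <= h / vmin by rewrite divr_ge0// ltW.
    apply: le_trans (_ : v' * (1 + h / vmin) <= _).
      have : h <= v' * (h / vmin).
        by rewrite mulrCA ler_peMr// ler_pdivlMr// mul1r.
      by move: dv; rewrite ler_norml mulrDr mulr1 => /andP[_]; lra.
    rewrite ler_pM2l//; apply: le_trans e1 _; rewrite expr2 ler_peMr ?expR_ge0//.
    by rewrite -[leLHS]expR0 ler_expR.
  have sqv : Num.sqrt v <= Num.sqrt v' * expR (h / vmin).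
    rewrite -[X in _ * X]gtr0_norm ?expR_gt0// -sqrtr_sqr -sqrtrM ?(ltW v'0)//.
    exact: ler_wsqrtr.
  rewrite ler_pdivlMl ?mulr_gt0// ler_pdivrMr ?mulr_gt0//.
  by rewrite mulrA ler_pM2r// mulrC.
rewrite -expRD ler_expR -subr_ge0.
set D := (X in 0 <= X).
have -> : D = h * (L ^+ 2 / vmin ^+ 2) - (y - m) ^+ 2 * ((v' - v) / (2 * v * v')) +
   (h * (C * L / vmin) - (m' - m) * ((y - m) + (y - m')) / (2 * v')).
  by rewrite /D; field; rewrite !gt_eqF.
have iv (u : R) : vmin <= u -> u^-1 <= vmin^-1.
  by move=> vu; rewrite lef_pV2 ?posrE// (lt_le_trans vm0).
apply: addr_ge0; rewrite subr_ge0; apply: le_trans (ler_norm _) _.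
  rewrite normrM mulrCA; apply: ler_pM => //.
    by rewrite normrX lerXn2r ?nnegrE.
  rewrite normrM distrC; apply: ler_pM => //.
  rewrite gtr0_norm ?invr_gt0 ?mulr_gt0// lef_pV2 ?posrE ?mulr_gt0 ?exprn_gt0// expr2.
  have vvp : 0 < v * v' by rewrite mulr_gt0.
  have := ler_pM (ltW vm0) (ltW vm0) vv vv'; rewrite -mulrA; lra.
rewrite -mulrA normrM.
apply: le_trans (_ : (C * h) * (2 * L * (2 * vmin)^-1) <= _); last first.
  by rewrite le_eqVlt; apply/orP; left; apply/eqP; field; rewrite gt_eqF.
apply: ler_pM => //; first by rewrite distrC.
rewrite normrM; apply: ler_pM => //.
  by rewrite mulr_natl mulr2n (le_trans (ler_normD _ _))// lerD.
rewrite gtr0_norm ?invr_gt0 ?mulr_gt0// lef_pV2 ?posrE ?mulr_gt0//.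
by rewrite ler_pM2l.
Qed.
End GaussianRatio.

(** * Cells of the parameter mesh *)

Section Cells.
Variables (R : realType) (Xs : set R) (tau1 tau2 : R) (Om2 : set R).
Hypotheses (Xs_compact : compact Xs) (tau1_gt0 : 0 < tau1) (tau2_gt0 : 0 < tau2).
Hypotheses (Om2_compact : compact Om2) (Om2_gt0 : Om2 `<=` [set x | 0 < x]).
Local Notation D := (R * R * R)%type.
Implicit Types (G : mixmeas R).

Lemma Om2_away_from0 : exists2 vmin : R, 0 < vmin & forall v, Om2 v -> vmin <= v.
Proof.
have cl : closed Om2 by exact: compact_closed.
have : \forall v \near (0 : R), (~` Om2) v.
  apply: open_nbhs_nbhs; split; first exact: closed_openC.
  by move=> /Om2_gt0 /=; rewrite ltxx.
move=> /nbhs_ballP[r /= r0 hr]; exists r => // v Ov; rewrite leNgt; apply/negP => vr.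
by apply: (hr v) => //; rewrite /ball/= sub0r normrN gtr0_norm//; exact: Om2_gt0.
Qed.

(** Padding with weight zero indexes mixtures with different numbers of atoms by the same range. *)
Definition weight_at G (i : nat) : R := if insub i is Some i' then @mwt R G i' else 0.
Definition atom_at G (i : nat) : D := if insub i is Some i' then @matom R G i' else (0, 0, 0).

Lemma gmix_nat G k x y : (mnum G <= k)%N -> gmix G x y =
  \sum_(i < k) weight_at G i * gauss y (h1 x (atom_at G i).1) (h2 x (atom_at G i).2).
Proof.
move=> mk; rewrite [RHS](bigID (fun i : 'I_k => (i < mnum G)%N))/= [X in _ + X]big1 ?addr0; last first.
  by move=> i im; rewrite /weight_at insubN// mul0r.
pose F i := weight_at G i * gauss y (h1 x (atom_at G i).1) (h2 x (atom_at G i).2).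
rewrite -(big_ord_widen k F mk); apply: eq_bigr => i _.
by rewrite /F /weight_at /atom_at valK.
Qed.

Definition coord G (i c : nat) : R :=
  match c with
  | 0 => weight_at G i
  | 1 => (atom_at G i).1.1
  | 2 => (atom_at G i).1.2
  | _ => (atom_at G i).2
  end.

(** The number of atoms is part of the cell, so that two mixtures of one cell are compared atom by
    atom and padding never meets a genuine atom. *)
Definition cell k N (M : R) G : 'I_k.+1 * {ffun 'I_k * 'I_4 -> 'I_N.+1} :=
  (inord (mnum G), [ffun p : 'I_k * 'I_4 => inord (Num.truncn (coord G p.1 p.2 * M))]).

Lemma cell_coord k N (M V : R) G G' : (mnum G <= k)%N -> (mnum G' <= k)%N -> 0 < M ->
  (forall i c, 0 <= coord G i c <= V) -> (forall i c, 0 <= coord G' i c <= V) ->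
  (Num.truncn (V * M) <= N)%N -> cell k N M G = cell k N M G' ->
  mnum G = mnum G' /\ forall i c, (i < k)%N -> (c < 4)%N -> `|coord G i c - coord G' i c| <= M^-1.
Proof.
move=> mk mk' M0 hG hG' VN [e1 e2]; split.
  by have := congr1 (@nat_of_ord _) e1; rewrite !inordK.
move=> i c ik c4.
have /(congr1 (@nat_of_ord _)) := congr1 (fun f : {ffun 'I_k * 'I_4 -> 'I_N.+1} => f (Ordinal ik, Ordinal c4)) e2.
rewrite !ffunE/= !inordK; last 2 first.
- rewrite ltnS (leq_trans _ VN)// le_truncn// ler_pM2r//.
  by have /andP[] := hG' i c.
- rewrite ltnS (leq_trans _ VN)// le_truncn// ler_pM2r//.
  by have /andP[] := hG i c.
set u := coord G i c; set u' := coord G' i c => e3.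
have u0 : 0 <= u * M by rewrite mulr_ge0 ?(ltW M0)//; have /andP[] := hG i c.
have u'0 : 0 <= u' * M by rewrite mulr_ge0 ?(ltW M0)//; have /andP[] := hG' i c.
have /andP[a1 a2] := truncn_itv u0.
have /andP[b1 b2] := truncn_itv u'0.
rewrite e3 -natr1 in a1 a2; rewrite -natr1 in b2.
rewrite -[M^-1]mul1r ler_pdivlMr// -[X in _ * X <= _]gtr0_norm// -normrM mulrBl ler_norml.
by apply/andP; split; lra.
Qed.

Lemma card_cell k N : #|{: 'I_k.+1 * {ffun 'I_k * 'I_4 -> 'I_N.+1}}| = (k.+1 * N.+1 ^ (k * 4))%N.
Proof. by rewrite card_prod card_ffun card_prod !card_ord. Qed.

Lemma coord_bounded k cbar0 : 0 < cbar0 -> exists2 V : R, 0 < V & forall G i c,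
  inOkc tau1 tau2 Om2 k cbar0 G -> 0 <= coord G i c <= V.
Proof.
move=> c0; have [V V1 hV] := support_bounded Om2_compact.
have V0 : 0 <= V := le_trans ler01 V1.
exists (1 + tau1 + tau2 + V); first by rewrite !addr_gt0// (lt_le_trans _ V1).
move=> G i c GO; have [w0 w1 v0] := inOkc_proper Om2_gt0 c0 GO; have [_ _ _ _ he] := GO.
have t1 := ltW tau1_gt0; have t2 := ltW tau2_gt0.
rewrite /coord /weight_at /atom_at; case: insubP => [i' _ _|_].
  have [/andP[a0 a1] /andP[b0 b1] /hV] := he i'; rewrite ler_norml => /andP[_ v1].
  have := w0 i'; have : @mwt R G i' <= 1 by rewrite -w1 (bigD1 i')//= lerDl; exact: sumr_ge0.
  have := v0 i'; case: c => [|[|[|c]]] h1 h2 h3; apply/andP; split; lra.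
by case: c => [|[|[|c]]]; rewrite /= lexx/=; lra.
Qed.

(* On a mesh [n^-3], log-densities at [|y| <= n] vary by [O(1 / n)] within a cell, so that
   log-likelihoods of [n] points vary by [O(1)]. *)
Lemma gmix_cell_ratio k cbar0 (V : R) : 0 < cbar0 -> (forall G i c,
    inOkc tau1 tau2 Om2 k cbar0 G -> 0 <= coord G i c <= V) ->
  exists2 K : R, 0 <= K & forall n N G G' x y, (0 < n)%N ->
    inOkc tau1 tau2 Om2 k cbar0 G -> inOkc tau1 tau2 Om2 k cbar0 G' ->
    (Num.truncn (V * n%:R ^+ 3) <= N)%N -> cell k N (n%:R ^+ 3) G = cell k N (n%:R ^+ 3) G' ->
    Xs x -> `|y| <= n%:R -> gmix G' x y <= gmix G x y * expR (K / n%:R).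
Proof.
move=> c0 hV.
have [vmin vm0 hvm] := Om2_away_from0.
have [B B1 hB] := support_bounded Xs_compact.
have B0 : 0 <= B := le_trans ler01 B1.
pose T := tau1 + tau2 * B.
have T0 : 0 <= T by rewrite addr_ge0 ?mulr_ge0// ltW.
pose C := (1 + B) * (2 * T).
have C0 : 0 <= C by rewrite !mulr_ge0// addr_ge0.
pose L := 1 + T ^+ 2.
have L0 : 0 <= L by rewrite addr_ge0// exprn_ge0.
pose K1 := vmin^-1 + L ^+ 2 / vmin ^+ 2 + C * L / vmin.
have K10 : 0 <= K1.
  have vm := ltW vm0.
  have ? : 0 <= vmin^-1 by rewrite invr_ge0.
  by apply: addr_ge0; [apply: addr_ge0 => //|]; apply: divr_ge0 => //;
    [exact: exprn_ge0|exact: exprn_ge0|exact: mulr_ge0].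
exists (cbar0^-1 + K1); first by rewrite addr_ge0 ?invr_ge0 ?(ltW c0).
move=> n N G G' x y n0 GO GO' VN cellE Xx yn.
have [mk _ hw _ he] := GO; have [mk' _ hw' _ he'] := GO'.
have n1 : 1 <= n%:R :> R by rewrite ler1n.
have np : 0 < n%:R :> R by rewrite ltr0n.
have M0 : 0 < n%:R ^+ 3 :> R by rewrite exprn_gt0.
have [mE hc] := cell_coord mk mk' M0 (fun i c => hV G i c GO) (fun i c => hV G' i c GO') VN cellE.
rewrite (gmix_nat _ _ mk) (gmix_nat _ _ mk') mulr_suml; apply: ler_sum => i _.
set h := (n%:R ^+ 3)^-1 in hc.
have h0 : 0 <= h by rewrite invr_ge0 ltW.
have := hc i 0%N (ltn_ord i) isT; have := hc i 1%N (ltn_ord i) isT.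
have := hc i 2%N (ltn_ord i) isT; have := hc i 3%N (ltn_ord i) isT.
rewrite /= /weight_at /atom_at; case: insubP => [j ji jE|nj]; last first.
  by rewrite insubN ?mul0r// -mE.
case: insubP => [j' ji' j'E|]; last by rewrite -mE ji.
have [/andP[a0 a1] /andP[b0 b1] /hvm v1] := he j.
have [/andP[a0' a1'] /andP[b0' b1'] /hvm v1'] := he' j'.
move=> dv db da dw.
have xB := hB x Xx.
have lin (a b : R) : 0 <= a <= tau1 -> 0 <= b <= tau2 -> `|a + b * x| <= T.
  move=> /andP[p0 p1] /andP[q0 q1]; apply: le_trans (ler_normD _ _) _.
  by rewrite normrM (ger0_norm p0) (ger0_norm q0); apply: lerD => //; apply: ler_pM.
have l1 : `|(matom j).1.1 + (matom j).1.2 * x| <= T by apply: lin; apply/andP.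
have l2 : `|(matom j').1.1 + (matom j').1.2 * x| <= T by apply: lin; apply/andP.
have mu (z : R) : `|z| <= T -> `|y - z ^+ 2| <= n%:R * L.
  move=> zT; apply: le_trans (ler_normB _ _) _; rewrite /L mulrDr mulr1; apply: lerD => //.
  by rewrite normrX (le_trans (lerXn2r 2 _ _ zT)) ?nnegrE// ler_peMl// exprn_ge0.
have dmu : `|h1 x (matom j).1 - h1 x (matom j').1| <= C * h.
  rewrite /h1 subr_sqr normrM /C mulrAC; apply: ler_pM => //; last first.
    by rewrite mulr_natl mulr2n (le_trans (ler_normD _ _))// lerD.
  rewrite (_ : _ - _ = ((matom j).1.1 - (matom j').1.1) + ((matom j).1.2 - (matom j').1.2) * x); last by ring.
  by rewrite (le_trans (ler_normD _ _))// [leRHS]mulrDl mul1r lerD// normrM [B * _]mulrC ler_pM.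
have gr := gauss_ratio vm0 v1 v1' h0 C0 dv dmu (mu _ l1) (mu _ l2).
(* Weights are at least [cbar0], which turns the additive change [h] into a relative one. *)
have wr : mwt j' <= mwt j * expR (h / cbar0).
  apply: le_trans (_ : mwt j * (1 + h / cbar0) <= _); last first.
    by rewrite ler_wpM2l ?expR_ge1Dx// (le_trans (ltW c0)).
  rewrite mulrDr mulr1 mulrCA.
  have : h * 1 <= h * (mwt j / cbar0) by rewrite ler_wpM2l// ler_pdivlMr// mul1r.
  by move: dw; rewrite mulr1 ler_norml => /andP[]; lra.
have gp (m v : R) : 0 <= gauss y m (h2 x v).
  by rewrite mulr_ge0 ?expR_ge0// invr_ge0 mulr_ge0// sqrtr_ge0.
apply: le_trans (ler_pM _ _ wr gr) _ => //; first exact: le_trans (ltW c0) (hw' _).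
  exact: gp.
rewrite mulrACA ler_wpM2l//.
  by apply: mulr_ge0; [exact: le_trans (ltW c0) (hw _)|exact: gp].
rewrite -expRD ler_expR.
have e1 : h <= n%:R^-1.
  by rewrite lef_pV2 ?posrE// ler_eXnr.
(* Residuals reach [n * L], so their squares cost a factor of order n^2; the mesh n^-3 leaves 1 /
   n. *)
have e2 : h * n%:R ^+ 2 = n%:R^-1 by rewrite /h; field; rewrite gt_eqF.
have n2 : 1 <= n%:R ^+ 2 :> R by rewrite exprn_ege1.
apply: le_trans (_ : h * n%:R ^+ 2 * (cbar0^-1 + K1) <= _); last by rewrite e2 mulrC.
rewrite -mulrDr -[leRHS]mulrA; apply: ler_wpM2l => //; rewrite /K1.
clear K10; clearbody C L.
rewrite [leRHS]mulrDr [X in _ <= _ + X]mulrDr [X in _ <= _ + (X + _)]mulrDr.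
have nn2 : n%:R <= n%:R ^+ 2 :> R by rewrite ler_eXnr.
apply: lerD; first by rewrite ler_peMl// invr_ge0 ltW.
apply: lerD; first apply: lerD.
- by rewrite ler_peMl// invr_ge0 ltW.
- by rewrite [leRHS]mulrA exprMn lexx.
- rewrite !mulrA; apply: ler_wpM2r; first by rewrite invr_ge0 ltW.
  by apply: ler_wpM2r => //; rewrite mulrC; apply: ler_wpM2r.
Qed.
End Cells.

(** * Maximum likelihood *)

Lemma measure_bigsetU_le d (T : measurableType d) (R : realType) (P : probability T R)
    (I : Type) (s : seq I) (F : I -> set T) : (forall i, measurable (F i)) ->
  measurable (\big[setU/set0]_(i <- s) F i) /\
  (P (\big[setU/set0]_(i <- s) F i) <= \sum_(i <- s) P (F i))%E.
Proof.
move=> mF; elim: s => [|i s [IHm IHle]]; first by rewrite !big_nil measure0.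
rewrite !big_cons; split; first exact: measurableU.
by apply: (le_trans (measureU2 P (mF i) IHm)); rewrite leeD2l.
Qed.

Section Sample.
Variables (R : realType) (fbar : R -> R) (g0 : R -> R -> R).
Hypothesis fbar_ge0 : forall x, 0 <= fbar x.
Hypothesis fbar_meas : measurable_fun [set: R] fbar.
Hypothesis g0_ge0 : forall x y, 0 <= g0 x y.
Hypothesis g0_meas : measurable_fun [set: R * R] (fun z : R * R => g0 z.1 z.2).
Local Notation leb := (@lebesgue_measure R).
Context d (T : measurableType d) (P : probability T R) (X Y : nat -> T -> R).
Hypotheses (mX : forall j, measurable_fun setT (X j)) (mY : forall j, measurable_fun setT (Y j)).
Hypothesis law : iid_law fbar g0 P X Y.

(** A sample of size [j + 1] with all coordinates but the last unconstrained. *)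
Lemma marginal_law j (A B : set R) : measurable A -> measurable B ->
  P (X j @^-1` A `&` Y j @^-1` B) = rect_law fbar g0 A B.
Proof.
move=> mA mB.
pose pick (C : set R) i := if i == j then C else setT.
have mp C i : measurable C -> measurable (pick C i) by rewrite /pick; case: ifP.
have := law j.+1 (fun i => mp A i mA) (fun i => mp B i mB).
have pj C : pick C j = C by rewrite /pick eqxx.
rewrite (bigD1 ord_max)//= !pj big1 ?mule1 => [<-|i].
  congr (P _); apply/seteqP; split => [t [hA hB] i /= _|t /(_ j (ltnSn j))].
    by rewrite /pick; case: eqP => [->|].
  by rewrite !pj.
rewrite /pick -val_eqE/= => /negPf ->.
by rewrite (rect_lawT law).
Qed.

Lemma product_markov (F : R -> R -> R) (rho a : R) n : (forall x y, 0 <= F x y) ->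
  measurable_fun [set: R * R] (fun z : R * R => F z.1 z.2) ->
  (\int[leb]_x ((fbar x)%:E * \int[leb]_y (g0 x y * F x y)%:E) = rho%:E)%E -> 0 < a ->
  let S := [set t | a <= \prod_(i < n) F (X i t) (Y i t)] in
  measurable S /\ (P S <= (rho ^+ n / a)%:E)%E.
Proof.
move=> F0 mF Fint a0 S.
have mprod : measurable_fun setT (fun t => \prod_(i < n) F (X i t) (Y i t)).
  apply: measurable_prod => i _.
  by apply: (measurableT_comp mF (measurable_fun_pair (mX i) (mY i))).
have mS : measurable S.
  rewrite (_ : S = (fun t => \prod_(i < n) F (X i t) (Y i t)) @^-1` `[a, +oo[).
    by rewrite -[X in measurable X]setTI; exact: mprod.
  by apply/seteqP; split=> t /=; rewrite in_itv/= andbT.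
split=> //.
have prod0 t : 0 <= \prod_(i < n) F (X i t) (Y i t) by exact: prodr_ge0.
rewrite EFinM -(expectation_prod fbar_ge0 fbar_meas g0_ge0 g0_meas mX mY law F0 mF Fint).
rewrite lee_pdivlMr// muleC -integral_cst//.
apply: le_trans (_ : \int[P]_(t in S) (\prod_(i < n) F (X i t) (Y i t))%:E <= _)%E.
  apply: ge0_le_integral => //.
  - by move=> t _; rewrite lee_fin ltW.
  - by apply/measurable_EFinP; apply: measurable_funTS.
apply: ge0_subset_integral => //; first exact/measurable_EFinP.
by move=> t _; rewrite lee_fin.
Qed.
End Sample.

Section MaximumLikelihood.
Variables (R : realType) (Xs : set R) (fbar : R -> R).
Hypotheses (Xs_compact : compact Xs) (fbar_ge0 : forall x, 0 <= fbar x).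
Hypothesis fbar_out : forall x, ~ Xs x -> fbar x = 0.
Hypothesis fbar_meas : measurable_fun setT fbar.
Hypothesis fbar_int : (\int[@lebesgue_measure R]_(x in Xs) (fbar x)%:E = 1)%E.
Local Notation leb := (@lebesgue_measure R).
Implicit Types (G : mixmeas R).
Variable G0 : mixmeas R.
Hypothesis G0_proper : proper G0.

Let g0_ge0 x y : 0 <= gmix G0 x y. Proof. by rewrite ltW// gmix_gt0. Qed.

(* [sqrt (g_G / g_G0)]. *)
Definition root_ratio G (x y : R) : R := expR ((ln (gmix G x y) - ln (gmix G0 x y)) / 2).

Lemma measurable_root_ratio G :
  measurable_fun [set: R * R] (fun z : R * R => root_ratio G z.1 z.2).
Proof.
apply: (measurableT_comp (@measurable_expR R)); apply: measurable_funM => //.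
by apply: measurable_funB; apply: (measurableT_comp (@measurable_ln R)); exact: measurable_gmix.
Qed.

Lemma integral_root_ratio G : proper G ->
  (\int[leb]_x ((fbar x)%:E * \int[leb]_y (gmix G0 x y * root_ratio G x y)%:E) =
   affinity fbar G G0)%E.
Proof.
move=> pG; apply: eq_integral => x _; congr (_ * _)%E; apply: eq_integral => y _.
have g0 := gmix_gt0 x y pG; have g00 := gmix_gt0 x y G0_proper.
have E0 : gmix G0 x y = expR (ln (gmix G0 x y)) by rewrite lnK.
have E1 : gmix G x y = expR (ln (gmix G x y)) by rewrite lnK.
rewrite /root_ratio; congr EFin; set u := ln (gmix G x y) in E1 *; set v := ln (gmix G0 x y) in E0 *.
rewrite E0 E1 -!expRD.
rewrite (_ : v + (u - v) / 2 = (u + v) / 2); last by field.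
by rewrite {2}(splitr (u + v)) expRD -expr2 sqrtr_sqr gtr0_norm// expR_gt0.
Qed.

Let mgf_sum x := MG 1 x G0 + MG (-1) x G0.
Definition tail_mass : R := L1 fbar mgf_sum.

Variable (n : nat).
Hypothesis n_gt0 : (0 < n)%N.

Context d (T : measurableType d) (P : probability T R) (X Y : nat -> T -> R).
Hypotheses (mX : forall j, measurable_fun setT (X j)) (mY : forall j, measurable_fun setT (Y j)).
Hypothesis law : iid_law fbar (gmix G0) P X Y.

(** A Chernoff bound at exponent 1/2: the product of root ratios has mean affinity^n, at most (1 - A
    log n / n)^n <= n^-A. The margin [K] is kept for the variation of the likelihood inside a
    cell. *)
Lemma chernoff_cell G (A K : R) : proper G ->
  ~ ((1 - A * ln n%:R / n%:R)%:E <= affinity fbar G G0)%E ->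
  exists S, [/\ measurable S, (P S <= (expR (K / 2) * n%:R `^ (- A))%:E)%E &
    forall t, ~ S t ->
      \sum_(i < n) ln (gmix G (X i t) (Y i t)) + K < \sum_(i < n) ln (gmix G0 (X i t) (Y i t))].
Proof.
move=> pG /negP; rewrite -ltNge => aff.
have n_pos : 0 < n%:R :> R by rewrite ltr0n.
set delta := A * ln n%:R / n%:R in aff.
have aff0 : (0 <= affinity fbar G G0)%E.
  by apply: integral_ge0 => x _; rewrite mule_ge0 ?lee_fin// affinity_at_ge0.
have affin : affinity fbar G G0 \is a fin_num.
  by rewrite ge0_fin_numE//; apply: lt_trans aff _; exact: ltry.
pose rho := fine (affinity fbar G G0).
have rhoE : (affinity fbar G G0 = rho%:E)%E by rewrite fineK.
have rho0 : 0 <= rho by exact: fine_ge0.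
have rho1 : rho <= expR (- delta).
  rewrite (le_trans _ (expR_ge1Dx _))//.
  by move: aff; rewrite rhoE lte_fin => /ltW.
have rhon : rho ^+ n <= n%:R `^ (- A).
  rewrite /powR gt_eqF// (le_trans (lerXn2r n _ _ rho1)) ?nnegrE ?expR_ge0//.
  rewrite -expRM_natl ler_expR /delta le_eqVlt; apply/orP; left; apply/eqP.
  by field; rewrite gt_eqF.
have Fint := integral_root_ratio pG; rewrite rhoE in Fint.
(* [root_ratio] halves log-likelihood differences, so a deficit of [K] corresponds to the level
   [expR (- (K / 2))]. *)
have [mS PS] := product_markov fbar_ge0 fbar_meas g0_ge0 (measurable_gmix G0) mX mY law n
  (fun x y => expR_ge0 _) (measurable_root_ratio G) Fint (expR_gt0 (- (K / 2))).
eexists; split; [exact: mS| |].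
  apply: le_trans PS _; rewrite lee_fin -expRN opprK mulrC ler_wpM2l// expR_ge0.
move=> t /= /negP; rewrite -ltNge /root_ratio -expR_sum ltr_expR -mulr_suml sumrB.
by lra.
Qed.

(** exp(|y|) is at most exp(y) + exp(-y), whose mean under G_0 is [tail_mass]; Markov's inequality
    at level exp(n) gives the bound. The covariate leaves [Xs] with probability zero. *)
Lemma sample_tail j :
  exists S, [/\ measurable S, (P S <= (tail_mass * expR (- n%:R))%:E)%E &
    forall t, ~ S t -> Xs (X j t) /\ `|Y j t| <= n%:R].
Proof.
have mXs : measurable Xs by apply: closed_measurable; exact: compact_closed.
pose F (x y : R) := expR (1 * y) + expR (-1 * y).
have tM l : tame Xs (fun x => MG l x G0).
  by apply: tame_sum => i; apply: tameM; [exact: tame_cst|exact: tame_hexp].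
have tmg : tame Xs mgf_sum by apply: tameD.
have mF : measurable_fun [set: R * R] (fun z : R * R => F z.1 z.2).
  by apply: measurable_funD; apply: (measurableT_comp (@measurable_expR R)); apply: measurable_funM.
have F0 x y : 0 <= F x y by rewrite addr_ge0// expR_ge0.
have mgf_sum_ge0 x : 0 <= mgf_sum x.
  by have [w0 _ _] := G0_proper; rewrite addr_ge0// sumr_ge0// => i _; rewrite mulr_ge0// expR_ge0.
have Fint : (\int[leb]_x ((fbar x)%:E * \int[leb]_y (gmix G0 x y * F x y)%:E) =
    (tail_mass)%:E)%E.
  rewrite (L1E fbar_ge0 fbar_out fbar_meas fbar_int tmg).
  apply: eq_integral => x _; rewrite EFinM ger0_norm ?mgf_sum_ge0//; congr (_ * _)%E.
  have mex (l : R) : measurable_fun [set: R] (fun y => expR (l * y) * gmix G0 x y).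
    apply: measurable_funM; last exact: measurable_gmix2.
    by apply: (measurableT_comp (@measurable_expR R)); apply: measurable_funM.
  rewrite /mgf_sum EFinD -!integral_gmix_mgf// -ge0_integralD//.
  all: try by move=> y _; rewrite lee_fin mulr_ge0 ?expR_ge0.
  all: try by apply/measurable_EFinP; exact: mex.
  by apply: eq_integral => y _; rewrite -EFinD mulrDr ![gmix _ _ _ * _]mulrC.
pose B := [set y : R | n%:R < `|y|].
have mB : measurable B.
  rewrite (_ : B = (@Num.norm R R) @^-1` `]n%:R, +oo[); last first.
    by apply/seteqP; split=> y; rewrite /B/= in_itv/= andbT.
  rewrite -[X in measurable X]setTI; exact: normr_measurable.
pose Sx := X j @^-1` (~` Xs); pose Sy := Y j @^-1` B.
have mSx : measurable Sx by rewrite -[Sx]setTI; apply: mX => //; exact: measurableC.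
have mSy : measurable Sy by rewrite -[Sy]setTI; exact: mY.
have PSx : P Sx = 0%E.
  have := marginal_law law j (measurableC mXs) measurableT.
  rewrite preimage_setT setIT => ->.
  by apply: integral0_eq => x Xx; rewrite fbar_out// mul0e.
have PSy : (P Sy <= (tail_mass * expR (- n%:R))%:E)%E.
  (* Products run over initial segments of the sample, so the inequality is taken for the
     observation 0 and carried to [j] by the equality of marginal laws. *)
  have [mS PS] := product_markov fbar_ge0 fbar_meas g0_ge0 (measurable_gmix G0) mX mY law 1
    F0 mF Fint (expR_gt0 n%:R).
  have mT := @measurableT _ R.
  have := marginal_law law j mT mB.
  have := marginal_law law 0 mT mB.
  rewrite !preimage_setT !setTI => E0; rewrite -E0 => ->.
  rewrite expr1 -expRN in PS; apply: le_trans PS; apply: le_measure; rewrite ?inE//.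
    by rewrite -[X in measurable X]setTI; exact: mY.
  move=> t; rewrite /= big_ord1 /B/= => nY.
  rewrite /F mul1r mulN1r; have [y0|y0] := leP 0 (Y 0%N t).
    rewrite ger0_norm// in nY.
    by rewrite (le_trans (_ : _ <= expR (Y 0%N t))) ?ler_expR ?(ltW nY)// lerDl expR_ge0.
  rewrite ltr0_norm// in nY.
  by rewrite (le_trans (_ : _ <= expR (- Y 0%N t))) ?ler_expR ?(ltW nY)// lerDr expR_ge0.
exists (Sx `|` Sy); split; first exact: measurableU.
  have PSx0 : (P Sx <= 0)%E by rewrite PSx.
  by apply: (le_trans (measureU2 P mSx mSy)); rewrite -[leRHS]add0e; exact: (leeD PSx0 PSy).
move=> t /not_orP[nx ny]; split; first exact: contrapT.
by rewrite leNgt; apply/negP.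
Qed.

End MaximumLikelihood.

(** * Affinity of the maximum likelihood estimator *)

Section MLEAffinity.
Variables (R : realType) (Xs : set R) (fbar : R -> R).
Hypotheses (Xs_compact : compact Xs) (fbar_ge0 : forall x, 0 <= fbar x).
Hypothesis fbar_out : forall x, ~ Xs x -> fbar x = 0.
Hypothesis fbar_meas : measurable_fun setT fbar.
Hypothesis fbar_int : (\int[@lebesgue_measure R]_(x in Xs) (fbar x)%:E = 1)%E.
Variables (tau1 tau2 : R) (Om2 : set R).
Hypotheses (tau1_gt0 : 0 < tau1) (tau2_gt0 : 0 < tau2).
Hypotheses (Om2_compact : compact Om2) (Om2_gt0 : Om2 `<=` [set x | 0 < x]).
Implicit Types (G : mixmeas R).
Variables (k : nat) (cbar0 : R) (G0 : mixmeas R).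
Hypotheses (cbar0_gt0 : 0 < cbar0) (G0_in : inOkc tau1 tau2 Om2 k cbar0 G0).
Local Notation inO := (inOkc tau1 tau2 Om2 k cbar0).

Let G0_proper : proper G0. Proof. exact: inOkc_proper G0_in. Qed.

(* [12 k = 3 * 4 k]: there are [O(n^(3 * 4 k))] cells, and one more power of [n] is the
   probability bound. *)
Definition rate_exponent : nat := (12 * k).+1.

(** The [n] tail events have total probability of order n exp(-n), which this turns into a multiple
    of 1 / n. *)
Lemma nat_expR_decay (n : nat) : n%:R ^+ 2 * expR (- n%:R) <= 4 :> R.
Proof.
have h : (n%:R / 2) ^+ 2 <= expR (n%:R : R).
  rewrite [X in expR X](splitr) expRD -expr2 lerXn2r ?nnegrE ?expR_ge0 ?divr_ge0//.
  by apply: le_trans (expR_ge1Dx _); lra.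
rewrite expRN ler_pdivrMr ?expR_gt0//; move: h; rewrite exprMn; lra.
Qed.

(** Off the exceptional event every admissible mixture of too small an affinity has a smaller
    likelihood than G_0, which is itself a competitor, so it is no maximizer. The constant is chosen
    before the probability space and the sample. *)
Lemma mle_affinity : exists2 C : R, 0 < C &
  forall (d : measure_display) (T : measurableType d) (P : probability T R) (X Y : nat -> T -> R),
    (forall j, measurable_fun setT (X j)) -> (forall j, measurable_fun setT (Y j)) ->
    iid_law fbar (gmix G0) P X Y ->
  forall n, (0 < n)%N -> exists E : set T, [/\ measurable E, (P E <= (C / n%:R)%:E)%E &
    forall t G, ~ E t -> is_MLE tau1 tau2 Om2 k cbar0 G (X^~ t) (Y^~ t) n ->
      ((1 - rate_exponent%:R * ln n%:R / n%:R)%:E <= affinity fbar G G0)%E].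
Proof.
have [V V0 hV] := coord_bounded tau1_gt0 tau2_gt0 Om2_compact Om2_gt0 k cbar0_gt0.
have [K K0 hK] := gmix_cell_ratio Xs_compact tau1_gt0 tau2_gt0 Om2_compact Om2_gt0 cbar0_gt0 hV.
pose Ct := tail_mass fbar G0.
have Ct0 : 0 <= Ct by exact: L1_ge0.
pose C1 : R := k.+1%:R * (V + 1) ^+ (k * 4) * expR (K / 2).
have C10 : 0 < C1 by rewrite !mulr_gt0 ?expR_gt0 ?ltr0n// exprn_gt0// addr_gt0.
exists (C1 + 4 * Ct); first by rewrite ltr_wpDr// mulr_ge0.
move=> d T P X Y mX mY law n n0.
have np : 0 < n%:R :> R by rewrite ltr0n.
have n1 : 1 <= n%:R :> R by rewrite ler1n.
set A : R := rate_exponent%:R.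
pose N := Num.truncn (V * n%:R ^+ 3).
pose bad G := ~ ((1 - A * ln n%:R / n%:R)%:E <= affinity fbar G G0)%E.
have /choice[S hS] : forall c : 'I_k.+1 * {ffun 'I_k * 'I_4 -> 'I_N.+1}, exists S : set T,
    [/\ measurable S, (P S <= (expR (K / 2) * n%:R `^ (- A))%:E)%E &
      forall t G, ~ S t -> inO G -> bad G -> cell k N (n%:R ^+ 3) G = c ->
      (forall j, (j < n)%N -> Xs (X j t) /\ `|Y j t| <= n%:R) ->
      loglik G (X^~ t) (Y^~ t) n < loglik G0 (X^~ t) (Y^~ t) n].
  (* One mixture of small affinity represents its cell, the ratio bound within the cell transferring
     the conclusion to the others; a cell without such a mixture gets the empty event. *)
  move=> c; have [[Gc [Gc_in Gc_bad Gc_cell]]|none] :=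
    pselect (exists G, [/\ inO G, bad G & cell k N (n%:R ^+ 3) G = c]); last first.
    exists set0; split=> //; first by rewrite measure0 lee_fin mulr_ge0 ?expR_ge0 ?powR_ge0.
    by move=> t G _ Gin Gbad Gcell; case: none; exists G.
  have pGc := inOkc_proper Om2_gt0 cbar0_gt0 Gc_in.
  have [S [mS PS nS]] := chernoff_cell fbar_ge0 fbar_meas G0_proper n0 mX mY law K pGc Gc_bad.
  exists S; split=> // t G St Gin Gbad Gcell hXY.
  apply: le_lt_trans (nS t St); rewrite /loglik.
  have -> : K = \sum_(i < n) K / n%:R.
    by rewrite sumr_const card_ord -[RHS]mulr_natr divfK// gt_eqF.
  rewrite -big_split/=; apply: ler_sum => i _.
  have [hX hY] := hXY i (ltn_ord i).
  have pG := inOkc_proper Om2_gt0 cbar0_gt0 Gin.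
  rewrite -[K / _]expRK -lnM ?posrE ?expR_gt0 ?gmix_gt0//.
  rewrite ler_ln ?posrE ?mulr_gt0 ?expR_gt0 ?gmix_gt0//.
  by apply: (hK n N) => //; rewrite Gcell.
have /choice[U hU] := fun j => sample_tail Xs_compact fbar_ge0 fbar_out fbar_meas fbar_int G0_proper n mX mY law j.
have [mS PS] := measure_bigsetU_le P (index_enum _) (fun c => let: And3 h _ _ := hS c in h).
have [mU PU] := @measure_bigsetU_le _ _ _ P _ (index_enum 'I_n) (fun j => U j) (fun j => let: And3 h _ _ := hU j in h).
set ES := \big[setU/set0]_(c <- _) S c in mS PS.
set EU := \big[setU/set0]_(j <- _) U _ in mU PU.
exists (ES `|` EU); split; first exact: measurableU.
  apply: (le_trans (measureU2 P mS mU)); rewrite mulrDl EFinD; apply: leeD.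
    apply: (le_trans PS).
    apply: (@le_trans _ _ (\sum_(c : 'I_k.+1 * {ffun 'I_k * 'I_4 -> 'I_N.+1})
      (expR (K / 2) * n%:R `^ (- A))%:E)%E).
      by apply: lee_sum => c _; have [_ h _] := hS c.
    rewrite sumEFin lee_fin sumr_const card_cell -[leLHS]mulr_natl natrM natrX.
    have VN : N.+1%:R <= (V + 1) * n%:R ^+ 3 :> R.
      rewrite -natr1 mulrDl mul1r; apply: lerD; last by rewrite exprn_ege1.
      have Vn : 0 <= V * n%:R ^+ 3 by rewrite mulr_ge0 ?exprn_ge0// ltW.
      by have /andP[h _] := truncn_itv Vn.
    have VN4 : N.+1%:R ^+ (k * 4) <= (V + 1) ^+ (k * 4) * n%:R ^+ (12 * k) :> R.
      rewrite (_ : 12 * k = 3 * (k * 4))%N; last by lia.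
      rewrite [n%:R ^+ _]exprM -exprMn; apply: lerXn2r => //; rewrite nnegrE//.
      by rewrite mulr_ge0 ?exprn_ge0// addr_ge0// ltW.
    have nA : n%:R ^+ (12 * k) * n%:R `^ (- A) = n%:R^-1 :> R.
      rewrite powRN powR_mulrn// /rate_exponent exprS invfM mulrCA divff ?mulr1//.
      by rewrite gt_eqF// exprn_gt0.
    apply: le_trans (_ : k.+1%:R * ((V + 1) ^+ (k * 4) * n%:R ^+ (12 * k)) *
        (expR (K / 2) * n%:R `^ (- A)) <= _).
      rewrite ler_wpM2r ?mulr_ge0 ?expR_ge0 ?powR_ge0//.
      by rewrite ler_wpM2l.
    by rewrite /C1 -nA le_eqVlt; apply/orP; left; apply/eqP; ring.
  apply: (le_trans PU).
  apply: (@le_trans _ _ (\sum_(j < n) (Ct * expR (- n%:R))%:E)%E).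
    by apply: lee_sum => j _; have [_ h _] := hU j.
  rewrite sumEFin lee_fin sumr_const card_ord -[leLHS]mulr_natl ler_pdivlMr//.
  rewrite (_ : _ * n%:R = Ct * (n%:R ^+ 2 * expR (- n%:R))); last by ring.
  by rewrite [4 * _]mulrC ler_wpM2l// nat_expR_decay.
move=> t G Et [Gin Gmax]; apply: contrapT => Gbad.
have := Gmax _ G0_in; apply/negP; rewrite -ltNge.
have [_ _ h] := hS (cell k N (n%:R ^+ 3) G).
apply: h => //.
  move=> St; apply: Et; left; rewrite /ES.
  by rewrite (bigD1 (cell k N (n%:R ^+ 3) G))//=; left.
move=> j jn; have [_ _ h] := hU j; apply: h => Ut; apply: Et; right.
by rewrite /EU (bigD1 (Ordinal jn))//=; left.
Qed.

End MLEAffinity.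

(** * The rate *)

Lemma ln_le_sqrt (R : realType) (n : nat) : (0 < n)%N -> ln (n%:R : R) <= 2 * Num.sqrt n%:R.
Proof.
move=> n0; have np : 0 < n%:R :> R by rewrite ltr0n.
have sp : 0 < Num.sqrt (n%:R : R) by rewrite sqrtr_gt0.
rewrite -{1}(sqr_sqrtr (ltW np)) expr2 lnM ?posrE// mulr_natl mulr2n.
suff h : ln (Num.sqrt (n%:R : R)) <= Num.sqrt n%:R by rewrite lerD.
rewrite -{1}[Num.sqrt _](subrK 1) addrC (le_trans (le_ln1Dx _))//; last by rewrite gerBl.
by rewrite ltrBrDl subrr.
Qed.

Lemma ln_over_n_small (R : realType) (a : R) : 0 < a ->
  exists N : nat, forall n, (N <= n)%N -> ln n%:R / n%:R <= a.
Proof.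
move=> a0; exists (Num.truncn ((2 / a) ^+ 2)).+1 => n nN.
have n0 : (0 < n)%N by exact: leq_trans nN.
have np : 0 < n%:R :> R by rewrite ltr0n.
have sp : 0 < Num.sqrt (n%:R : R) by rewrite sqrtr_gt0.
have nE : n%:R = Num.sqrt n%:R * Num.sqrt n%:R :> R by rewrite -expr2 sqr_sqrtr// ltW.
have h : 2 / a <= Num.sqrt n%:R.
  rewrite -[leLHS]ger0_norm ?divr_ge0 ?(ltW a0)// -sqrtr_sqr ler_wsqrtr//.
  have q0 : 0 <= (2 / a) ^+ 2 by exact: sqr_ge0.
  have /andP[_ h] := truncn_itv q0.
  by rewrite (le_trans (ltW h))// ler_nat.
rewrite ler_pdivrMr// (le_trans (ln_le_sqrt R n0))// [X in _ <= _ * X]nE mulrA ler_pM2r//.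
by rewrite ler_pdivrMr// mulrC in h.
Qed.

(** The affinity deficit A log n / n of the estimator is read as eps^2, and the r~_sin-th root of a
    multiple of eps is the rate. Maximizers are selected pointwise in the sample space, so the
    deviation set is enclosed in a measurable event. *)
Theorem theorem6 (R : realType) (tau1 tau2 : R) (Om2 : set R) :
  0 < tau1 -> 0 < tau2 -> compact Om2 -> Om2 `<=` [set x | 0 < x] ->
  exists c : R, 0 < c /\
  forall (Xs : set R) (fbar : R -> R),
    compact Xs ->
    (forall x, 0 <= fbar x) -> (forall x, ~ Xs x -> fbar x = 0) ->
    measurable_fun setT fbar ->
    (\int[@lebesgue_measure R]_(x in Xs) (fbar x)%:E = 1)%E ->
  forall (k0 : nat) (pi0 : 'I_k0 -> R) (th0 : 'I_k0 -> (R * R) * R) (k : nat),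
    injective th0 ->
    (forall i, inOmega tau1 tau2 Om2 (th0 i)) ->
    (forall i, 0 < pi0 i) -> \sum_(i < k0) pi0 i = 1 ->
    (* nonlinearity setting II *)
    (exists i, (th0 i).1.1 != 0 /\ (th0 i).1.2 = 0) ->
    (k0 < k)%N ->
    (* \widetilde r is well defined at the relevant points *)
    (forall i, (th0 i).1.1 != 0 -> (th0 i).1.2 = 0 ->
       exists r, rtilde_pred (th0 i).1.1 (k - k0).+1 r) ->
  let G0 := @MixMeas R k0 pi0 th0 in
  let rsin := (\max_(i < k0 | ((th0 i).1.1 != 0)%R && ((th0 i).1.2 == 0)%R)
                 rtilde (th0 i).1.1 (k - k0).+1)%N in
  let kappa := (rsin, 2%N, uphalf rsin) in
  exists C0 : R, 0 < C0 /\
  exists cstar : R, 0 < cstar /\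
  forall cbar0 : R, 0 < cbar0 -> cbar0 <= cstar -> (forall i, cbar0 <= pi0 i) ->
  exists C' : R, 0 < C' /\
  forall (d : measure_display) (T : measurableType d) (P : probability T R)
         (X Y : nat -> T -> R),
    (forall j, measurable_fun setT (X j)) -> (forall j, measurable_fun setT (Y j)) ->
    (* (X_j, Y_j)_j i.i.d. with law p_{G0} *)
    (forall (n : nat) (A B : nat -> set R),
       (forall j, measurable (A j)) -> (forall j, measurable (B j)) ->
       P (\bigcap_(j < n) (X j @^-1` A j `&` Y j @^-1` B j)) =
       (\prod_(j < n) \int[@lebesgue_measure R]_(x in A j)
           ((fbar x)%:E * \int[@lebesgue_measure R]_(y in B j) (gmix G0 x y)%:E))%E) ->
  forall Ghat : nat -> T -> mixmeas R,
    (forall n w, is_MLE tau1 tau2 Om2 k cbar0 (Ghat n w)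
                   (fun j => X j w) (fun j => Y j w) n) ->
  forall n : nat, (0 < n)%N ->
    exists E : set T, measurable E /\
      [set w | C0 * (ln n%:R / n%:R) `^ ((2 * rsin%:R)^-1) < Wkappa kappa (Ghat n w) G0]
        `<=` E /\
      (P E <= (C' * expR (- (c * ln n%:R)))%:E)%E.
Proof.
(* The value 1 of [c] is the spare power of [n] in [rate_exponent]. *)
move=> tau10 tau20 Om2c Om2p; exists 1; split=> // Xs fbar Xsc f0 fout fm fint k0 pi0 th0 k.
move=> th0_inj th0_in pi0_gt0 pi0_sum setII k0k rex G0 rsin kappa.
have [Cd Cd0 hCd] := distance_of_affinity Xsc f0 fout fm fint tau10 tau20 Om2c Om2p
  pi0_gt0 pi0_sum th0_inj th0_in k0k setII rex.
set A : R := (rate_exponent k)%:R.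
have A0 : 0 < A by rewrite ltr0n.
have sA : 0 < Num.sqrt A by rewrite sqrtr_gt0.
exists ((Cd * Num.sqrt A) `^ rsin%:R^-1); split; first by rewrite powR_gt0// mulr_gt0.
exists 1; split=> // cbar0 c0 _ cpi.
have G0_in : inOkc tau1 tau2 Om2 k cbar0 G0 by split=> //; exact: ltnW.
have [eta eta0 heta] := hCd cbar0 c0.
have [C C0 hC] := mle_affinity Xsc f0 fout fm fint tau10 tau20 Om2c Om2p c0 G0_in.
have [N hN] : exists N : nat, forall n, (N <= n)%N -> ln n%:R / n%:R <= eta ^+ 2 / A.
  by apply: ln_over_n_small; rewrite divr_gt0// exprn_gt0.
(* For [n < N + 2] the claimed bound is at least one and the whole space serves as event. The shift
   by 2 also gives [n >= 2] in the other case, hence [ln n > 0]. *)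
exists (C + N.+2%:R); split; first by rewrite addr_gt0.
move=> d T P X Y mX mY law Ghat hMLE n n0.
have np : 0 < n%:R :> R by rewrite ltr0n.
have -> : expR (- (1 * ln n%:R)) = n%:R^-1 :> R by rewrite mul1r expRN lnK.
have [nN|nN] := ltnP n N.+2.
  exists setT; split=> //; split=> //.
  rewrite probability_setT lee_fin ler_pdivlMr// mul1r.
  by rewrite (le_trans (_ : _ <= N.+2%:R)) ?ler_nat ?(ltnW nN)// lerDr ltW.
have [E [mE PE hE]] := hC d T P X Y mX mY law n n0.
exists E; split=> //; split; last first.
  apply: le_trans PE _; rewrite lee_fin ler_wpM2r ?invr_ge0 ?(ltW np)//.
  by rewrite lerDl.
move=> t /= hW; apply: contrapT => Et.
have aff := hE t _ Et (hMLE n t).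
have u0 : 0 < ln n%:R / n%:R :> R.
  by rewrite divr_gt0// ln_gt0// ltr1n; apply: leq_trans nN.
set u := ln n%:R / n%:R in u0 hW.
(* [eps = sqrt (A * u)] splits in the final comparison: [sqrt A] belongs to [C0], and [sqrt u]
   produces the factor 2 in the exponent. *)
have eps0 : 0 < Num.sqrt (A * u) by rewrite sqrtr_gt0 mulr_gt0.
have epseta : Num.sqrt (A * u) <= eta.
  rewrite -[leRHS]gtr0_norm// -sqrtr_sqr ler_wsqrtr// mulrC -ler_pdivlMr//.
  by apply: hN; rewrite (leq_trans _ nN)// ltnW.
have Gin := (hMLE n t).1.
have : ((1 - Num.sqrt (A * u) ^+ 2)%:E <= affinity fbar (Ghat n t) G0)%E.
  by rewrite sqr_sqrtr ?(mulr_ge0 (ltW A0) (ltW u0))// /u mulrA.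
move=> /(heta _ _ eps0 epseta Gin); apply/negP; rewrite -ltNge.
rewrite -/G0 -/rsin -/kappa; apply: le_lt_trans hW.
rewrite sqrtrM ?(ltW A0)// mulrA powRM ?mulr_ge0 ?sqrtr_ge0 ?(ltW Cd0)//.
rewrite ler_wpM2l ?powR_ge0// invfM powRrM powR12_sqrt//.
exact: ltW.
Qed.
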